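(* The twisted crossed product $A(4) \rtimes_{\alpha}^{\mathrm{tw}} (K \times K)$ is isomorphic, as a C*-algebra, to $M_4(C(\mathbb{R}P^3))$, the C*-algebra of $4\times 4$ matrices over the continuous complex-valued functions on the real projective space $\mathbb{R}P^3$.
   Context: $A(4)$ is the universal unital C*-algebra generated by projections $\{p_{i,j}\}_{i,j=1}^4$ satisfying $\sum_{i=1}^4 p_{i,j}=1$ for every $j$ and $\sum_{j=1}^4 p_{i,j}=1$ for every $i$. Permutations $\sigma\in\mathfrak{S}_4$ are written in one-line notation $(\sigma(1)\sigma(2)\sigma(3)\sigma(4))$. Put $t_1=(1234)$ (the identity), $t_2=(2143)$, $t_3=(3412)$, $t_4=(4321)$, and let $K=\{t_1,t_2,t_3,t_4\}\subset\mathfrak{S}_4$ (the Klein four group). One has $t_it_j=t_{t_i(j)}$. The group $\mathfrak{S}_4\times\mathfrak{S}_4$ acts on $A(4)$ by $\alpha_{(\sigma,\mu)}(p_{i,j})=p_{\sigma(i),\mu(j)}$; restrict $\alpha$ to $K\times K$. Let $\omega=(1342)\in\mathfrak{S}_4$, and define $\varepsilon\colon\{1,2,3,4\}^2\to\{1,-1\}$ by $\varepsilon(i,j)=1$ if $i=1$ or $j=1$ or $\omega(i)=j$, and $\varepsilon(i,j)=-1$ otherwise. The map $((t_i,t_j),(t_k,t_l))\mapsto \varepsilon(i,k)\varepsilon(j,l)$ is a $2$-cocycle on $K\times K$ with values in $\{1,-1\}$. $A(4) \rtimes_{\alpha}^{\mathrm{tw}} (K \times K)$ is the twisted crossed product of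 the action $\alpha$ of $K\times K$ by this cocycle. That is, it is the universal C*-algebra generated by $A(4)$ as a unital subalgebra together with unitaries $\{u_{i,j}\}_{i,j=1}^4$ such that $u_{i,j}xu_{i,j}^*=\alpha_{(t_i,t_j)}(x)$ for all $i,j$ and all $x\in A(4)$, and $u_{i,j}u_{k,l}=\varepsilon(i,k)\varepsilon(j,l)u_{t_i(k),t_j(l)}$ for all $i,j,k,l$. *)

(* Defs.v *)
From HB Require Import structures.
From mathcomp Require Import all_boot all_order all_algebra all_fingroup.
From mathcomp Require Import boolp classical_sets functions reals topology.
From mathcomp Require Import normedtype sequences.
From mathcomp Require Import complex generic_quotient ring.

Set Implicit Arguments.
Unset Strict Implicit.
Unset Printing Implicit Defensive.

Import Order.TTheory GRing.Theory Num.Theory.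
Import numFieldNormedType.Exports.

Local Open Scope classical_set_scope.
Local Open Scope ring_scope.
Local Open Scope complex_scope.

Local Notation normc := ComplexField.Normc.normc.

(* Unital C*-algebras over R[i], with a real-valued norm. As an algType is a
   nonzero ring, the zero algebra is excluded. *)
HB.mixin Record Algebra_isCStarAlgebra (R : realType) A
    of GRing.Algebra R[i] A := {
  star : A -> A;
  cnorm : A -> R;
  starK : involutive star;
  starD : {morph star : x y / x + y};
  starZ : forall (a : R[i]) (x : A), star (a *: x) = a^* *: star x;
  starM : forall x y : A, star (x * y) = star y * star x;
  cnorm_eq0 : forall x : A, cnorm x = 0 -> x = 0;
  ler_cnormD : forall x y : A, cnorm (x + y) <= cnorm x + cnorm y;
  cnormZ : forall (a : R[i]) (x : A), cnorm (a *: x) = normc a * cnorm x;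
  ler_cnormM : forall x y : A, cnorm (x * y) <= cnorm x * cnorm y;
  cnorm_starM : forall x : A, cnorm (star x * x) = cnorm x ^+ 2;
  cnorm_complete : forall u : nat -> A,
    (forall e : R, 0 < e ->
      \forall m & n \near \oo, cnorm (u m - u n) < e) ->
    exists l : A, cnorm (u n - l) @[n --> \oo] --> (0 : R);
}.

#[short(type="cstarType")]
HB.structure Definition CStarAlgebra (R : realType) :=
  {A of GRing.Algebra R[i] A & Algebra_isCStarAlgebra R A}.

Definition star_hom (R : realType) (A B : cstarType R) (f : A -> B) : Prop :=
  [/\ linear f, monoid_morphism f & {morph f : x / star x}].

Definition cstar_isomorphic (R : realType) (A B : cstarType R) : Prop :=
  exists f : A -> B, star_hom f /\ bijective f.

Section operator_norm.
Variables (R : realType) (n : nat).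
Local Notation C := R[i].
Implicit Types (v w : 'cV[C]_n) (M N : 'M[C]_n).

(* The Euclidean norm on C^n, and the norm of a matrix as an operator on it. *)
Definition vnorm v : R := Num.sqrt (\sum_i normc (v i 0) ^+ 2).

Definition opnorm M : R := sup [set vnorm (M *m v) | v in [set v | vnorm v <= 1]].

Definition adjmx (M : 'M[C]_n) : 'M[C]_n := map_mx Num.conj M^T.

Let rcM (x y : R) : (x * y)%:C = x%:C * y%:C :> C.
Proof. exact: (rmorphM (real_complex R)). Qed.

Let rcD (x y : R) : (x + y)%:C = x%:C + y%:C :> C.
Proof. exact: (rmorphD (real_complex R)). Qed.

Let rcX (x : R) k : (x ^+ k)%:C = x%:C ^+ k :> C.
Proof. exact: (rmorphXn (real_complex R)). Qed.

Let dot v w : C := dotmx v^T w^T.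

Lemma normcE (z : C) : (normc z)%:C = `|z|.
Proof. by []. Qed.

Lemma normc_ge0 (z : C) : 0 <= normc z.
Proof. by rewrite -ler0c normcE. Qed.

Lemma dotE v : dot v v = ((vnorm v) ^+ 2)%:C.
Proof.
rewrite /dot dotmxE mxE sqr_sqrtr; last by apply: sumr_ge0 => i _; exact: sqr_ge0.
rewrite (raddf_sum (real_complex R)); apply: eq_bigr => i _.
rewrite !mxE -normCK -normcE; exact/esym/(rmorphXn (real_complex R)).
Qed.

Lemma vnorm_ge0 v : 0 <= vnorm v. Proof. exact: sqrtr_ge0. Qed.

Lemma sqrt_dot v : sqrtC (dot v v) = (vnorm v)%:C.
Proof. by rewrite dotE rcX sqrCK// ler0c vnorm_ge0. Qed.

Lemma CSdot v w : `|dot v w| <= (vnorm v * vnorm w)%:C.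
Proof.
rewrite rcM -!sqrt_dot.
by have [] := CauchySchwarz_sqrt (@dotmx C n) v^T w^T.
Qed.

Lemma vnormD v w : vnorm (v + w) <= vnorm v + vnorm w.
Proof.
rewrite -lecR rcD -!sqrt_dot /dot linearD.
by have [] := triangle_lerif (@dotmx C n) v^T w^T.
Qed.

Lemma vnormZ a v : vnorm (a *: v) = normc a * vnorm v.
Proof.
rewrite /vnorm -[normc a]ger0_norm ?normc_ge0// -sqrtr_sqr -sqrtrM ?sqr_ge0//.
congr Num.sqrt; rewrite mulr_sumr; apply: eq_bigr => i _.
by rewrite mxE ComplexField.Normc.normcM exprMn.
Qed.

Lemma vnorm0 : vnorm 0 = 0.
Proof. by have := vnormZ 0 0; rewrite scale0r ComplexField.Normc.normc0 mul0r. Qed.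

Lemma vnorm_sum (I : Type) (s : seq I) (F : I -> 'cV[C]_n) :
  vnorm (\sum_(i <- s) F i) <= \sum_(i <- s) vnorm (F i).
Proof.
elim/big_rec2 : _ => [|i y x _ h]; first by rewrite vnorm0.
by rewrite (le_trans (vnormD _ _))// lerD2l.
Qed.

Lemma normc_vnorm v i : normc (v i 0) <= vnorm v.
Proof.
rewrite -(@ler_pXn2r _ 2)// ?nnegrE ?normc_ge0 ?vnorm_ge0//.
rewrite sqr_sqrtr; last by apply: sumr_ge0 => j _; exact: sqr_ge0.
by rewrite (bigD1 i)//= lerDl; apply: sumr_ge0 => j _; exact: sqr_ge0.
Qed.

Lemma vnorm_eq0 v : vnorm v = 0 -> v = 0.
Proof.
move=> v0; apply/colP => i; rewrite mxE; apply: ComplexField.Normc.eq0_normc.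
by apply/eqP; rewrite eq_le normc_ge0 -v0 normc_vnorm.
Qed.

Lemma mulmx_cols M v : M *m v = \sum_j v j 0 *: col j M.
Proof.
apply/colP => i; rewrite mxE summxE; apply: eq_bigr => j _.
by rewrite !mxE mulrC.
Qed.

Lemma vnorm_le_sum v : vnorm v <= \sum_i normc (v i 0).
Proof.
rewrite -(@ler_pXn2r _ 2)// ?nnegrE ?vnorm_ge0//; last first.
  by apply: sumr_ge0 => j _; exact: normc_ge0.
rewrite sqr_sqrtr; last by apply: sumr_ge0 => j _; exact: sqr_ge0.
rewrite expr2 mulr_suml; apply: ler_sum => i _.
rewrite expr2 ler_wpM2l ?normc_ge0// (bigD1 i)//= lerDl.
by apply: sumr_ge0 => j _; exact: normc_ge0.
Qed.

Lemma vnorm_mul_le M v :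
  vnorm (M *m v) <= (\sum_i \sum_j normc (M i j)) * vnorm v.
Proof.
rewrite mulmx_cols (le_trans (vnorm_sum _ _))// exchange_big mulr_suml.
apply: ler_sum => j _; rewrite vnormZ mulrC.
rewrite ler_pM ?normc_ge0 ?vnorm_ge0 ?normc_vnorm//.
rewrite (le_trans (vnorm_le_sum _))//.
by apply: ler_sum => i _; rewrite mxE.
Qed.

Let opset M := [set vnorm (M *m v) | v in [set v | vnorm v <= 1]].

Lemma has_sup_opset M : has_sup (opset M).
Proof.
split; first by exists (vnorm (M *m 0)), 0 => //=; rewrite vnorm0 ler01.
exists (\sum_i \sum_j normc (M i j)) => _ [v /= v1 <-].
rewrite (le_trans (vnorm_mul_le _ _))// ler_piMr//.
by apply: sumr_ge0 => i _; apply: sumr_ge0 => j _; exact: normc_ge0.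
Qed.

Lemma opnorm_ge0 M : 0 <= opnorm M.
Proof.
apply: (le_trans (vnorm_ge0 (M *m 0))); apply: ub_le_sup.
  by have [] := has_sup_opset M.
by exists 0 => //=; rewrite vnorm0 ler01.
Qed.

Lemma vnorm_opnorm M v : vnorm (M *m v) <= opnorm M * vnorm v.
Proof.
have [v0|v0] := eqVneq (vnorm v) 0.
  by rewrite (vnorm_eq0 v0) mulmx0 vnorm0 mulr0.
have vp : 0 < vnorm v by rewrite lt_neqAle eq_sym v0 vnorm_ge0.
have nv : normc ((vnorm v)^-1)%:C = (vnorm v)^-1.
  by apply: complexI; rewrite normcE ger0_norm// ler0c invr_ge0 vnorm_ge0.
rewrite -ler_pdivrMr// mulrC -{1}nv -vnormZ scalemxAr.
apply: ub_le_sup; first by have [] := has_sup_opset M.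
by exists (((vnorm v)^-1)%:C *: v) => //=; rewrite vnormZ nv mulVf.
Qed.

Lemma opnorm_le M (K : R) : 0 <= K ->
  (forall v, vnorm (M *m v) <= K * vnorm v) -> opnorm M <= K.
Proof.
move=> K0 h; apply: ge_sup; first by have [] := has_sup_opset M.
by move=> _ [v /= v1 <-]; rewrite (le_trans (h v))// ler_piMr.
Qed.

Lemma opnorm_le_sum M : opnorm M <= \sum_i \sum_j normc (M i j).
Proof.
apply: opnorm_le; last exact: vnorm_mul_le.
by apply: sumr_ge0 => i _; apply: sumr_ge0 => j _; exact: normc_ge0.
Qed.

Lemma normc_opnorm M i j : normc (M i j) <= opnorm M.
Proof.
have e1 : vnorm (delta_mx j 0) = 1.
  rewrite /vnorm (bigD1 j)// big1 => [|k /negbTE kj].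
    by rewrite mxE !eqxx ComplexField.Normc.normc1 expr1n /= addr0 sqrtr1.
  by rewrite mxE kj ComplexField.Normc.normc0 expr0n.
have -> : M i j = (M *m delta_mx j 0 : 'cV_n) i 0.
  rewrite mxE (bigD1 j)// big1 => [|k /negbTE kj].
    by rewrite mxE !eqxx mulr1 /= addr0.
  by rewrite mxE kj mulr0.
by rewrite (le_trans (normc_vnorm _ _))// (le_trans (vnorm_opnorm _ _))// e1 mulr1.
Qed.

Lemma opnormD M N : opnorm (M + N) <= opnorm M + opnorm N.
Proof.
apply: opnorm_le => [|v]; first by rewrite addr_ge0 ?opnorm_ge0.
by rewrite mulmxDl (le_trans (vnormD _ _))// mulrDl lerD ?vnorm_opnorm.
Qed.

Lemma opnormZ_le a M : opnorm (a *: M) <= normc a * opnorm M.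
Proof.
apply: opnorm_le => [|v]; first by rewrite mulr_ge0 ?normc_ge0 ?opnorm_ge0.
by rewrite -scalemxAl vnormZ -mulrA ler_wpM2l ?normc_ge0 ?vnorm_opnorm.
Qed.

Lemma opnorm_eq0 M : opnorm M = 0 -> M = 0.
Proof.
move=> M0; apply/matrixP => i j; rewrite mxE; apply: ComplexField.Normc.eq0_normc.
by apply/eqP; rewrite eq_le normc_ge0 -M0 normc_opnorm.
Qed.

Lemma opnormM M N : opnorm (M *m N) <= opnorm M * opnorm N.
Proof.
apply: opnorm_le => [|v]; first by rewrite mulr_ge0 ?opnorm_ge0.
rewrite -mulmxA (le_trans (vnorm_opnorm _ _))// -mulrA ler_wpM2l ?opnorm_ge0//.
exact: vnorm_opnorm.
Qed.

Lemma adjmxK : involutive adjmx.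
Proof. by move=> M; apply/matrixP => i j; rewrite !mxE conjCK. Qed.

Lemma adj_dot M v : dot (M *m v) (M *m v) = dot v (adjmx M *m (M *m v)).
Proof.
have adjC : map_mx Num.conj (adjmx M) = M^T.
  by apply/matrixP => i j; rewrite !mxE conjCK.
rewrite /dot !dotmxE !trmxK [in RHS]map_mxM/= adjC mulmxA.
by rewrite [in LHS]trmx_mul.
Qed.

Lemma opnorm_sq_le M : opnorm M ^+ 2 <= opnorm (adjmx M *m M).
Proof.
rewrite -(@sqr_sqrtr _ (opnorm (adjmx M *m M))) ?opnorm_ge0//.
rewrite ler_pXn2r ?nnegrE ?opnorm_ge0 ?sqrtr_ge0//.
apply: opnorm_le => [|v]; first exact: sqrtr_ge0.
rewrite -(@ler_pXn2r _ 2)// ?nnegrE ?mulr_ge0 ?sqrtr_ge0 ?vnorm_ge0//.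
rewrite exprMn [X in _ <= X * _]sqr_sqrtr ?opnorm_ge0// -lecR -dotE adj_dot.
rewrite mulmxA.
rewrite (@le_trans _ _ `|dot v (adjmx M *m M *m v)|)//.
  rewrite -mulmxA -adj_dot dotE ger0_norm// ler0c; exact: sqr_ge0.
rewrite (le_trans (CSdot _ _))// lecR mulrC expr2 mulrA ler_wpM2r ?vnorm_ge0//.
exact: vnorm_opnorm.
Qed.

Lemma opnorm_adj M : opnorm (adjmx M) = opnorm M.
Proof.
suff le N : opnorm N <= opnorm (adjmx N).
  by apply/eqP; rewrite eq_le le -{2}(adjmxK M) le.
have [->|N0] := eqVneq (opnorm N) 0; first exact: opnorm_ge0.
have Np : 0 < opnorm N by rewrite lt_neqAle eq_sym N0 opnorm_ge0.
rewrite -(ler_pM2r Np) -expr2 (le_trans (opnorm_sq_le _))//.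
exact: opnormM.
Qed.

Lemma opnorm_cstar M : opnorm (adjmx M *m M) = opnorm M ^+ 2.
Proof.
apply/eqP; rewrite eq_le opnorm_sq_le andbT (le_trans (opnormM _ _))//.
by rewrite opnorm_adj expr2.
Qed.

End operator_norm.

HB.mixin Record isNonemptyCompact T of Topological T := {
  compact_setT : compact [set: T];
  inhabited_setT : [set: T] !=set0;
}.

#[short(type="compactType")]
HB.structure Definition NonemptyCompact :=
  {T of Topological T & isNonemptyCompact T}.

(* C(X), for the topology of the modulus on R[i]. *)
Definition contC (R : realType) (X : topologicalType) : Type :=
  continuousType X (R[i]^o).

HB.instance Definition _ (R : realType) (X : topologicalType) :=
  Choice.on (contC R X).

Section ring_of_continuous_functions.
Variables (R : realType) (X : topologicalType).
Implicit Types f g h : contC R X.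

Definition Cfun f : X -> R[i]^o := f.

Definition mkC (f : X -> R[i]^o) (cf : continuous f) : contC R X := mkcts cf.

Lemma CcontP f g : (forall x, Cfun f x = Cfun g x) -> f = g.
Proof. by move=> fg; exact/continuousEP. Qed.

Lemma Ccont_continuous f : continuous (Cfun f).
Proof. exact: cts_fun. Qed.

Lemma Cadd_continuous f g : continuous (fun x => Cfun f x + Cfun g x).
Proof. by move=> x; apply: cvgD; exact: Ccont_continuous. Qed.

Lemma Copp_continuous f : continuous (fun x => - Cfun f x).
Proof. by move=> x; apply: cvgN; exact: Ccont_continuous. Qed.

Lemma Cmul_continuous f g : continuous (fun x => Cfun f x * Cfun g x : R[i]^o).
Proof. by move=> x; apply: cvgM; exact: Ccont_continuous. Qed.

Lemma normc_conjc (z : R[i]) : normc z^* = normc z.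
Proof. by case: z => a b /=; rewrite sqrrN. Qed.

Lemma Cconj_continuous f : continuous (fun x => (Cfun f x)^* : R[i]^o).
Proof.
move=> x; apply/cvgrPdist_lt => e e0.
have /cvgrPdist_lt/(_ e e0) := @Ccont_continuous f x.
apply: filterS => y; rewrite -rmorphB /= => h.
by rewrite -normcE normc_conjc.
Qed.

Definition Ccst (a : R[i]) : contC R X := mkC (@cst_continuous X R[i]^o a).
Definition Cadd f g : contC R X := mkC (@Cadd_continuous f g).
Definition Copp f : contC R X := mkC (@Copp_continuous f).
Definition Cmul f g : contC R X := mkC (@Cmul_continuous f g).
Definition Cconj f : contC R X := mkC (@Cconj_continuous f).

Fact CaddA : associative Cadd.
Proof. by move=> f g h; apply: CcontP => x; exact: addrA. Qed.
Fact CaddC : commutative Cadd.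
Proof. by move=> f g; apply: CcontP => x; exact: addrC. Qed.
Fact Cadd0 : left_id (Ccst 0) Cadd.
Proof. by move=> f; apply: CcontP => x; exact: add0r. Qed.
Fact CaddN : left_inverse (Ccst 0) Copp Cadd.
Proof. by move=> f; apply: CcontP => x; exact: addNr. Qed.

HB.instance Definition _ :=
  GRing.isZmodule.Build (contC R X) CaddA CaddC Cadd0 CaddN.

Fact CmulA : associative Cmul.
Proof. by move=> f g h; apply: CcontP => x; exact: mulrA. Qed.
Fact CmulC : commutative Cmul.
Proof. by move=> f g; apply: CcontP => x; exact: mulrC. Qed.
Fact Cmul1 : left_id (Ccst 1) Cmul.
Proof. by move=> f; apply: CcontP => x; exact: mul1r. Qed.
Fact CmulD : left_distributive Cmul Cadd.
Proof. by move=> f g h; apply: CcontP => x; exact: mulrDl. Qed.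

HB.instance Definition _ :=
  GRing.Zmodule_isComPzRing.Build (contC R X) CmulA CmulC Cmul1 CmulD.

End ring_of_continuous_functions.

Section compact.
Variables (R : realType) (X : compactType).

Fact Ccont1_neq0 : (1 : contC R X) != 0.
Proof.
have [x _] := @inhabited_setT X; apply/eqP => /(congr1 (fun f => Cfun f x)).
by move=> h; have /eqP : (1 : R[i]) = 0 := h; rewrite oner_eq0.
Qed.

HB.instance Definition _ := GRing.PzSemiRing_isNonZero.Build (contC R X) Ccont1_neq0.

End compact.

(* M_n(C(X)); its scalars are those of R[i], whereas the canonical module
   structure of a matrix type is over its coefficient ring, hence the alias. *)
Definition mx_contC (R : realType) (X : topologicalType) (n : nat) : Type :=
  'M[contC R X]_n.

Section matrices_of_continuous_functions.
Variables (R : realType) (X : compactType) (n : nat).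
Local Notation M := (mx_contC R X n.+1).
Implicit Types (A B : M) (a b : R[i]).

HB.instance Definition _ := GRing.NzRing.copy M 'M[contC R X]_n.+1.

Definition mx_at A (x : X) : 'M[R[i]]_n.+1 := \matrix_(i, j) Cfun (A i j) x.

Definition MCscale a A : M := \matrix_(i, j) (Ccst X a * A i j).
Definition MCstar A : M := \matrix_(i, j) Cconj (A j i).
Definition MCnorm A : R := sup [set opnorm (mx_at A x) | x in [set: X]].

Lemma MCP A B : (forall x, mx_at A x = mx_at B x) -> A = B.
Proof.
move=> AB; apply/matrixP => i j; apply: CcontP => x.
by have /matrixP/(_ i j) := AB x; rewrite !mxE.
Qed.

Lemma Cfun_sum (f : 'I_n.+1 -> contC R X) x :
  Cfun (\sum_i f i) x = \sum_i Cfun (f i) x.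
Proof.
by apply: (big_morph (fun g : contC R X => Cfun g x : R[i]^o)).
Qed.

Lemma mx_at0 x : mx_at 0 x = 0.
Proof. by apply/matrixP => i j; rewrite !mxE. Qed.
Lemma mx_atD A B x : mx_at (A + B) x = mx_at A x + mx_at B x.
Proof. by apply/matrixP => i j; rewrite !mxE. Qed.
Lemma mx_atN A x : mx_at (- A) x = - mx_at A x.
Proof. by apply/matrixP => i j; rewrite !mxE. Qed.
Lemma mx_atM A B x : mx_at (A * B) x = mx_at A x *m mx_at B x.
Proof.
apply/matrixP => i j; rewrite !mxE Cfun_sum; apply: eq_bigr => k _.
by rewrite !mxE.
Qed.
Lemma mx_atZ a A x : mx_at (MCscale a A) x = a *: mx_at A x.
Proof. by apply/matrixP => i j; rewrite !mxE. Qed.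
Lemma mx_at_star A x : mx_at (MCstar A) x = adjmx (mx_at A x).
Proof. by apply/matrixP => i j; rewrite !mxE. Qed.

Fact MCscalerA a b A : MCscale a (MCscale b A) = MCscale (a * b) A.
Proof. by apply: MCP => x; rewrite !mx_atZ scalerA. Qed.
Fact MCscale1 : left_id 1 MCscale.
Proof. by move=> A; apply: MCP => x; rewrite mx_atZ scale1r. Qed.
Fact MCscaleDr : right_distributive MCscale +%R.
Proof. by move=> a A B; apply: MCP => x; rewrite !(mx_atZ, mx_atD) scalerDr. Qed.
Fact MCscaleDl A : {morph MCscale^~ A : a b / a + b}.
Proof. by move=> a b; apply: MCP => x; rewrite !(mx_atZ, mx_atD) scalerDl. Qed.

HB.instance Definition _ := GRing.Zmodule_isLmodule.Build R[i] M
  MCscalerA MCscale1 MCscaleDr MCscaleDl.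

Lemma mx_at_scale a A x : mx_at (a *: A) x = a *: mx_at A x.
Proof. exact: mx_atZ. Qed.

Fact MCscalerAl a A B : a *: (A * B) = (a *: A) * B.
Proof. by apply: MCP => x; rewrite !(mx_at_scale, mx_atM) scalemxAl. Qed.

HB.instance Definition _ := GRing.Lmodule_isLalgebra.Build R[i] M MCscalerAl.

Fact MCscalerAr a A B : a *: (A * B) = A * (a *: B).
Proof. by apply: MCP => x; rewrite !(mx_at_scale, mx_atM) scalemxAr. Qed.

HB.instance Definition _ := GRing.Lalgebra_isAlgebra.Build R[i] M MCscalerAr.

Fact MCstarK : involutive MCstar.
Proof. by move=> A; apply: MCP => x; rewrite !mx_at_star adjmxK. Qed.
Fact MCstarD : {morph MCstar : A B / A + B}.
Proof.
move=> A B; apply: MCP => x; rewrite !(mx_at_star, mx_atD).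
by apply/matrixP => i j; rewrite !mxE rmorphD.
Qed.
Fact MCstarZ a A : MCstar (a *: A) = a^* *: MCstar A.
Proof.
apply: MCP => x; rewrite !(mx_at_star, mx_at_scale).
by apply/matrixP => i j; rewrite !mxE rmorphM.
Qed.
Fact MCstarM A B : MCstar (A * B) = MCstar B * MCstar A.
Proof.
apply: MCP => x; rewrite !(mx_at_star, mx_atM).
by rewrite /adjmx trmx_mul map_mxM.
Qed.

Lemma Ccont_bounded (f : contC R X) : exists K, forall x, normc (Cfun f x) <= K.
Proof.
have cf : continuous (fun x => normc (Cfun f x) : R).
  move=> x; apply/cvgrPdist_lt => e e0.
  have eC : 0 < e%:C by rewrite ltcR.
  have /cvgrPdist_lt/(_ _ eC) := @Ccont_continuous R X f x.
  apply: filterS => y; rewrite -normcE ltcR; apply: le_lt_trans.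
  exact: (@ler_dist_dist R (Rcomplex R)).
have cpt : compact ((fun x => normc (Cfun f x) : R) @` [set: X]).
  apply: continuous_compact; last exact: compact_setT.
  by apply: continuous_subspaceT.
have [K [Kr Kb]] := compact_bounded cpt.
exists (K + 1) => x; have := Kb (K + 1); rewrite ltrDl ltr01 => /(_ erefl).
move=> /(_ (normc (Cfun f x))) /= h.
by rewrite -[leLHS]ger0_norm ?normc_ge0//; apply: h; exists x.
Qed.

Let supset A := [set opnorm (mx_at A x) | x in [set: X]].

Lemma has_sup_MC A : has_sup (supset A).
Proof.
split; first by have [x _] := @inhabited_setT X; exists (opnorm (mx_at A x)), x.
have /choice[K KP] : forall ij : 'I_n.+1 * 'I_n.+1,
    exists K, forall x, normc (Cfun (A ij.1 ij.2) x) <= K.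
  by move=> ij; exact: Ccont_bounded.
exists (\sum_i \sum_j K (i, j)) => _ [x _ <-].
rewrite (le_trans (opnorm_le_sum _))//.
apply: ler_sum => i _; apply: ler_sum => j _; rewrite mxE.
exact: (KP (i, j)).
Qed.

Lemma opnorm_MCnorm A x : opnorm (mx_at A x) <= MCnorm A.
Proof. by apply: ub_le_sup; [have [] := has_sup_MC A | exists x]. Qed.

Lemma MCnorm_le A K : (forall x, opnorm (mx_at A x) <= K) -> MCnorm A <= K.
Proof.
move=> h; apply: ge_sup; first by have [] := has_sup_MC A.
by move=> _ [x _ <-].
Qed.

Lemma MCnorm_ge0 A : 0 <= MCnorm A.
Proof.
have [x _] := @inhabited_setT X.
by rewrite (le_trans _ (opnorm_MCnorm A x))// opnorm_ge0.
Qed.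

Fact MCnorm_eq0 A : MCnorm A = 0 -> A = 0.
Proof.
move=> A0; apply: MCP => x; rewrite mx_at0; apply: opnorm_eq0.
by apply/eqP; rewrite eq_le opnorm_ge0 -A0 opnorm_MCnorm.
Qed.

Fact ler_MCnormD A B : MCnorm (A + B) <= MCnorm A + MCnorm B.
Proof.
apply: MCnorm_le => x; rewrite mx_atD (le_trans (opnormD _ _))//.
by rewrite lerD// opnorm_MCnorm.
Qed.

Lemma MCnormZ_le a A : MCnorm (a *: A) <= normc a * MCnorm A.
Proof.
apply: MCnorm_le => x; rewrite mx_at_scale (le_trans (opnormZ_le _ _))//.
by rewrite ler_wpM2l ?normc_ge0 ?opnorm_MCnorm.
Qed.

Fact MCnormZ a A : MCnorm (a *: A) = normc a * MCnorm A.
Proof.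
apply/eqP; rewrite eq_le MCnormZ_le/=.
have [->|a0] := eqVneq a 0.
  by rewrite ComplexField.Normc.normc0 mul0r MCnorm_ge0.
have na0 : 0 < normc a by rewrite -ltcR normcE normr_gt0.
rewrite -ler_pdivlMl// -ComplexField.Normc.normcV.
by rewrite -{1}[A](scalerK a0) MCnormZ_le.
Qed.

Fact ler_MCnormM A B : MCnorm (A * B) <= MCnorm A * MCnorm B.
Proof.
apply: MCnorm_le => x; rewrite mx_atM (le_trans (opnormM _ _))//.
by rewrite ler_pM ?opnorm_ge0 ?opnorm_MCnorm.
Qed.

Lemma MCnorm_star A : MCnorm (MCstar A) = MCnorm A.
Proof.
suff le B : MCnorm (MCstar B) <= MCnorm B.
  have := le (MCstar A); rewrite MCstarK => h.
  by apply/le_anti/andP; split; [exact: le | exact: h].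
by apply: MCnorm_le => x; rewrite mx_at_star opnorm_adj opnorm_MCnorm.
Qed.

Fact MCnorm_starM A : MCnorm (MCstar A * A) = MCnorm A ^+ 2.
Proof.
apply/le_anti/andP; split.
  by apply: le_trans (ler_MCnormM _ _) _; rewrite (MCnorm_star A) expr2.
have N0 := MCnorm_ge0 (MCstar A * A).
rewrite -(sqr_sqrtr N0) ler_pXn2r ?nnegrE ?MCnorm_ge0 ?sqrtr_ge0//.
apply: MCnorm_le => x.
rewrite -(@ler_pXn2r _ 2)// ?nnegrE ?opnorm_ge0 ?sqrtr_ge0//.
rewrite (sqr_sqrtr N0) -opnorm_cstar -mx_at_star -mx_atM.
exact: opnorm_MCnorm.
Qed.

Lemma MCnormB A B : MCnorm (A - B) = MCnorm (B - A).
Proof.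
have := MCnormZ (-1) (A - B); rewrite scaleN1r opprB => ->.
suff -> : normc (-1 : R[i]) = 1 by rewrite mul1r.
by apply: complexI; rewrite normcE normrN1.
Qed.

Lemma normc_MCnorm A i j x : normc (Cfun (A i j) x) <= MCnorm A.
Proof.
have -> : Cfun (A i j) x = mx_at A x i j by rewrite mxE.
by rewrite (le_trans (normc_opnorm _ _ _))// opnorm_MCnorm.
Qed.

Lemma complex_cauchy_cvg (z : nat -> R[i]) :
  (forall e : R, 0 < e -> \forall m & k \near \oo, normc (z m - z k) < e) ->
  exists l, forall e : R, 0 < e -> \forall m \near \oo, normc (z m - l) < e.
Proof.
move=> zC.
have ReN (w : R[i]) : `|complex.Re w| <= normc w.
  case: w => a b /=; rewrite -sqrtr_sqr ler_wsqrtr// lerDl; exact: sqr_ge0.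
have ImN (w : R[i]) : `|complex.Im w| <= normc w.
  case: w => a b /=; rewrite -sqrtr_sqr ler_wsqrtr// lerDr; exact: sqr_ge0.
have real_cvg (y : nat -> R) :
    (forall e : R, 0 < e -> \forall m & k \near \oo, `|y m - y k| < e) ->
    cvg (y @ \oo).
  move=> yC; apply/cauchy_cvgP/cauchy_ballP => e e0.
  rewrite near_simpl. exact: (yC _ e0).
have cR : cvg ((fun k => complex.Re (z k)) @ \oo).
  apply: real_cvg => e e0; have := zC _ e0; apply: filterS => -[m k] /= h.
  by rewrite (le_lt_trans _ h)// (le_trans _ (ReN _))//; case: (z m) (z k) => ? ? [].
have cI : cvg ((fun k => complex.Im (z k)) @ \oo).
  apply: real_cvg => e e0; have := zC _ e0; apply: filterS => -[m k] /= h.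
  by rewrite (le_lt_trans _ h)// (le_trans _ (ImN _))//; case: (z m) (z k) => ? ? [].
exists (lim ((fun k => complex.Re (z k)) @ \oo) +i* lim ((fun k => complex.Im (z k)) @ \oo)).
move=> e e0; have e2 : 0 < e / 2 by rewrite divr_gt0.
have /cvgrPdist_lt/(_ _ e2) hR := cR.
have /cvgrPdist_lt/(_ _ e2) hI := cI.
near=> m.
have gR : `|lim ((fun k => complex.Re (z k)) @ \oo) - complex.Re (z m)| < e / 2.
  by near: m; exact: hR.
have gI : `|lim ((fun k => complex.Im (z k)) @ \oo) - complex.Im (z m)| < e / 2.
  by near: m; exact: hI.
set a := lim _ in gR *; set b := lim _ in gI *.
have -> : z m - (a +i* b) =
    (complex.Re (z m) - a)%:C + (complex.Im (z m) - b) *i.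
  by case: (z m) => c d; apply/eqP; rewrite eq_complex /= addr0 add0r !eqxx.
rewrite (le_lt_trans (le_normcD _ _))// [ltRHS]splitr ltrD//.
  by rewrite /= expr0n /= addr0 sqrtr_sqr distrC.
by rewrite /= expr0n /= add0r sqrtr_sqr distrC.
Unshelve. all: by end_near. Qed.

Fact MCnorm_complete (u : nat -> M) :
  (forall e : R, 0 < e -> \forall m & k \near \oo, MCnorm (u m - u k) < e) ->
  exists l : M, MCnorm (u k - l) @[k --> \oo] --> (0 : R).
Proof.
move=> uC.
have atB A B i j x : Cfun ((A - B) i j) x = Cfun (A i j) x - Cfun (B i j) x.
  by rewrite !mxE.
have /choice[L LP] : forall ijx : 'I_n.+1 * 'I_n.+1 * X, exists l,
    forall e : R, 0 < e -> \forall m \near \oo,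
      normc (Cfun (u m ijx.1.1 ijx.1.2) ijx.2 - l) < e.
  move=> [[i j] x] /=; apply: complex_cauchy_cvg => e e0.
  have := uC _ e0; apply: filterS => -[m k] /=; apply: le_lt_trans.
  by rewrite -atB normc_MCnorm.
have Lunif (e : R) : 0 < e -> \forall m \near \oo, forall i j x,
    normc (Cfun (u m i j) x - L (i, j, x)) <= e.
  move=> e0; have [[P Q] /= [Poo Qoo] PQ] := uC _ e0.
  apply: filterS Poo => m Pm i j x; apply/ler_addgt0Pr => d d0.
  near \oo => k.
  have -> : Cfun (u m i j) x - L (i, j, x) =
      Cfun ((u m - u k) i j) x + (Cfun (u k i j) x - L (i, j, x)).
    by rewrite atB addrA subrK.
  rewrite (le_trans (le_normcD _ _))// lerD//.
    rewrite (le_trans (normc_MCnorm _ _ _ _))//; apply/ltW/(PQ (m, k)).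
    by split => //=; near: k.
  by apply: ltW; near: k; exact: (LP (i, j, x)).
have Lc i j : continuous (fun x => L (i, j, x) : R[i]^o).
  move=> x; apply/cvgrPdist_lt => e e0.
  have [r r0 re] : exists2 r : R, 0 < r & e = r%:C.
    by move: e0; case: (e) => a b /=; rewrite ltcE /= => /andP[/eqP -> a0]; exists a.
  have r3 : 0 < r / 3 by rewrite divr_gt0.
  have r3C : 0 < (r / 3)%:C by rewrite ltcR.
  near \oo => m.
  have um y : normc (Cfun (u m i j) y - L (i, j, y)) <= r / 3.
    by move: y; near: m; apply: filterS (Lunif _ r3) => m + y; apply.
  have /cvgrPdist_lt/(_ _ r3C) := @Ccont_continuous R X (u m i j) x.
  apply: filterS => y; rewrite -normcE ltcR => h.
  rewrite re -normcE ltcR.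
  have -> : L (i, j, x) - L (i, j, y) =
      (Cfun (u m i j) x - Cfun (u m i j) y) +
      ((Cfun (u m i j) y - L (i, j, y)) - (Cfun (u m i j) x - L (i, j, x))).
    by rewrite opprB addrACA [in RHS]addrA; ring.
  rewrite (le_lt_trans (le_normcD _ _))//.
  have -> : r = r / 3 + (r / 3 + r / 3) by field.
  rewrite ltr_leD// (le_trans (le_normcD _ _))// lerD//.
  by rewrite normcN.
pose l : M := \matrix_(i, j) mkC (Lc i j).
exists l; apply/cvgrPdist_le => e e0.
pose c : R := (n.+1 * n.+1)%:R.
have c0 : 0 < c by rewrite ltr0n.
have ec : 0 < e / c by rewrite divr_gt0.
apply: filterS (Lunif _ ec) => m um.
rewrite sub0r normrN ger0_norm ?MCnorm_ge0//.
apply: MCnorm_le => x; rewrite (le_trans (opnorm_le_sum _))//.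
rewrite (@le_trans _ _ (\sum_(i < n.+1) \sum_(j < n.+1) e / c))//.
  apply: ler_sum => i _; apply: ler_sum => j _; rewrite mxE atB.
  have -> : l i j = mkC (Lc i j) by rewrite mxE.
  exact: um.
rewrite !sumr_const !card_ord -mulrnA -[X in X <= _]mulr_natr.
by rewrite /c mulrAC -mulrA divff ?mulr1// lt0r_neq0.
Unshelve. all: by end_near. Qed.

HB.instance Definition _ := @Algebra_isCStarAlgebra.Build R M
  MCstar MCnorm MCstarK MCstarD MCstarZ MCstarM MCnorm_eq0 ler_MCnormD MCnormZ
  ler_MCnormM MCnorm_starM MCnorm_complete.

End matrices_of_continuous_functions.

Lemma compact_set_type (T : topologicalType) (A : set T) :
  compact A -> compact [set: A].
Proof.
move=> cA F PF _.
have PG : ProperFilter (set_val @ F) by exact: fmap_proper_filter.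
have GA : (set_val @ F) A by apply: (@filterS _ F _ setT) => [x _|]; [exact: set_valP|exact: filterT].
have [p [Ap clp]] := cA _ PG GA.
exists (SigSub (mem_set Ap)); split=> // B U FB.
move=> [_ [[V oV <-] Vp VU]].
have GB : (set_val @ F) (set_val @` B).
  by apply: (@filterS _ F _ B) => // x Bx; exists x.
have nV : nbhs p V by apply: open_nbhs_nbhs; split.
have [q [[x Bx <-] Vq]] := clp _ V GB nV.
by exists x; split => //; exact: VU.
Qed.

Section RPn.
Variables (R : realType) (n : nat).

Definition sphere : set 'rV[R]_n.+1 := [set v | \sum_i v 0 i ^+ 2 = 1].

Definition antipodal (v w : sphere) : bool :=
  (val v == val w) || (val v == - val w).

Fact antipodal_refl : reflexive antipodal.
Proof. by move=> v; rewrite /antipodal eqxx. Qed.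

Fact antipodal_sym : symmetric antipodal.
Proof.
move=> v w; rewrite /antipodal eq_sym; congr (_ || _).
by apply/eqP/eqP => ->; rewrite opprK.
Qed.

Fact antipodal_trans : transitive antipodal.
Proof.
move=> v u w /orP[]/eqP uv /orP[]/eqP vw; rewrite /antipodal uv vw ?opprK eqxx ?orbT//.
Qed.

Definition antipodal_equiv :=
  EquivRel antipodal antipodal_refl antipodal_sym antipodal_trans.

Definition real_projective_space : Type :=
  quotient_topology {eq_quot antipodal_equiv}%qT.

HB.instance Definition _ := Topological.on real_projective_space.

Lemma sphere_compact : compact sphere.
Proof.
apply: bounded_closed_compact.
  exists 1; split => // x x1 v /= v1; rewrite (le_trans _ (ltW x1))//.
  rewrite /Num.norm/= mx_normrE; apply/bigmax_leP; split => //= -[i j] _ /=.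
  rewrite (ord1 i) -(@ler_pXn2r _ 2)// ?nnegrE// expr1n.
  rewrite real_normK ?num_real// -v1 (bigD1 j)//= lerDl.
  by apply: sumr_ge0 => k _; exact: sqr_ge0.
have -> : sphere = (fun v : 'rV[R]_n.+1 => \sum_i v 0 i ^+ 2) @^-1` [set (1 : R)].
  by [].
apply: preimage_closed; last exact: closed_eq.
move=> v _; move: v; apply: continuous_big => [|i _ v]; first exact: add_continuous.
have cc := @coord_continuous R 1 n.+1 0 i v.
exact: (cvgM cc cc).
Qed.

Fact RP_compact : compact [set: real_projective_space].
Proof.
have cS : compact [set: sphere].
  exact/compact_set_type/sphere_compact.
pose pi := (\pi_real_projective_space : sphere -> real_projective_space)%qT.
have -> : [set: real_projective_space] = pi @` [set: sphere].
  apply/seteqP; split => // q _; exists (repr q) => //; exact: reprK.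
apply: continuous_compact => //; apply: continuous_subspaceT.
exact: pi_continuous.
Qed.

Fact RP_inhabited : [set: real_projective_space] !=set0.
Proof.
have v1 : (delta_mx 0 0 : 'rV[R]_n.+1) \in sphere.
  rewrite inE /sphere/= (bigD1 ord0)//= mxE !eqxx expr1n big1 ?addr0// => i /negbTE i0.
  by rewrite mxE i0 andbF expr0n.
by exists (\pi_real_projective_space (SigSub v1))%qT.
Qed.

HB.instance Definition _ := isNonemptyCompact.Build
  real_projective_space RP_compact RP_inhabited.
End RPn.

Definition projection (R : realType) (A : cstarType R) (x : A) : Prop :=
  star x = x /\ x * x = x.

Definition unitary (R : realType) (A : cstarType R) (x : A) : Prop :=
  star x * x = 1 /\ x * star x = 1.

Definition magic_square (R : realType) (A : cstarType R)
    (p : 'I_4 -> 'I_4 -> A) : Prop :=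
  [/\ forall i j, projection (p i j),
      forall j, \sum_i p i j = 1 &
      forall i, \sum_j p i j = 1].

(* (A, p) has the universal property that defines A(4); existence and uniqueness
   of f together say that A is universal and generated by the entries of p. *)
Definition universal_magic_square (R : realType) (A : cstarType R)
    (p : 'I_4 -> 'I_4 -> A) : Prop :=
  magic_square p /\
  forall (D : cstarType R) (q : 'I_4 -> 'I_4 -> D), magic_square q ->
    exists! f : A -> D, star_hom f /\ forall i j, f (p i j) = q i j.

(* A(4) being universal, these equations determine alpha. *)
Definition magic_action (R : realType) (A : cstarType R)
    (p : 'I_4 -> 'I_4 -> A) (alpha : 'S_4 * 'S_4 -> A -> A) : Prop :=
  forall s m : 'S_4, star_hom (alpha (s, m)) /\
    forall i j, alpha (s, m) (p i j) = p (s i) (m j).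

(* One-line notation with values written in 1..4; 'I_4 is {0, .., 3}. *)
Definition oneline (s : seq nat) (i : 'I_4) : 'I_4 := inord (nth 1%N s i).-1.

Lemma oneline_inj (s : seq nat) :
  perm_eq s [:: 1; 2; 3; 4]%N -> injective (oneline s).
Proof.
move=> ps i j /(congr1 val).
have s4 : size s = 4%N by rewrite (perm_size ps).
have bnd (k : 'I_4) : (0 < nth 1 s k < 5)%N.
  have : nth 1%N s k \in s by rewrite mem_nth// s4.
  by rewrite (perm_mem ps) !inE => /or4P[] /eqP ->.
have us : uniq s by rewrite (perm_uniq ps).
have lt4 (k : 'I_4) : ((nth 1%N s k).-1 < 4)%N.
  by move: (bnd k); case: (nth _ _ _).
rewrite /oneline /= !inordK//.
move=> ij; apply/val_inj/eqP.
have sz (k : 'I_4) : (k < size s)%N by rewrite s4.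
rewrite -(nth_uniq 1%N (sz i) (sz j) us); apply/eqP.
by move: (bnd i) (bnd j) ij; case: (nth _ s i) => // a; case: (nth _ s j) => // b _ _ /= ->.
Qed.

Definition klein_line (i : 'I_4) : seq nat :=
  nth [::] [:: [:: 1; 2; 3; 4]; [:: 2; 1; 4; 3];
               [:: 3; 4; 1; 2]; [:: 4; 3; 2; 1]]%N i.

Fact klein_line_perm i : perm_eq (klein_line i) [:: 1; 2; 3; 4]%N.
Proof. by case: i => [[|[|[|[|]]]]]. Qed.

Definition klein (i : 'I_4) : 'S_4 := perm (oneline_inj (klein_line_perm i)).

Fact omega_perm : perm_eq [:: 1; 3; 4; 2]%N [:: 1; 2; 3; 4]%N.
Proof. by []. Qed.

Definition omega : 'S_4 := perm (oneline_inj omega_perm).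

Lemma kleinE i j : klein i j = inord (nth 1%N (klein_line i) j).-1.
Proof. by rewrite permE. Qed.

(* perm composes left to right, which is immaterial in this abelian subgroup. *)
Lemma klein_mul i j : (klein i * klein j)%g = klein (klein i j).
Proof.
apply/permP => k; apply/val_inj.
rewrite permM !kleinE /klein_line; move: i j k.
by do 3!case=> [[|[|[|[|//]]]]] ?; rewrite /= ?inordK.
Qed.

Definition epsilon (i j : 'I_4) : int :=
  if [|| i == ord0, j == ord0 | omega i == j] then 1 else -1.

Lemma epsilonE i j : epsilon i j = nth 0 (nth [::]
 [:: [:: 1; 1; 1; 1]; [:: 1; -1; 1; -1]; [:: 1; -1; -1; 1]; [:: 1; 1; -1;-1]] i) j.
Proof.
rewrite /epsilon -!val_eqE permE /oneline /=; move: i j.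
by do 2!case=> [[|[|[|[|//]]]]] ?; rewrite /= ?inordK.
Qed.

Lemma epsilon_cocycle i j k :
  epsilon i j * epsilon (klein i j) k = epsilon i (klein j k) * epsilon j k.
Proof.
rewrite !epsilonE !kleinE /klein_line; move: i j k.
by do 3!case=> [[|[|[|[|//]]]]] ?; rewrite /= ?inordK.
Qed.

Definition twisted_covariant (R : realType) (A D : cstarType R)
    (alpha : 'S_4 * 'S_4 -> A -> A) (phi : A -> D) (v : 'I_4 -> 'I_4 -> D) : Prop :=
  [/\ star_hom phi,
      forall i j, unitary (v i j),
      forall i j x, v i j * phi x * star (v i j) = phi (alpha (klein i, klein j) x) &
      forall i j k l,
        v i j * v k l = v (klein i k) (klein j l) *~ (epsilon i k * epsilon j l)].

(* (B, iota, u) is universal among the covariant pairs; A sits in B through the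
   unital embedding iota. *)
Definition twisted_crossed_product (R : realType) (A B : cstarType R)
    (alpha : 'S_4 * 'S_4 -> A -> A) (iota : A -> B) (u : 'I_4 -> 'I_4 -> B) : Prop :=
  [/\ injective iota,
      twisted_covariant alpha iota u &
      forall (D : cstarType R) (phi : A -> D) (v : 'I_4 -> 'I_4 -> D),
        twisted_covariant alpha phi v ->
        exists! f : B -> D,
          [/\ star_hom f, forall x, f (iota x) = phi x &
              forall i j, f (u i j) = v i j]].

(* Main.v *)
Require Import Defs.
From HB Require Import structures.
From mathcomp Require Import all_boot all_order all_algebra all_fingroup.
From mathcomp Require Import boolp classical_sets functions reals topology.
From mathcomp Require Import normedtype sequences derive complex.
From mathcomp Require Import ring lra generic_quotient.

(** For the quaternion basis c_1 = 1, c_2, c_3, c_4 the maps x |-> c_k x c_l^*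
    are a projective representation of K x K on R^4 with the given cocycle, and
    their sixteen matrices are a basis of M_4(C). So an algebra with unitaries
    u_kl as in the crossed product B is the algebra of 4 x 4 matrices over the
    commutant of these unitaries, an element x having the matrix entry e x for
    the matrix units e = quat_unit u. As p_kl = u_kl p_11 u_kl^*, all that
    remains of the magic square is the 4 x 4 matrix f of the projection p_11.
    Its relations become the following: that the rows and the columns of the
    square have sum 1 kills the antisymmetric part of f and makes its trace 1
    (entry_sym, entry_trace); that p_11 is orthogonal to the rest of its row
    and of its column, being one of several projections with sum 1, kills the
    2 x 2 minors of f (entry_exchange); together these make the entries of f
    commute (entry_commute). Thus f is a self-adjoint, symmetric, idempotent
    matrix of trace 1 with commuting entries, like the matrix of the functions
    x_i x_j on RP^3. Conversely, the lines through the four quaternions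
    c_k x c_l^*, for l or for k variable, are orthogonal, which gives a magic
    square in M_4(C(RP^3)) (concrete_magic_square).

    The analytic part is that such an f over a commutative C*-algebra E extends
    to a homomorphism from C(RP^3) to E with x_i x_j |-> f_ij
    (functional_calculus). It is found as a limit of sums of g(x_m) k_m, for
    points x_m of RP^3 and nonnegative k_m in E with sum 1 such that the sum of
    k_m |x_m x_m^T - f| ^+ 2 is small (exists_quadrature). To get these, f is
    written as an average of real matrices with weights in E
    (exists_barycenter); by a random walk with these matrices as steps
    (random_walk) the spread around f becomes as small as desired; and the
    columns of the resulting matrices are moved to the sphere, which cannot
    increase the distance to f (columns_dist2). Uniform continuity in the form
    |g x - g y| <= e + N |x x^T - y y^T| ^+ 2 (modulus) does the rest. The
    order on E that this uses comes from the square root of 1 - x for a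
    self-adjoint contraction x (sqrt_one_sub).

    The universal properties give Psi : B -> M_4(C(RP^3)), the calculus gives
    Theta : M_4(C(RP^3)) -> B. Theta \o Psi = id holds by uniqueness. Psi \o
    Theta fixes the matrix units and the coordinates; at each point of RP^3 it
    induces a character of C(RP^3) which agrees with the evaluation on the
    coordinates, hence everywhere (character_eval). *)

Set Implicit Arguments.
Unset Strict Implicit.
Unset Printing Implicit Defensive.

Import Order.TTheory GRing.Theory Num.Theory.
Import numFieldNormedType.Exports.

Local Open Scope classical_set_scope.
Local Open Scope ring_scope.
Local Open Scope complex_scope.

Local Notation normc := ComplexField.Normc.normc.

(** * Norm and limits *)

Section cstar_norm.
Variables (R : realType) (A : cstarType R).
Implicit Types (x y z : A) (r t : R) (u v : nat -> A).

Lemma normc_real r : normc (r%:C) = `|r|.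
Proof. by rewrite /= expr0n addr0 sqrtr_sqr. Qed.

Lemma cnorm0 : cnorm (0 : A) = 0.
Proof. by have := cnormZ 0 (0 : A); rewrite scaler0 ComplexField.Normc.normc0 mul0r. Qed.

Lemma cnormN x : cnorm (- x) = cnorm x.
Proof.
rewrite -scaleN1r cnormZ (_ : -1 = (-1)%:C); last by rewrite rmorphN rmorph1.
by rewrite normc_real normrN1 mul1r.
Qed.

Lemma cnorm_ge0 x : 0 <= cnorm x.
Proof. by have := ler_cnormD x (- x); rewrite subrr cnorm0 cnormN; lra. Qed.

Lemma cnormB x y : cnorm (x - y) = cnorm (y - x).
Proof. by rewrite -cnormN opprB. Qed.

Lemma cnorm_distD x y z : cnorm (x - z) <= cnorm (x - y) + cnorm (y - z).
Proof. by rewrite -{1}(subrK y x) -addrA ler_cnormD. Qed.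

Lemma cnorm_star x : cnorm (star x) = cnorm x.
Proof.
suff le y : cnorm y <= cnorm (star y).
  by apply/le_anti; rewrite le andbT -{2}(starK x) le.
have [->|y0] := eqVneq (cnorm y) 0; first exact: cnorm_ge0.
have yp : 0 < cnorm y by rewrite lt_neqAle eq_sym y0 cnorm_ge0.
by rewrite -(ler_pM2r yp) -expr2 -cnorm_starM ler_cnormM.
Qed.

Lemma star0 : star (0 : A) = 0.
Proof. by apply: (addrI (star 0)); rewrite -starD !addr0. Qed.

Lemma starN x : star (- x) = - star x.
Proof. by apply: (addrI (star x)); rewrite -starD !subrr star0. Qed.

Lemma starB x y : star (x - y) = star x - star y.
Proof. by rewrite starD starN. Qed.

Lemma star1 : star (1 : A) = 1.
Proof. by rewrite -[RHS]starK -[star 1 in RHS]mulr1 starM starK mulr1. Qed.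

Lemma star_sum (I : Type) (s : seq I) (P : pred I) (F : I -> A) :
  star (\sum_(i <- s | P i) F i) = \sum_(i <- s | P i) star (F i).
Proof. exact: (big_morph _ starD star0). Qed.

Lemma cnorm1 : cnorm (1 : A) = 1.
Proof.
have n0 : cnorm (1 : A) != 0.
  by apply/eqP => /cnorm_eq0/eqP; rewrite oner_eq0.
by apply: (mulfI n0); rewrite mulr1 -expr2 -cnorm_starM star1 mul1r.
Qed.

(** Real scalars, packaged as a ring morphism so that ring normalises them. *)
Definition rcst r : A := (r%:C)%:A.

Fact rcst_is_zmod_morphism : zmod_morphism rcst.
Proof. by move=> r t; rewrite /rcst rmorphB scalerBl. Qed.

Fact rcst_is_monoid_morphism : monoid_morphism rcst.
Proof.
split; first by rewrite /rcst rmorph1 scale1r.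
by move=> r t; rewrite /rcst rmorphM -scalerA -scalerAl mul1r.
Qed.

HB.instance Definition _ := GRing.isZmodMorphism.Build _ _ rcst rcst_is_zmod_morphism.
HB.instance Definition _ := GRing.isMonoidMorphism.Build _ _ rcst rcst_is_monoid_morphism.

Lemma mul_rcst r x : rcst r * x = r%:C *: x.
Proof. by rewrite -scalerAl mul1r. Qed.

Lemma rcstC r x : rcst r * x = x * rcst r.
Proof. by rewrite mul_rcst -scalerAr mulr1. Qed.

Lemma star_rcst r : star (rcst r) = rcst r.
Proof.
rewrite /rcst starZ star1; congr (_ *: _).
by apply/eqP; rewrite eq_complex /= oppr0 !eqxx.
Qed.

Lemma cnormMr r x : cnorm (rcst r * x) = `|r| * cnorm x.
Proof. by rewrite mul_rcst cnormZ normc_real. Qed.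

Lemma cnorm_rcst r : cnorm (rcst r) = `|r|.
Proof. by rewrite -[rcst r]mulr1 cnormMr cnorm1 mulr1. Qed.

(** By the C*-identity, applied k times. *)
Lemma cnormX_sa x k : star x = x -> cnorm (x ^+ (2 ^ k)) = cnorm x ^+ (2 ^ k).
Proof.
move=> sx; elim: k => [|k IH]; first by rewrite expn0 !expr1.
have sxk : star (x ^+ (2 ^ k)) = x ^+ (2 ^ k).
  elim: (2 ^ k)%N => [|m IHm]; first by rewrite !expr0 star1.
  by rewrite exprSr starM IHm sx -exprS exprSr.
by rewrite expnSr !exprM expr2 -{1}sxk cnorm_starM IH.
Qed.

(** A self-adjoint element all of whose powers have a common bound is a
    contraction, since its norm is multiplicative along the powers 2 ^ k. *)
Lemma cnorm_le1_pow x K : star x = x ->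
  (forall k, cnorm (x ^+ (2 ^ k)) <= K) -> cnorm x <= 1.
Proof.
move=> sx xK; rewrite leNgt; apply/negP => x1.
have x0 : 0 < cnorm x - 1 by rewrite subr_gt0.
have ge k : 1 + k%:R * (cnorm x - 1) <= cnorm x ^+ k.
  elim: k => [|k IH]; first by rewrite mul0r addr0.
  rewrite exprSr (le_trans _ (ler_wpM2r (cnorm_ge0 x) IH))// -natr1.
  have : 0 <= k%:R * (cnorm x - 1) ^+ 2 by rewrite mulr_ge0 ?ler0n ?sqr_ge0.
  by lra.
have := archi_boundP (_ : 0 <= `|K| / (cnorm x - 1)).
set k := Num.bound _ => h.
have {}h : `|K| < k%:R * (cnorm x - 1).
  by rewrite -ltr_pdivrMr// h// mulr_ge0// invr_ge0 ltW.
have := xK k; rewrite cnormX_sa//; apply/negP; rewrite -ltNge.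
rewrite (le_lt_trans (ler_norm K))// (lt_le_trans h)//.
rewrite (le_trans _ (ge _))// -[leLHS]add0r lerD// ler_wpM2r ?(ltW x0)//.
by rewrite ler_nat ltnW// ltn_expl.
Qed.

(** Convergence for cnorm, which is not the norm of a normed module. *)
Definition tends_to u (l : A) :=
  forall e : R, 0 < e -> exists N, forall n, (N <= n)%N -> cnorm (u n - l) < e.

Lemma cauchy_tends_to u :
  (forall e : R, 0 < e -> exists N, forall m n, (N <= m)%N -> (N <= n)%N ->
    cnorm (u m - u n) < e) ->
  exists l, tends_to u l.
Proof.
move=> uC; have [|l ul] := @cnorm_complete R A u.
  move=> e /uC[N NP]; exists ([set m | (N <= m)%N], [set m | (N <= m)%N]) => /=.
    by split; exists N.
  by move=> [m n] /= [Nm Nn]; exact: NP.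
exists l => e e0; have /cvgrPdist_lt/(_ _ e0)[N _ NP] := ul.
exists N => n Nn; have := NP n Nn.
by rewrite /= sub0r normrN ger0_norm ?cnorm_ge0.
Qed.

Lemma tends_to_unique u l l' : tends_to u l -> tends_to u l' -> l = l'.
Proof.
move=> ul ul'; apply/eqP; rewrite -subr_eq0; apply/eqP/cnorm_eq0/eqP.
rewrite eq_le cnorm_ge0 andbT; apply/ler_addgt0Pr => e e0; rewrite add0r.
have e2 : 0 < e / 2 by rewrite divr_gt0.
have [N NP] := ul _ e2; have [M MP] := ul' _ e2.
rewrite (le_trans (cnorm_distD _ (u (N + M)%N) _))// [leRHS]splitr lerD//.
  by rewrite cnormB ltW// NP// leq_addr.
by rewrite ltW// MP// leq_addl.
Qed.

Lemma tends_to_cst l : tends_to (fun=> l) l.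
Proof. by move=> e e0; exists 0%N => n _; rewrite subrr cnorm0. Qed.

Lemma tends_toD u v l l' : tends_to u l -> tends_to v l' ->
  tends_to (fun n => u n + v n) (l + l').
Proof.
move=> ul vl e e0; have e2 : 0 < e / 2 by rewrite divr_gt0.
have [N NP] := ul _ e2; have [M MP] := vl _ e2.
exists (N + M)%N => n nNM; rewrite opprD addrACA (le_lt_trans (ler_cnormD _ _))//.
rewrite [ltRHS]splitr ltrD// ?NP ?MP//; first exact: leq_trans (leq_addr _ _) nNM.
exact: leq_trans (leq_addl _ _) nNM.
Qed.

Lemma tends_toM u v l l' : tends_to u l -> tends_to v l' ->
  tends_to (fun n => u n * v n) (l * l').
Proof.
move=> ul vl e e0; pose K := cnorm l + cnorm l' + 1.
have K0 : 0 < K by rewrite ltr_wpDl// addr_ge0 ?cnorm_ge0.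
pose d := Num.min 1 (e / (2 * K)).
have d0 : 0 < d by rewrite lt_min ltr01 divr_gt0// mulr_gt0.
have [N NP] := ul _ d0; have [M MP] := vl _ d0.
exists (N + M)%N => n nNM.
have {NP} un := NP n (leq_trans (leq_addr _ _) nNM).
have {MP} vn := MP n (leq_trans (leq_addl _ _) nNM).
have -> : u n * v n - l * l' = (u n - l) * (v n - l') + (u n - l) * l' + l * (v n - l').
  by rewrite (mulrBl (v n - l')) addrAC subrK mulrBr mulrBl addrA subrK.
have d1 : d <= 1 by rewrite ge_min lexx.
have dK : d * (2 * K) <= e by rewrite -ler_pdivlMr ?mulr_gt0// ge_min lexx orbT.
rewrite (le_lt_trans (ler_cnormD _ _))//.
have h1 := ler_cnormD ((u n - l) * (v n - l')) ((u n - l) * l').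
have h2 := ler_cnormM (u n - l) (v n - l').
have h3 := ler_cnormM (u n - l) l'.
have h4 := ler_cnormM l (v n - l').
have h5 : cnorm (u n - l) * cnorm (v n - l') <= d * 1.
  by rewrite ler_pM ?cnorm_ge0// ltW// (lt_le_trans vn).
have h6 : cnorm (u n - l) * cnorm l' <= d * cnorm l' by rewrite ler_wpM2r ?cnorm_ge0// ltW.
have h7 : cnorm l * cnorm (v n - l') <= cnorm l * d by rewrite ler_wpM2l ?cnorm_ge0// ltW.
have h8 : 0 < d * K by rewrite mulr_gt0.
by move: dK h8; rewrite /K => dK h8; lra.
Qed.

Lemma tends_toZ (a : R[i]) u l : tends_to u l -> tends_to (fun n => a *: u n) (a *: l).
Proof.
move=> ul; have := tends_toM (tends_to_cst a%:A) ul.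
rewrite -scalerAl mul1r; congr tends_to; apply: funext => n.
by rewrite -scalerAl mul1r.
Qed.

Lemma tends_to_star u l : tends_to u l -> tends_to (fun n => star (u n)) (star l).
Proof.
by move=> ul e /ul[N NP]; exists N => n /NP; rewrite -starB cnorm_star.
Qed.

Lemma tends_to_shift u l : tends_to u l -> tends_to (fun n => u n.+1) l.
Proof.
by move=> ul e /ul[N NP]; exists N => n Nn; apply: NP; rewrite (leq_trans Nn).
Qed.

End cstar_norm.

(** * Positivity *)

Section positivity.
Variables (R : realType) (A : cstarType R).
Implicit Types (x y z s t p q : A) (r : R).

Lemma rcst_half x : rcst A 2^-1 * (x + x) = x.
Proof.
by rewrite mulrDr -mulrDl -rmorphD (_ : 2^-1 + 2^-1 = 1) ?rmorph1 ?mul1r//; lra.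
Qed.

Lemma rcst_mulACA r r' x y :
  (rcst A r * x) * (rcst A r' * y) = rcst A (r * r') * (x * y).
Proof. by rewrite mulrA -[_ * x * _]mulrA -rcstC !mulrA -rmorphM. Qed.

(** The iteration y <- (x + y ^+ 2) / 2 for 1 - sqrt (1 - x), started
    at 0, has nonnegative coefficients: it is dominated by the same iteration
    for the real number 1, which increases and is bounded by 1. Commutation
    with x passes to the limit. *)
Lemma sqrt_one_sub x : star x = x -> cnorm x <= 1 ->
  exists y, [/\ star y = y, (1 - y) * (1 - y) = 1 - x &
                forall z, z * x = x * z -> z * y = y * z].
Proof.
move=> sx x1.
pose y n := iter n (fun y => rcst A 2^-1 * (x + y * y)) 0.
pose r n := iter n (fun r : R => 2^-1 * (1 + r * r)) 0.
have yS n : y n.+1 = rcst A 2^-1 * (x + y n * y n) by [].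
have rS n : r n.+1 = 2^-1 * (1 + r n * r n) by [].
have r01 n : 0 <= r n <= 1.
  elim: n => [|n /andP[r0 r1]]; first by rewrite /= ler01 lexx.
  have h0 : 0 <= r n * r n by rewrite mulr_ge0.
  have h1 : r n * r n <= 1 * 1 by rewrite ler_pM.
  by rewrite rS; lra.
have h20 : 0 <= 2^-1 :> R by rewrite invr_ge0.
have yr n : cnorm (y n) <= r n.
  elim: n => [|n IH]; first by rewrite cnorm0.
  rewrite yS rS cnormMr ger0_norm// ler_wpM2l//.
  rewrite (le_trans (ler_cnormD _ _))// lerD// (le_trans (ler_cnormM _ _))//.
  by rewrite ler_pM ?cnorm_ge0.
have yrS n : cnorm (y n.+1 - y n) <= r n.+1 - r n.
  elim: n => [|n IH]; first by rewrite !subr0 yr.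
  have -> : y n.+2 - y n.+1 =
      rcst A 2^-1 * (y n.+1 * (y n.+1 - y n) + (y n.+1 - y n) * y n).
    rewrite yS [y n.+1 in X in _ - X]yS -mulrBr; congr (_ * _).
    by rewrite mulrBr mulrBl addrA subrK opprD addrACA subrr add0r.
  have -> : r n.+2 - r n.+1 = 2^-1 * (r n.+1 * (r n.+1 - r n) + (r n.+1 - r n) * r n).
    by rewrite rS [r n.+1 in X in _ - X]rS; ring.
  rewrite cnormMr ger0_norm// ler_wpM2l// (le_trans (ler_cnormD _ _))//.
  by rewrite lerD// (le_trans (ler_cnormM _ _))// ler_pM ?cnorm_ge0.
have ydist m n : (n <= m)%N -> cnorm (y m - y n) <= r m - r n.
  move=> /subnK <-; elim: (m - n)%N => [|k IH]; first by rewrite add0n !subrr cnorm0.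
  rewrite addSn (le_trans (cnorm_distD _ (y (k + n)%N) _))//.
  by have := yrS (k + n)%N; move: IH; lra.
have r_nd : nondecreasing_seq r.
  by apply/nondecreasing_seqP => n; rewrite -subr_ge0 (le_trans (cnorm_ge0 _) (yrS n)).
have r_ub : has_ubound (range r) by exists 1 => _ [n _ <-]; have /andP[] := r01 n.
have rC := nondecreasing_cvgn r_nd r_ub.
have r_le n : r n <= sup (range r) by apply: ub_le_sup => //; exists n.
have [l yl] : exists l, tends_to y l.
  apply: cauchy_tends_to => e e0.
  have /cvgrPdist_lt/(_ _ e0)[N _ NP] := rC.
  have C m n : (N <= n)%N -> (n <= m)%N -> cnorm (y m - y n) < e.
    move=> Nn nm; rewrite (le_lt_trans (ydist _ _ nm))//.
    have /= := NP n Nn; rewrite ger0_norm ?subr_ge0//.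
    by apply: le_lt_trans; rewrite lerD2r.
  exists N => m n Nm Nn; have [nm|/ltnW mn] := leqP n m; first exact: C.
  by rewrite cnormB C.
have ysa n : star (y n) = y n.
  elim: n => [|n IH]; first exact: star0.
  by rewrite yS starM star_rcst -rcstC starD sx starM IH.
exists l; split.
- by apply: tends_to_unique (tends_to_star yl) _;
  under [X in tends_to X]funext do rewrite ysa.
- have lE : l = rcst A 2^-1 * (x + l * l).
    apply: tends_to_unique (tends_to_shift yl) _.
    by apply: tends_toM (tends_to_cst _) _;
      apply: tends_toD (tends_to_cst _) (tends_toM yl yl).
  have l2 : l + l = x + l * l.
    by rewrite {1 2}lE -mulrDr rcst_half.
  have -> : x = l + l - l * l by rewrite l2 addrK.
  by rewrite mulrBl mul1r mulrBr mulr1 -[l + l - _]addrA [in RHS]opprD [in RHS]addrA.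
- move=> z zx; have zy n : z * y n = y n * z.
    elim: n => [|n IH]; first by rewrite mulr0 mul0r.
    by rewrite yS mulrA -rcstC -!mulrA; congr (_ * _);
      rewrite mulrDr mulrDl zx mulrA IH -!mulrA IH.
  apply: tends_to_unique (tends_toM (tends_to_cst z) yl) _.
  by under [X in tends_to X]funext do rewrite zy; exact: tends_toM yl (tends_to_cst z).
Qed.

(** The C*-identity for s + i t, whose real part is s. *)
Lemma cnorm_sqr_le s t : star s = s -> star t = t -> s * t = t * s ->
  cnorm s ^+ 2 <= cnorm (s * s + t * t).
Proof.
move=> ss st cst; pose i : R[i] := 0 +i* 1.
have ii : i * i = -1 by apply/eqP;
  rewrite eq_complex /= !(mul0r, mulr0, mulr1, addr0, sub0r, oppr0) !eqxx.
have ic : Num.conj i = - i by apply/eqP; rewrite eq_complex /= oppr0 !eqxx.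
pose w := s + i *: t.
have sw : star w = s - i *: t by rewrite starD ss starZ st ic scaleNr.
have ww : star w * w = s * s + t * t.
  rewrite sw mulrDr !mulrBl -!scalerAl -!scalerAr scalerA ii scaleN1r opprK.
  by rewrite -cst addrA subrK.
have sE : s = rcst A 2^-1 * (w + star w).
  by rewrite sw addrACA subrr addr0 rcst_half.
rewrite -ww cnorm_starM sE cnormMr ger0_norm ?invr_ge0//.
rewrite ler_pXn2r ?nnegrE ?mulr_ge0 ?invr_ge0 ?cnorm_ge0//.
by have := ler_cnormD w (star w); rewrite cnorm_star; lra.
Qed.

(** Positivity in a form that is closed under sums by the triangle inequality;
    that it describes the squares of self-adjoint elements is the content of
    nonneg_sqr and nonneg_sqrt. *)
Definition nonneg x := star x = x /\ exists t : R, cnorm (rcst A t - x) <= t.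

Lemma nonneg_rcst r : 0 <= r -> nonneg (rcst A r).
Proof. by move=> r0; split; [exact: star_rcst|exists r; rewrite subrr cnorm0]. Qed.

Lemma nonnegD x y : nonneg x -> nonneg y -> nonneg (x + y).
Proof.
move=> [sx [t xt]] [sy [u yu]]; split; first by rewrite starD sx sy.
by exists (t + u); rewrite rmorphD opprD addrACA (le_trans (ler_cnormD _ _))// lerD.
Qed.

Lemma nonneg_sum (I : Type) (r : seq I) (P : pred I) (F : I -> A) :
  (forall i, P i -> nonneg (F i)) -> nonneg (\sum_(i <- r | P i) F i).
Proof.
move=> F0; elim/big_rec: _ => [|i x Pi x0]; last exact: nonnegD (F0 _ Pi) x0.
by rewrite -(rmorph0 (rcst A)); apply: nonneg_rcst.
Qed.

Lemma nonneg_rcst_sub x : star x = x -> nonneg (rcst A (cnorm x) - x).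
Proof.
move=> sx; split; first by rewrite starB star_rcst sx.
by exists (cnorm x); rewrite opprB addrC subrK.
Qed.

(** Here t^-1 x = 1 - y for a contraction y. *)
Lemma nonneg_sqrt x : nonneg x ->
  exists s, [/\ star s = s, s * s = x & forall z, z * x = x * z -> z * s = s * z].
Proof.
move=> [sx [t xt]]; have t0 : 0 <= t := le_trans (cnorm_ge0 _) xt.
have [te|tn0] := eqVneq t 0.
  exists 0; split; [exact: star0| |by move=> z; rewrite mulr0 mul0r].
  move: xt; rewrite te rmorph0 sub0r cnormN => x0.
  by rewrite mulr0; apply/esym/cnorm_eq0/le_anti; rewrite x0 cnorm_ge0.
have tp : 0 < t by rewrite lt_neqAle eq_sym tn0.
pose x' := 1 - rcst A t^-1 * x.
have [||y [sy yy yc]] := @sqrt_one_sub x'.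
- by rewrite starB star1 starM star_rcst sx -rcstC.
- have -> : x' = rcst A t^-1 * (rcst A t - x).
    by rewrite mulrBr -rmorphM mulVf// rmorph1.
  by rewrite cnormMr ger0_norm ?invr_ge0// mulrC ler_pdivrMr// mul1r.
exists (rcst A (Num.sqrt t) * (1 - y)); split.
- by rewrite starM star_rcst starB star1 sy -rcstC.
- rewrite rcst_mulACA -expr2 sqr_sqrtr// yy.
  by rewrite /x' opprB addrC subrK mulrA -rmorphM divff// rmorph1 mul1r.
- move=> z zx; rewrite mulrA -rcstC -!mulrA; congr (_ * _).
  rewrite mulrBr mulrBl mulr1 mul1r yc// /x' mulrBr mulrBl mulr1 mul1r.
  by rewrite mulrA -rcstC -!mulrA zx.
Qed.

(** For a contraction s the square root k of 1 - s ^+ 2 satisfies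
    s ^+ 2 + k ^+ 2 = 1, so it is a contraction, too. *)
Lemma nonneg_sqr s : star s = s -> nonneg (s * s).
Proof.
move=> ss; split; first by rewrite starM ss.
pose n := cnorm (s * s); exists n.
have [n0|n0] := eqVneq n 0.
  by rewrite n0 rmorph0 sub0r cnormN -/n n0.
have np : 0 < n by rewrite lt_neqAle eq_sym n0 cnorm_ge0.
pose r := Num.sqrt n^-1; have r2 : r * r = n^-1.
  by rewrite -expr2 sqr_sqrtr// invr_ge0 ltW.
pose s' := rcst A r * s; have ss' : s' * s' = rcst A n^-1 * (s * s).
  by rewrite /s' rcst_mulACA r2.
have sas' : star s' = s' by rewrite /s' starM star_rcst ss -rcstC.
have [||y [sy yy yc]] := @sqrt_one_sub (s' * s').
- by rewrite starM sas'.
- by rewrite ss' cnormMr ger0_norm ?invr_ge0 ?(ltW np)// -/n mulVf.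
have cs : s' * (1 - y) = (1 - y) * s'.
  by rewrite mulrBr mulrBl mulr1 mul1r yc// mulrA.
have sy1 : star (1 - y) = 1 - y by rewrite starB star1 sy.
have k1 := cnorm_sqr_le sy1 sas' (esym cs).
move: k1; rewrite yy subrK cnorm1 -cnorm_starM sy1 yy => k1.
have -> : rcst A n - s * s = rcst A n * (1 - s' * s').
  by rewrite mulrBr mulr1 ss' [rcst A n * _]mulrA -rmorphM divff// rmorph1 mul1r.
by rewrite cnormMr ger0_norm ?(ltW np)// ler_piMr// (ltW np).
Qed.

(** The square roots s of x and t of - x commute and s ^+ 2 + t ^+ 2 = 0. *)
Lemma nonneg_anti x : nonneg x -> nonneg (- x) -> x = 0.
Proof.
move=> /nonneg_sqrt[s [ss sx sc]] /nonneg_sqrt[t [st tx tc]].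
have cst : s * t = t * s by apply: tc; rewrite mulrN mulNr -sx mulrA.
have := cnorm_sqr_le ss st cst; rewrite sx tx subrr cnorm0 => s0.
suff se : s = 0 by rewrite -sx se mulr0.
apply/cnorm_eq0/eqP; rewrite -sqrf_eq0; apply/eqP/le_anti.
by rewrite s0 sqr_ge0.
Qed.

(** * Orthogonality of projections with sum 1 *)

Lemma cnorm_projection p : projection p -> cnorm p <= 1.
Proof.
move=> [sp pp]; have := cnorm_starM p; rewrite sp pp => pn.
have [->|n0] := eqVneq (cnorm p) 0; first exact: ler01.
have -> // : cnorm p = 1 by apply: (mulfI n0); rewrite mulr1 -expr2 -pn.
Qed.

Lemma projection_compl p : projection p -> projection (1 - p).
Proof.
move=> [sp pp]; split; first by rewrite starB star1 sp.
by rewrite mulrBr mulr1 mulrBl mul1r pp subrr subr0.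
Qed.

(** The powers of the block-diagonal element (1 - p) + p z p stay bounded. *)
Lemma cnorm_corner p z : projection p -> star z = z -> cnorm z <= 1 ->
  cnorm ((1 - p) + p * z * p) <= 1.
Proof.
move=> pP sz z1; have [sp pp] := pP.
have p1 := cnorm_projection pP; have q1 := cnorm_projection (projection_compl pP).
apply: (@cnorm_le1_pow _ _ _ (1 + 1)).
  by rewrite starD starB star1 !starM sp sz mulrA.
move=> k; have : (0 < 2 ^ k)%N by rewrite expn_gt0.
case: (2 ^ k)%N => // m _.
suff [c [pc cp cn ->]] : exists c, [/\ p * c = c, c * p = c, cnorm c <= 1 &
    ((1 - p) + p * z * p) ^+ m.+1 = (1 - p) + c].
  by rewrite (le_trans (ler_cnormD _ _))// lerD.
have zn : cnorm (p * z * p) <= 1.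
  rewrite (le_trans (ler_cnormM _ _))// -[leRHS]mulr1 ler_pM ?cnorm_ge0//.
  by rewrite (le_trans (ler_cnormM _ _))// -[leRHS]mulr1 ler_pM ?cnorm_ge0.
elim: m => [|m [c [pc cp cn IH]]].
  by exists (p * z * p); split; rewrite ?expr1 ?mulrA ?pp// -mulrA pp.
exists (c * (p * z * p)); split.
- by rewrite mulrA pc.
- by rewrite -!mulrA pp.
- by rewrite (le_trans (ler_cnormM _ _))// -[leRHS]mulr1 ler_pM ?cnorm_ge0.
- have [_ qq] := projection_compl pP.
  have qp : (1 - p) * p = 0 by rewrite mulrBl mul1r pp subrr.
  have cq : c * (1 - p) = 0 by rewrite mulrBr mulr1 cp subrr.
  rewrite exprSr IH; move: (1 - p) qq qp cq => q qq qp cq.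
  by rewrite mulrDr !mulrDl qq cq addr0 !mulrA qp !mul0r add0r.
Qed.

(** 1 - 2 p q p is the corner of the reflection 1 - 2 q. *)
Lemma nonneg_corner p q : projection p -> projection q -> nonneg (p * q * p).
Proof.
move=> pP [sq qq]; have [sp pp] := pP; split; first by rewrite !starM sp sq mulrA.
exists 2^-1; pose z := 1 - (q + q).
have sz : star z = z by rewrite starB star1 starD sq.
have zz : z * z = 1.
  have zq : z * q = - q by rewrite mulrBl mul1r mulrDl qq opprD addrA subrr add0r.
  by rewrite {2}/z mulrBr mulr1 mulrDr zq -opprD opprK subrK.
have z1 : cnorm z <= 1.
  by rewrite -(@ler_pXn2r _ 2)// ?nnegrE ?cnorm_ge0// -cnorm_starM sz zz cnorm1 expr1n.
have -> : rcst A 2^-1 - p * q * p = rcst A 2^-1 * ((1 - p) + p * z * p).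
  rewrite mulrBr mulr1 mulrBl pp addrA subrK mulrBr mulr1; congr (_ - _).
  by rewrite mulrDr mulrDl rcst_half.
rewrite cnormMr ger0_norm ?invr_ge0// ler_piMr ?invr_ge0//.
exact: cnorm_corner.
Qed.

(** Compressing the relation by the i-th projection gives nonnegative elements
    with sum 0. *)
Lemma projections_orthogonal (I : finType) (P : I -> A) i j :
  (forall k, projection (P k)) -> \sum_k P k = 1 -> i != j -> P i * P j = 0.
Proof.
move=> PP P1 ij; have [si ii] := PP i; have [sj jj] := PP j.
have : P i * (\sum_k P k) * P i = P i by rewrite P1 mulr1.
rewrite (bigD1 i)//= (bigD1 j) 1?eq_sym//= !mulrDr !mulrDl ii ii.
rewrite -[RHS]addr0 => /addrI/eqP; rewrite addr_eq0 => /eqP h.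
have x0 : P i * P j * P i = 0.
  apply: nonneg_anti; first exact: nonneg_corner.
  rewrite h opprK mulr_sumr mulr_suml; apply: nonneg_sum => k _.
  exact: nonneg_corner.
have : cnorm (P j * P i) ^+ 2 = 0.
  by rewrite -cnorm_starM starM si sj mulrA -[P i * P j * P j]mulrA jj x0 cnorm0.
move/eqP; rewrite sqrf_eq0 => /eqP/cnorm_eq0 ji0.
by rewrite -si -sj -starM ji0 star0.
Qed.

End positivity.

(** * Commutative C*-algebras *)

#[short(type="comCstarType")]
HB.structure Definition ComCStarAlgebra (R : realType) :=
  {E of CStarAlgebra R E & GRing.PzSemiRing_hasCommutativeMul E}.

Section commutative_order.
Variables (R : realType) (E : comCstarType R).
Implicit Types (a b x y : E).

Lemma nonnegM a b : nonneg a -> nonneg b -> nonneg (a * b).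
Proof.
move=> /nonneg_sqrt[s [ss <- _]] /nonneg_sqrt[t [st <- _]].
have -> : s * s * (t * t) = (s * t) * (s * t) by ring.
by apply: nonneg_sqr; rewrite starM ss st mulrC.
Qed.

(** With beta the norm of b, both beta + a and beta - a are nonnegative, hence
    so is beta ^+ 2 - a ^+ 2; being a square, it only adds to a ^+ 2. *)
Lemma cnorm_le_nonneg a b : star a = a ->
  nonneg (b - a) -> nonneg (b + a) -> cnorm a <= cnorm b.
Proof.
move=> sa ba1 ba2.
have sb : star b = b.
  by rewrite -[b](subrK a) starD sa; case: ba1 => ->.
have bb := nonneg_rcst_sub sb; pose c := rcst E (cnorm b).
have c1 : nonneg (c - a) by rewrite -(subrK b c) -addrA; exact: nonnegD.
have c2 : nonneg (c + a) by rewrite -(subrK b c) -addrA; exact: nonnegD.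
have [s [ss s2 _]] := nonneg_sqrt (nonnegM c1 c2).
rewrite -(@ler_pXn2r _ 2)// ?nnegrE ?cnorm_ge0//.
rewrite (le_trans (cnorm_sqr_le sa ss (mulrC _ _)))// s2.
have -> : a * a + (c - a) * (c + a) = c * c by ring.
by rewrite -rmorphM cnorm_rcst ger0_norm ?expr2// mulr_ge0 ?cnorm_ge0.
Qed.

Lemma nonneg_cnorm_le a b : nonneg a -> nonneg (b - a) -> cnorm a <= cnorm b.
Proof.
move=> a0 ba; apply: cnorm_le_nonneg => //; first by case: a0.
have -> : b + a = (b - a) + (a + a) by ring.
exact: nonnegD ba (nonnegD a0 a0).
Qed.

Lemma nonneg_sum_sqr (I : Type) (r : seq I) (F : I -> E) :
  (forall i, star (F i) = F i) -> nonneg (\sum_(i <- r) F i ^+ 2).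
Proof. by move=> sF; apply: nonneg_sum => i _; rewrite expr2; exact: nonneg_sqr. Qed.

End commutative_order.

(** * The commutative C*-algebra of a commuting self-adjoint family *)

(** The bicommutant serves as the commutative C*-algebra of the family: it is
    closed without taking a closure, and its elements commute with whatever
    commutes with the family. *)
Definition bicommutant (R : realType) (A : cstarType R) (I : Type) (f : I -> A) : {pred A}
  :=
  [pred x | `[< forall z, (forall i, f i * z = z * f i) -> x * z = z * x >]].

Section bicommutant.
Variables (R : realType) (A : cstarType R) (I : Type) (f : I -> A).

Lemma bicommutantP x :
  reflect (forall z, (forall i, f i * z = z * f i) -> x * z = z * x) (x \in bicommutant f).
Proof. exact: asboolP. Qed.

Fact bicommutant_subalg : subalg_closed (bicommutant f).
Proof.
split; first by apply/bicommutantP => z _; rewrite mul1r mulr1.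
- move=> a x y /bicommutantP xP /bicommutantP yP; apply/bicommutantP => z fz.
  by rewrite mulrDl mulrDr -scalerAl -scalerAr xP// yP.
- move=> x y /bicommutantP xP /bicommutantP yP; apply/bicommutantP => z fz.
  by rewrite -mulrA yP// mulrA xP// mulrA.
Qed.

HB.instance Definition _ := GRing.isSubalgClosed.Build R[i] A (bicommutant f)
  (GRing.subalg_closed_semi bicommutant_subalg).

Hypothesis fsa : forall i, star (f i) = f i.
Hypothesis fC : forall i j, f i * f j = f j * f i.

Lemma bicommutant_mem i : f i \in bicommutant f.
Proof. by apply/bicommutantP => z. Qed.

Lemma bicommutant_star x : x \in bicommutant f -> star x \in bicommutant f.
Proof.
move=> /bicommutantP xP; apply/bicommutantP => z fz.
apply: (can_inj (@starK _ _)); rewrite !starM !starK xP// => i.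
by rewrite -[f i]fsa -!starM fz.
Qed.

Lemma bicommutant_comm x y : x \in bicommutant f -> y \in bicommutant f -> x * y = y * x.
Proof.
move=> /bicommutantP xP /bicommutantP yP; apply: (xP) => i.
by apply/esym; apply: yP => j; exact: fC.
Qed.

Lemma bicommutant_closed u l :
  (forall n, u n \in bicommutant f) -> tends_to u l -> l \in bicommutant f.
Proof.
move=> uP ul; apply/bicommutantP => z fz.
have uz n : u n * z = z * u n by have /bicommutantP := uP n; apply.
apply: tends_to_unique (tends_toM ul (tends_to_cst z)) _.
under [X in tends_to X]funext do rewrite uz.
exact: tends_toM (tends_to_cst z) ul.
Qed.

End bicommutant.

Section bicommutant_algebra.
Variables (R : realType) (A : cstarType R) (I : Type) (f : I -> A).
Variables (fsa : forall i, star (f i) = f i).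
Variables (fC : forall i j, f i * f j = f j * f i).

(** The hypotheses on f are arguments of the type, because its commutativity
    and its involution rest on them. *)
Definition bicommutant_of of (forall i, star (f i) = f i)
  & (forall i j, f i * f j = f j * f i) : Type := {x : A | x \in bicommutant f}.
Local Notation F := (bicommutant_of fsa fC).

HB.instance Definition _ := SubChoice.copy F {x : A | x \in bicommutant f}.
HB.instance Definition _ := [SubChoice_isSubAlgebra of F by <:].

Fact bicommutant_of_mulC : commutative (@GRing.mul F).
Proof. by move=> x y; apply: val_inj; apply: bicommutant_comm (valP x) (valP y). Qed.

HB.instance Definition _ := GRing.PzSemiRing_hasCommutativeMul.Build F bicommutant_of_mulC.

Definition bicommutant_val (x : F) : A := val x.
Local Notation v := bicommutant_val.

Lemma bicommutant_val_inj : injective v. Proof. exact: val_inj. Qed.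

Lemma bicommutant_valP x : v x \in bicommutant f. Proof. exact: valP. Qed.

Fact bicommutant_val_is_linear : linear v.
Proof. by move=> a x y; exact: (linearP (val : F -> A)). Qed.

Fact bicommutant_val_is_monoid_morphism : monoid_morphism v.
Proof. by split=> [|x y]; [exact: (rmorph1 (val : F -> A)) | exact: (rmorphM (val : F ->
  A))]. Qed.

HB.instance Definition _ := GRing.isLinear.Build R[i] F A *:%R v bicommutant_val_is_linear.
HB.instance Definition _ := GRing.isMonoidMorphism.Build F A v
  bicommutant_val_is_monoid_morphism.

Definition bicommutant_of_star (x : F) : F :=
  Sub (star (v x)) (bicommutant_star fsa (bicommutant_valP x)).
Definition bicommutant_of_norm (x : F) : R := cnorm (v x).
Local Notation fstar := bicommutant_of_star.
Local Notation fnorm := bicommutant_of_norm.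

Let val_star x : v (fstar x) = star (v x). Proof. exact: SubK. Qed.

Fact fstarK : involutive fstar.
Proof. by move=> x; apply: bicommutant_val_inj; rewrite !val_star starK. Qed.
Fact fstarD : {morph fstar : x y / x + y}.
Proof.
by move=> x y; apply: bicommutant_val_inj; rewrite val_star !rmorphD/= starD !val_star.
Qed.
Fact fstarZ (a : R[i]) x : fstar (a *: x) = (Num.conj a) *: fstar x.
Proof. by apply: bicommutant_val_inj; rewrite val_star !linearZ/= starZ val_star. Qed.
Fact fstarM x y : fstar (x * y) = fstar y * fstar x.
Proof. by apply: bicommutant_val_inj; rewrite val_star !rmorphM/= starM !val_star. Qed.
Fact fnorm_eq0 x : fnorm x = 0 -> x = 0.
Proof. by move=> /cnorm_eq0 x0; apply: bicommutant_val_inj; rewrite x0 rmorph0. Qed.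
Fact ler_fnormD x y : fnorm (x + y) <= fnorm x + fnorm y.
Proof. by rewrite /fnorm rmorphD ler_cnormD. Qed.
Fact fnormZ (a : R[i]) x : fnorm (a *: x) = normc a * fnorm x.
Proof. by rewrite /fnorm linearZ cnormZ. Qed.
Fact ler_fnormM x y : fnorm (x * y) <= fnorm x * fnorm y.
Proof. by rewrite /fnorm rmorphM ler_cnormM. Qed.
Fact fnorm_starM x : fnorm (fstar x * x) = fnorm x ^+ 2.
Proof. by rewrite /fnorm rmorphM/= val_star cnorm_starM. Qed.

Fact fnorm_complete (u : nat -> F) :
  (forall e : R, 0 < e -> \forall m & n \near \oo, fnorm (u m - u n) < e) ->
  exists l : F, fnorm (u n - l) @[n --> \oo] --> (0 : R).
Proof.
move=> uC; have [|l ul] := @cnorm_complete R A (v \o u).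
  by move=> e /uC; apply: filterS => -[m n] /=; rewrite /fnorm rmorphB.
have lF : l \in bicommutant f.
  apply: (@bicommutant_closed _ _ _ _ (v \o u)) => [n|]; first exact: bicommutant_valP.
  move=> e e0; have /cvgrPdist_lt/(_ _ e0)[N _ NP] := ul.
  exists N => n Nn; have := NP n Nn.
  by rewrite /= sub0r normrN ger0_norm ?cnorm_ge0.
exists (Sub l lF); suff -> : (fun n => fnorm (u n - Sub l lF)) = (fun n =>
  cnorm (v (u n) - l)) by [].
by apply: funext => n; rewrite /fnorm rmorphB /=; congr (cnorm (_ - _)); exact: SubK.
Qed.

HB.instance Definition _ := @Algebra_isCStarAlgebra.Build R F
  fstar fnorm fstarK fstarD fstarZ fstarM fnorm_eq0 ler_fnormD fnormZ
  ler_fnormM fnorm_starM fnorm_complete.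

Lemma bicommutant_val_star_hom : star_hom (v : F -> A).
Proof.
by split; [exact: bicommutant_val_is_linear | exact: bicommutant_val_is_monoid_morphism |].
Qed.

End bicommutant_algebra.

(** * Approximate spectral decompositions *)

Section spectral.
Variables (R : realType) (E : comCstarType R) (n : nat).
Local Notation rc := (rcst E).
Implicit Types (c : 'M[R]_n.+1).

(** The variance of a sum of two independent variables, the first of which is
    centred. *)
Lemma sum_mul_sqrD (I J : finType) (k x : I -> E) (a y : J -> E) :
  \sum_i k i = 1 -> \sum_j a j = 1 -> \sum_i k i * x i = 0 ->
  \sum_(p : I * J) k p.1 * a p.2 * (x p.1 + y p.2) ^+ 2 =
  \sum_i k i * x i ^+ 2 + \sum_j a j * y j ^+ 2.
Proof.
move=> k1 a1 kx; rewrite -(pair_bigA _ (fun i j => k i * a j * (x i + y j) ^+ 2))/=.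
transitivity (\sum_i \sum_j (k i * x i ^+ 2 * a j
    + (k i * x i) * (2%:R * (a j * y j)) + k i * (a j * y j ^+ 2))).
  by apply: eq_bigr => i _; apply: eq_bigr => j _; ring.
under [LHS]eq_bigr => i _ do rewrite !big_split/= -!mulr_sumr a1 mulr1.
by rewrite !big_split/= -!mulr_suml k1 kx !mul0r addr0 mul1r.
Qed.

Section random_walk.
Variables (L : finType) (a : L -> E) (c : L -> 'M[R]_n.+1) (f : 'M[E]_n.+1).
Hypothesis a_ge0 : forall l, nonneg (a l).
Hypothesis a1 : \sum_l a l = 1.
Hypothesis acf : forall i j, \sum_l a l * rc (c l i j) = f i j.

(** A random walk with independent steps c, the weights a being the
    probabilities: the variances add up. *)
Lemma random_walk d : exists (I : finType) (k : I -> E) (s : I -> 'M[R]_n.+1),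
  [/\ forall i, nonneg (k i), \sum_i k i = 1,
      forall i j, \sum_m k m * (rc (s m i j) - d%:R * f i j) = 0 &
      forall i j, \sum_m k m * (rc (s m i j) - d%:R * f i j) ^+ 2 =
        d%:R * \sum_l a l * (rc (c l i j) - f i j) ^+ 2].
Proof.
have step0 i j : \sum_l a l * (rc (c l i j) - f i j) = 0.
  under eq_bigr do rewrite mulrBr.
  by rewrite sumrB acf -mulr_suml a1 mul1r subrr.
elim: d => [|d [I [k [s [k0 k1 kx kv]]]]].
  exists unit, (fun=> 1), (fun=> 0); split=> [_||i j|i j].
  - by rewrite -(rmorph1 rc); exact: nonneg_rcst.
  - by rewrite big_const card_unit /= addr0.
  - by rewrite big1// => _ _; rewrite mxE rmorph0 mulr0n mul0r subrr mulr0.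
  - by rewrite !mulr0n !mul0r big1// => _ _; rewrite mxE rmorph0 subrr expr0n mulr0.
exists (I * L)%type, (fun p => k p.1 * a p.2), (fun p => s p.1 + c p.2).
have sE i j (p : I * L) : rc ((s p.1 + c p.2) i j) - d.+1%:R * f i j =
    (rc (s p.1 i j) - d%:R * f i j) + (rc (c p.2 i j) - f i j).
  by rewrite mxE rmorphD -natr1; ring.
split=> [p||i j|i j]; first exact: nonnegM.
- rewrite -(pair_bigA _ (fun i j => k i * a j))/=.
  by under eq_bigr do rewrite -mulr_sumr a1 mulr1.
- under eq_bigr do rewrite sE mulrDr.
  rewrite big_split/= -(pair_bigA _ (fun p l =>
    k p * a l * (rc (s p i j) - d%:R * f i j)))/=.
  rewrite -(pair_bigA _ (fun p l => k p * a l * (rc (c l i j) - f i j)))/=.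
  under eq_bigr do (under eq_bigr do rewrite mulrAC; rewrite -mulr_sumr a1 mulr1).
  under [X in _ + X]eq_bigr do (under eq_bigr do rewrite -mulrA;
    rewrite -mulr_sumr step0 mulr0).
  by rewrite kx big1// addr0.
- under eq_bigr do rewrite sE.
  rewrite (@sum_mul_sqrD _ _ k (fun m => rc (s m i j) - d%:R * f i j)
    a (fun l => rc (c l i j) - f i j))//.
  by rewrite kv -natr1 mulrDl mul1r.
Qed.

End random_walk.

Definition sqnorm_mx (X : 'M[E]_n.+1) : E := \tr (X^T *m X).

Lemma sqnorm_mxE (X : 'M[E]_n.+1) : sqnorm_mx X = \sum_i \sum_j X i j ^+ 2.
Proof.
rewrite exchange_big; apply: eq_bigr => j _; rewrite !mxE.
by apply: eq_bigr => i _; rewrite mxE expr2.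
Qed.

Lemma nonneg_sqnorm_mx (X : 'M[E]_n.+1) : (forall i j,
  star (X i j) = X i j) -> nonneg (sqnorm_mx X).
Proof.
move=> sX; rewrite sqnorm_mxE; apply: nonneg_sum => i _.
by apply: nonneg_sum_sqr => j; exact: sX.
Qed.

Variable f : 'M[E]_n.+1.

(** f looks like the matrix of coordinate functions x_i x_j of the projective
    space: a real projection of rank one. *)
Hypothesis fsa : forall i j, star (f i j) = f i j.
Hypothesis fT : f^T = f.
Hypothesis ff : f *m f = f.
Hypothesis ftr : \tr f = 1.

Let fsym i j : f i j = f j i. Proof. by rewrite -{1}fT mxE. Qed.

Lemma sqnorm_proj : sqnorm_mx f = 1. Proof. by rewrite /sqnorm_mx fT ff. Qed.

Definition dist2 c : E := sqnorm_mx (map_mx rc c - f).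

Lemma nonneg_dist2 c : nonneg (dist2 c).
Proof. by apply: nonneg_sqnorm_mx => i j; rewrite !mxE starB star_rcst fsa. Qed.

(** The polarisation (f_ii + f_jj + 2 f_ij) + (f_ii + f_jj - 2 f_ij) makes f an
    average of real matrices, with nonnegative elements of E for weights: on
    the sphere f_ii + f_jj +- 2 f_ij is the square of x_i +- x_j. *)
Lemma exists_barycenter : exists (L : finType) (a : L -> E) (c : L -> 'M[R]_n.+1),
  [/\ forall l, nonneg (a l), \sum_l a l = 1 &
      forall i j, \sum_l a l * rc (c l i j) = f i j].
Proof.
pose N : R := n.+1%:R.
have N0 : N != 0 by rewrite pnatr_eq0.
have N4 : 4 * N != 0 by rewrite mulf_neq0 ?pnatr_eq0.
pose sg (b : bool) : R := (-1) ^+ b.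
pose a (l : 'I_n.+1 * 'I_n.+1 * bool) : E :=
  rc (4 * N)^-1 * (f l.1.1 l.1.1 + f l.1.2 l.1.2 + rc (2 * sg l.2) * f l.1.1 l.1.2).
pose c (l : 'I_n.+1 * 'I_n.+1 * bool) : 'M[R]_n.+1 := (sg l.2 * N) *: delta_mx l.1.1 l.1.2.
have N1 : rc (4 * N)^-1 * (rc 4 * rc N) = 1
  by rewrite -!(rmorphM (rcst E)) mulVf// (rmorph1 (rcst E)).
have sumE (F : 'I_n.+1 * 'I_n.+1 * bool -> E) :
    \sum_l F l = \sum_i \sum_j (F (i, j, true) + F (i, j, false)).
  transitivity (\sum_i \sum_j \sum_b F (i, j, b)); last first.
    by apply: eq_bigr => i _; apply: eq_bigr => j _; rewrite big_bool.
  rewrite (pair_bigA _ (fun i j => \sum_b F (i, j, b)))/=.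
  rewrite (pair_bigA _ (fun p b => F (p.1, p.2, b)))/=.
  by apply: eq_bigr => -[[]].
have sg2 b : rc (sg b) * rc (sg b) = 1
  by rewrite -(rmorphM (rcst E)) -expr2 sqrr_sign (rmorph1 (rcst E)).
have [sgt sgf] : sg true = -1 /\ sg false = 1 by rewrite /sg expr1 expr0.
have w0 : nonneg (rc (4 * N)^-1) by apply: nonneg_rcst; rewrite invr_ge0 mulr_ge0.
move: (rc (4 * N)^-1) N1 w0 @a => w N1 w0 a.
exists _, a, c; split=> [[[i j] b]||i j].
- apply: nonnegM => //.
  have -> : f i i + f j j + rc (2 * sg b) * f i j =
      \sum_k (f i k + rc (sg b) * f j k) ^+ 2.
    have fE i' j' : f i' j' = \sum_k f i' k * f j' k.
      by rewrite -{1}ff mxE; apply: eq_bigr => k _; rewrite [f k j']fsym.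
    rewrite (fE i i) (fE j j) (fE i j) mulr_sumr -!big_split/=.
    by apply: eq_bigr => k _; rewrite rmorphM; ring: (sg2 b).
  apply: nonneg_sum_sqr => k.
  by rewrite starD starM star_rcst !fsa mulrC.
- rewrite sumE /a /=.
  transitivity (\sum_i \sum_j w * (2 * (f i i + f j j))).
    by apply: eq_bigr => i _; apply: eq_bigr => j _; rewrite sgt sgf; ring.
  under eq_bigr do rewrite -!mulr_sumr big_split/= -/(\tr f) ftr sumr_const card_ord.
  rewrite -!mulr_sumr big_split/= sumr_const card_ord sumrMnl -/(\tr f) ftr.
  by rewrite -[RHS]N1 /N; ring.
- rewrite sumE (bigD1 i)//= [X in _ + X = _]big1 ?addr0; last first.
    move=> i' /negbTE ii; rewrite big1// => j' _.
    by rewrite /c !mxE /= [i == _]eq_sym ii !(mulr0, rmorph0, addr0).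
  rewrite (bigD1 j)//= [X in _ + X = _]big1 ?addr0; last first.
    move=> j' /negbTE jj.
    by rewrite /c !mxE /= eqxx [j == _]eq_sym jj !(mulr0, rmorph0, addr0).
  rewrite /a /c /= !mxE !eqxx sgt sgf !mulr1.
  rewrite -[RHS]mul1r -[X in _ = X * _]N1; ring.
Qed.

(** After d steps the mean of the walk of the barycenter has variance O(1 / d). *)
Lemma exists_mean_approx (e : R) : 0 < e ->
  exists (I : finType) (k : I -> E) (s : I -> 'M[R]_n.+1),
  [/\ forall m, nonneg (k m), \sum_m k m = 1,
      forall i j, \sum_m k m * (rc (s m i j) - f i j) = 0 &
      cnorm (\sum_m k m * dist2 (s m)) <= e].
Proof.
move=> e0; have [L [a [c [a0 a1 ac]]]] := exists_barycenter.
pose v i j := \sum_l a l * (rc (c l i j) - f i j) ^+ 2.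
pose K := cnorm (\sum_i \sum_j v i j).
pose d := Num.bound (K / e).
have dK : K / e < d.+1%:R.
  rewrite (lt_trans (archi_boundP _))// ?ltr_nat// divr_ge0 ?cnorm_ge0 ?ltW//.
have [I [k [s [k0 k1 kx kv]]]] := random_walk a0 a1 ac d.+1.
pose r : R := d.+1%:R^-1.
have rd : rc r * d.+1%:R = 1.
  by rewrite -(rmorph_nat rc) -rmorphM mulVf ?pnatr_eq0// rmorph1.
have sE m i j : rc ((r *: s m) i j) - f i j = rc r * (rc (s m i j) - d.+1%:R * f i j).
  by rewrite mxE rmorphM mulrBr [rc r * (_ * f i j)]mulrA rd mul1r.
exists I, k, (fun m => r *: s m); split=> // [i j|].
  under eq_bigr do rewrite sE mulrCA.
  by rewrite -mulr_sumr kx mulr0.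
suff -> : \sum_m k m * dist2 (r *: s m) = rc r * \sum_i \sum_j v i j.
  rewrite cnormMr ger0_norm ?invr_ge0// -/K mulrC ler_pdivrMr//.
  by rewrite mulrC -ler_pdivrMr// ltW.
transitivity (\sum_i \sum_j \sum_m k m * (rc ((r *: s m) i j) - f i j) ^+ 2).
  rewrite (eq_bigr (fun i => \sum_m \sum_j k m * (rc ((r *: s m) i j) - f i j) ^+ 2)).
    rewrite exchange_big; apply: eq_bigr => m _.
    rewrite /dist2 sqnorm_mxE mulr_sumr; apply: eq_bigr => i _.
    by rewrite mulr_sumr; apply: eq_bigr => j _; rewrite !mxE.
  by move=> i _; rewrite exchange_big.
rewrite mulr_sumr; apply: eq_bigr => i _; rewrite mulr_sumr; apply: eq_bigr => j _.
under eq_bigr do rewrite sE exprMn mulrCA.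
by rewrite -mulr_sumr kv mulrA expr2 -[rc r * rc r * _]mulrA rd mulr1.
Qed.

Lemma exists_unit_vector (u : 'rV[R]_n.+1) : exists2 v : 'rV[R]_n.+1,
  @sphere R n v & u^T *m u = (\sum_i u 0 i ^+ 2) *: (v^T *m v).
Proof.
have [u0|u0] := eqVneq (\sum_i u 0 i ^+ 2) 0.
  have uE i : u 0 i = 0.
    apply/eqP; rewrite -sqrf_eq0; apply/eqP.
    by move/psumr_eq0P : u0 => -> // j _; exact: sqr_ge0.
  exists (delta_mx 0 0); last first.
    by apply/matrixP => i j; rewrite u0 !mxE big_ord1 !mxE !uE !mul0r.
  rewrite /sphere /= (bigD1 ord0)//= mxE !eqxx expr1n big1 ?addr0// => i /negbTE i0.
  by rewrite mxE i0 andbF expr0n.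
set w := \sum_i _ in u0 *; have w0 : 0 <= w by apply: sumr_ge0 => i _; exact: sqr_ge0.
have r2 : (Num.sqrt w)^-1 * (Num.sqrt w)^-1 = w^-1.
  by rewrite -invfM -expr2 sqr_sqrtr.
exists ((Num.sqrt w)^-1 *: u).
  rewrite /sphere /=; under eq_bigr do rewrite mxE exprMn.
  by rewrite -mulr_sumr expr2 r2 mulVf.
by rewrite linearZ/= [(_ *: u)^T]linearZ/= -scalemxAl !scalerA r2 divff// scale1r.
Qed.

Lemma sqnorm_mxD (X Y : 'M[E]_n.+1) :
  sqnorm_mx (X + Y) = sqnorm_mx X + (\tr (X^T *m Y)) *+ 2 + sqnorm_mx Y.
Proof.
rewrite /sqnorm_mx [(X + Y)^T]linearD/= mulmxDl !mulmxDr !mxtraceD.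
have -> : \tr (Y^T *m X) = \tr (X^T *m Y) by rewrite -mxtrace_tr trmx_mul trmxK.
by ring.
Qed.

Lemma sqnorm_mxN (X : 'M[E]_n.+1) : sqnorm_mx (- X) = sqnorm_mx X.
Proof. by rewrite /sqnorm_mx [(- X)^T]linearN/= mulNmx mulmxN opprK. Qed.

Lemma dist2_sphere v : @sphere R n v ->
  dist2 (v^T *m v) = (1 - \tr (map_mx rc (v^T *m v) *m f)) *+ 2.
Proof.
move=> sv; rewrite /dist2 sqnorm_mxD sqnorm_mxN sqnorm_proj mulmxN linearN/=.
have vv : v *m v^T = 1.
  by apply/matrixP => i j; rewrite !ord1 mxE mxE eqxx -[RHS]sv; apply: eq_bigr => k _;
    rewrite mxE expr2.
set P := map_mx rc _; have PT : P^T = P by apply/matrixP => i j; rewrite !mxE;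
  congr (rc _); apply: eq_bigr => k _; rewrite !mxE mulrC.
have -> : sqnorm_mx P = 1.
  rewrite /sqnorm_mx PT -map_mxM mulmxA -(mulmxA v^T) vv mulmx1.
  by rewrite trace_map_mx mxtrace_mulC vv /= mxtrace1 rmorph1.
by rewrite PT; ring.
Qed.

(** The matrix c is spread over the projective space by moving each of its
    columns to the sphere, with the squared length for weight. On a column x
    of c the distance counts the part of x outside the range of f, and
    (1 - f) c = (1 - f) (c - f) is no longer than c - f. *)
Lemma columns_dist2 c (v : 'I_n.+1 -> 'rV[R]_n.+1) :
  (forall j, @sphere R n (v j)) ->
  (forall j, col j c *m (col j c)^T = (\sum_i c i j ^+ 2) *: ((v j)^T *m v j)) ->
  \sum_j rc (\sum_i c i j ^+ 2) * dist2 ((v j)^T *m v j) =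
  (dist2 c - sqnorm_mx (f *m (map_mx rc c - f))) *+ 2.
Proof.
move=> sv cv; pose C := map_mx rc c; pose H := C - f.
have -> : \sum_j rc (\sum_i c i j ^+ 2) * dist2 ((v j)^T *m v j) =
    (sqnorm_mx C - \tr (C *m C^T *m f)) *+ 2.
  under eq_bigr do rewrite dist2_sphere// mulrnAr mulrBr mulr1.
  rewrite sumrMnl sumrB; congr ((_ - _) *+ 2).
    rewrite sqnorm_mxE exchange_big; apply: eq_bigr => j _.
    by rewrite rmorph_sum; apply: eq_bigr => i _; rewrite mxE rmorphXn.
  transitivity (\sum_j \tr (map_mx rc (col j c *m (col j c)^T) *m f)).
    apply: eq_bigr => j _.
    by rewrite cv map_mxZ -scalemxAl mxtraceZ.
  rewrite -raddf_sum -mulmx_suml; congr (\tr (_ *m f)).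
  apply/matrixP => a b; rewrite summxE mxE; apply: eq_bigr => j _.
  by rewrite !mxE big_ord1 !mxE rmorphM.
have CE : C = H + f by rewrite subrK.
have fCE : f *m C = f *m H + f by rewrite CE mulmxDr ff.
have -> : \tr (C *m C^T *m f) = sqnorm_mx (f *m C).
  by rewrite /sqnorm_mx trmx_mul fT mulmxA -(mulmxA C^T f f) ff -(mulmxA C) mxtrace_mulC.
rewrite fCE {1}CE (sqnorm_mxD H) (sqnorm_mxD (f *m H));
  have -> : (f *m H)^T *m f = H^T *m f.
  by rewrite trmx_mul fT -mulmxA ff.
by rewrite /dist2 -/C -/H; ring.
Qed.

(** The weights of the columns add up to 1 + V with V small, as f has squared
    norm 1; scaling by l = (1 + h)^-1 makes room for a nonnegative remainder r,
    which is placed at an arbitrary point x0. *)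
Lemma exists_quadrature (e : R) : 0 < e ->
  exists (I : finType) (k : I -> E) (x : I -> 'rV[R]_n.+1),
  [/\ forall m, nonneg (k m), forall m, @sphere R n (x m), \sum_m k m = 1 &
      cnorm (\sum_m k m * dist2 ((x m)^T *m x m)) <= e].
Proof.
move=> e0; have [x0 sx0 _] := exists_unit_vector 0.
pose D := cnorm (dist2 (x0^T *m x0)).
have D0 : 0 <= D := cnorm_ge0 _.
(* The columns contribute at most 2 h to the error, the remainder 2 h D. *)
pose h := e / (2 * (1 + D)).
have h0 : 0 < h by rewrite divr_gt0// mulr_gt0// ltr_wpDr.
have [I [k [s [k0 k1 kx kh]]]] := exists_mean_approx h0.
set V := \sum_m k m * dist2 (s m) in kh.
have V0 : nonneg V by apply: nonneg_sum => m _; exact: nonnegM (nonneg_dist2 _).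
have /choice[v vP] : forall mj : I * 'I_n.+1, exists v : 'rV[R]_n.+1, @sphere R n v /\
    col mj.2 (s mj.1) *m (col mj.2 (s mj.1))^T =
    (\sum_i s mj.1 i mj.2 ^+ 2) *: (v^T *m v).
  move=> [m j] /=; have [v sv] := exists_unit_vector (col j (s m))^T.
  by rewrite trmxK => ->; exists v; split => //; congr (_ *: _); apply: eq_bigr => i _;
    rewrite !mxE.
pose w (mj : I * 'I_n.+1) : R := \sum_i s mj.1 i mj.2 ^+ 2.
have w0 mj : 0 <= w mj by apply: sumr_ge0 => i _; exact: sqr_ge0.
pose l : R := (1 + h)^-1.
have l0 : 0 < l by rewrite invr_gt0 addr_gt0.
have lh : l * (1 + h) = 1 by rewrite mulVf// lt0r_neq0// addr_gt0.
pose q (mj : I * 'I_n.+1) := k mj.1 * rc (w mj).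
have q0 mj : nonneg (q mj) by exact: nonnegM (k0 _) (nonneg_rcst _ (w0 _)).
have qsum : \sum_mj q mj = 1 + V.
  rewrite -(pair_bigA _ (fun m j => k m * rc (w (m, j))))/=.
  transitivity (\sum_m (k m * dist2 (s m) +
      (k m * \tr ((map_mx rc (s m) - f)^T *m f)) *+ 2 + k m)).
    apply: eq_bigr => m _; rewrite -mulr_sumr.
    have -> : \sum_j rc (w (m, j)) = sqnorm_mx (map_mx rc (s m)).
      rewrite sqnorm_mxE exchange_big; apply: eq_bigr => j _.
      by rewrite rmorph_sum; apply: eq_bigr => i _; rewrite mxE rmorphXn.
    by rewrite -{1}[map_mx rc (s m)](subrK f) sqnorm_mxD sqnorm_proj -/(dist2 _); ring.
  rewrite big_split big_split/= sumrMnl k1 -/V addrC; congr (_ + _).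
  rewrite [X in X *+ 2](_ : _ = 0) ?mul0rn ?addr0//.
  transitivity (\sum_j \sum_i f i j * \sum_m k m * (rc (s m i j) - f i j)); last first.
    by rewrite big1// => j _; rewrite big1// => i _; rewrite kx mulr0.
  under [RHS]eq_bigr do under eq_bigr do rewrite mulr_sumr.
  under [RHS]eq_bigr do rewrite exchange_big.
  rewrite [RHS]exchange_big; apply: eq_bigr => m _; rewrite mulr_sumr.
  apply: eq_bigr => j _; rewrite mxE mulr_sumr; apply: eq_bigr => i _.
  by rewrite !mxE; ring.
pose r := rc l * (rc h - V).
have r0 : nonneg r.
  apply: nonnegM; first exact/nonneg_rcst/ltW.
  have -> : rc h - V = rc (h - cnorm V) + (rc (cnorm V) - V) by rewrite rmorphB; ring.
  apply: nonnegD; last by apply: nonneg_rcst_sub; case: V0.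
  by apply: nonneg_rcst; rewrite subr_ge0.
exists ((I * 'I_n.+1) + unit)%type,
  (fun o => if o is inl mj then rc l * q mj else r),
  (fun o => if o is inl mj then v mj else x0).
split=> [[mj|[]]|[mj|[]]||] //=.
- by apply: nonnegM => //; exact/nonneg_rcst/ltW.
- by case: (vP mj).
- rewrite big_sumType/= big_const card_unit/= addr0 -mulr_sumr qsum /r.
  by rewrite -[RHS](rmorph1 rc) -lh; ring.
rewrite big_sumType/= big_const card_unit/= addr0 addrC (le_trans (ler_cnormD _ _))//.
have rh : cnorm r <= 2 * h.
  rewrite cnormMr ger0_norm ?(ltW l0)//.
  have l1 : l <= 1 by rewrite invf_le1 ?addr_gt0// lerDl ltW.
  rewrite (le_trans (ler_piMl (cnorm_ge0 _) l1))//.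
  rewrite (le_trans (ler_cnormD _ _))// cnormN cnorm_rcst ger0_norm ?(ltW h0)//.
  by lra.
have rD : cnorm (r * dist2 (x0^T *m x0)) <= 2 * h * D.
  by rewrite (le_trans (ler_cnormM _ _))// ler_wpM2r.
set S := \sum_mj _.
have -> : e = 2 * h * D + 2 * h.
  by rewrite /h; field; rewrite lt0r_neq0// ltr_wpDr.
rewrite lerD//; have S0 : nonneg S.
  apply: nonneg_sum => mj _; apply: nonnegM (nonneg_dist2 _); apply: nonnegM => //.
  exact/nonneg_rcst/ltW.
have VS : nonneg (V *+ 2 - S).
  have -> : S = rc l * \sum_m k m * ((dist2 (s m) -
      sqnorm_mx (f *m (map_mx rc (s m) - f))) *+ 2).
    transitivity (\sum_m \sum_j rc l * q (m, j) * dist2 ((v (m, j))^T *m v (m, j))).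
      by rewrite pair_bigA; apply: eq_bigr => -[].
    rewrite mulr_sumr; apply: eq_bigr => m _;
      rewrite -(@columns_dist2 _ (fun j => v (m, j))).
    + by rewrite !mulr_sumr; apply: eq_bigr => j _; rewrite !mulrA.
    + by move=> j; case: (vP (m, j)).
    + by move=> j; case: (vP (m, j)).
  have -> : V *+ 2 - rc l * \sum_m k m * ((dist2 (s m) -
      sqnorm_mx (f *m (map_mx rc (s m) - f))) *+ 2) =
    rc (1 - l) * V *+ 2 +
    rc l * (\sum_m k m * sqnorm_mx (f *m (map_mx rc (s m) - f))) *+ 2.
    under eq_bigr do rewrite mulrnAr mulrBr.
    by rewrite sumrMnl sumrB -/V; ring.
  have nM2 (y : E) : nonneg y -> nonneg (y *+ 2) by move=> y0; rewrite mulr2n;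
    exact: nonnegD.
  apply: nonnegD; apply: nM2; apply: nonnegM => //.
  - by apply: nonneg_rcst; rewrite subr_ge0 invf_le1 ?addr_gt0// lerDl ltW.
  - exact/nonneg_rcst/ltW.
  - apply: nonneg_sum => m _; apply: nonnegM => //; apply: nonneg_sqnorm_mx => i j.
    rewrite mxE star_sum; apply: eq_bigr => a _.
    by rewrite starM !mxE starB star_rcst !fsa mulrC.
rewrite (le_trans (nonneg_cnorm_le S0 VS))// mulr2n (le_trans (ler_cnormD _ _))//.
by lra.
Qed.

End spectral.

(** * Continuous functional calculus *)

Definition sqdist (R : realType) n (c d : 'M[R]_n) : R :=
  \sum_i \sum_j (c i j - d i j) ^+ 2.

Lemma sqdist_ge0 (R : realType) n (c d : 'M[R]_n) : 0 <= sqdist c d.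
Proof. by apply: sumr_ge0 => i _; apply: sumr_ge0 => j _; exact: sqr_ge0. Qed.

Lemma sqdist_eq0 (R : realType) n (c d : 'M[R]_n) : sqdist c d = 0 -> c = d.
Proof.
move=> cd0; apply/matrixP => i j.
have h := psumr_eq0P (fun i _ => sumr_ge0 _ (fun j _ => sqr_ge0 _)) cd0.
have h' := psumr_eq0P (fun j _ => sqr_ge0 (c i j - d i j)) (h i isT).
have /eqP := h' j isT.
by rewrite sqrf_eq0 subr_eq0 => /eqP.
Qed.

Lemma normc_cts (R : realType) (T : topologicalType) (f : T -> R[i]^o) :
  continuous f -> continuous (fun x => normc (f x) : R).
Proof.
move=> cf x; apply/cvgrPdist_lt => e e0.
have eC : 0 < e%:C by rewrite ltcR.
have /cvgrPdist_lt/(_ _ eC) := cf x.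
apply: filterS => y; rewrite -Defs.normcE ltcR; apply: le_lt_trans.
exact: (@ler_dist_dist R (Rcomplex R)).
Qed.

Lemma real_complex_cts (R : realType) (T : topologicalType) (f : T -> R) :
  continuous f -> continuous (fun x => (f x)%:C : R[i]^o).
Proof.
move=> cf x; apply/cvgrPdist_lt => e e0.
have [r r0 ->] : exists2 r : R, 0 < r & e = r%:C.
  by move: e0; case: (e) => a b /=; rewrite ltcE /= => /andP[/eqP -> a0]; exists a.
have /cvgrPdist_lt/(_ _ r0) := cf x.
apply: filterS => y; rewrite -rmorphB -Defs.normcE ltcR.
by rewrite normc_real.
Qed.

Lemma fst_cts (T U V : topologicalType) (f : T -> V) :
  continuous f -> continuous (fun p : T * U => f p.1).
Proof. by move=> cf p; apply: (cvg_comp fst f); [exact: cvg_fst | exact: cf]. Qed.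

Lemma snd_cts (T U V : topologicalType) (f : U -> V) :
  continuous f -> continuous (fun p : T * U => f p.2).
Proof. by move=> cf p; apply: (cvg_comp snd f); [exact: cvg_snd | exact: cf]. Qed.

Section modulus.
Variables (R : realType) (X : compactType) (n : nat) (F : X -> 'M[R]_n.+1).
Hypothesis F_cts : forall i j, continuous (fun x => F x i j).
Hypothesis F_inj : injective F.

Lemma sqdist_cts : continuous (fun p : X * X => sqdist (F p.1) (F p.2)).
Proof.
apply: continuous_big => [|i _]; first exact: add_continuous.
apply: continuous_big => [|j _]; first exact: add_continuous.
move=> p.
have c1 := @fst_cts X X R _ (@F_cts i j) p.
have c2 := @snd_cts X X R _ (@F_cts i j) p.
exact: (cvgM (cvgB c1 c2) (cvgB c1 c2)).
Qed.

(** On the compact set of pairs with |g x - g y| >= e the distance from F x to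
    F y is bounded away from 0. *)
Lemma modulus (g : contC R X) (e : R) : 0 < e -> exists2 N : R, 0 <= N &
  forall x y, normc (Cfun g x - Cfun g y) <= e + N * sqdist (F x) (F y).
Proof.
move=> e0; pose t (p : X * X) : R := normc (Cfun g p.1 - Cfun g p.2).
have t_cts : continuous t.
  apply: normc_cts => p; apply: cvgB.
    exact: (@fst_cts X X R[i]^o _ (@Ccont_continuous _ _ g) p).
  exact: (@snd_cts X X R[i]^o _ (@Ccont_continuous _ _ g) p).
pose h p := sqdist (F p.1) (F p.2) + ((e - t p) + `|e - t p|).
have h_cts : continuous h.
  move=> p; apply: cvgD; first exact: sqdist_cts.
  have ct : e - t q @[q --> p] --> e - t p by apply: cvgB; [exact: cvg_cst | exact: t_cts].
  by apply: cvgD => //; exact: cvg_norm.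
have t_hi p : 0 <= (e - t p) + `|e - t p|.
  by rewrite addrC -[X in _ + X]opprK subr_ge0 -normrN ler_norm.
have h_lo p : e <= t p -> h p = sqdist (F p.1) (F p.2).
  by move=> ep; rewrite /h ler0_norm ?subrr ?addr0// subr_le0.
have h_gt0 p : 0 < h p.
  have [tp|ep] := ltP (t p) e.
    by rewrite ltr_wpDl ?sqdist_ge0// ltr_pwDl ?subr_gt0.
  rewrite h_lo// lt_neqAle sqdist_ge0 andbT eq_sym; apply/eqP => /sqdist_eq0/F_inj p12.
  by move: ep; rewrite /t p12 subrr ComplexField.Normc.normc0 leNgt e0.
have [x0 _] := @inhabited_setT X.
have cXX : compact [set: X * X].
  by rewrite -setXTT; apply: compact_setX; exact: compact_setT.
have [||c _ cmin] := @compact_EVT_min _ R h _ _ cXX.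
- by exists (x0, x0).
- exact: continuous_subspaceT.
have [K gK] := Ccont_bounded g.
have K0 : 0 <= K := le_trans (normc_ge0 _) (gK x0).
exists (2 * K / h c); first by rewrite divr_ge0 ?mulr_ge0// ltW.
move=> x y; have [xy|xy] := leP (t (x, y)) e.
  by rewrite (le_trans xy)// lerDl mulr_ge0 ?sqdist_ge0// divr_ge0 ?mulr_ge0// ltW.
rewrite -[leLHS]add0r lerD ?(ltW e0)//.
have hc : h c <= sqdist (F x) (F y) by rewrite -(h_lo (x, y)) ?(ltW xy)// cmin// inE.
have t2K : t (x, y) <= 2 * K.
  rewrite (le_trans (le_normcD _ _))// normcN; have := gK x; have := gK y; lra.
rewrite (le_trans t2K)// -[leLHS](divfK (lt0r_neq0 (h_gt0 c))).
by rewrite ler_wpM2l// divr_ge0 ?mulr_ge0// ltW.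
Qed.
End modulus.

Section dominated_sums.
Variables (R : realType) (E : comCstarType R) (I : finType) (k : I -> E).
Hypothesis k_ge0 : forall i, nonneg (k i).

Lemma dominated_real_sum (a r : I -> R) : (forall i, `|a i| <= r i) ->
  cnorm (\sum_i rcst E (a i) * k i) <= cnorm (\sum_i rcst E (r i) * k i).
Proof.
move=> ar; apply: cnorm_le_nonneg.
- rewrite star_sum; apply: eq_bigr => i _; have [sk _] := k_ge0 i.
  by rewrite starM star_rcst sk mulrC.
- rewrite -sumrB; apply: nonneg_sum => i _; rewrite -mulrBl -rmorphB.
  apply: nonnegM => //; apply: nonneg_rcst.
  by rewrite subr_ge0 (le_trans (ler_norm _)).
- rewrite -big_split; apply: nonneg_sum => i _; rewrite /= -mulrDl -rmorphD.
  apply: nonnegM => //; apply: nonneg_rcst.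
  by rewrite -[a i]opprK subr_ge0 (le_trans (ler_norm _))// normrN.
Qed.

Lemma dominated_sum (c : I -> R[i]) (r : I -> R) : (forall i, normc (c i) <= r i) ->
  cnorm (\sum_i c i *: k i) <= 2 * cnorm (\sum_i rcst E (r i) * k i).
Proof.
move=> cr; pose re i := complex.Re (c i); pose im i := complex.Im (c i).
have -> : \sum_i c i *: k i =
    (\sum_i rcst E (re i) * k i) + ('i%C : R[i]) *: \sum_i rcst E (im i) * k i.
  rewrite scaler_sumr -big_split; apply: eq_bigr => i _ /=.
  rewrite !mul_rcst scalerA -scalerDl; congr (_ *: _).
  by rewrite /re /im; case: (c i) => x y; apply/eqP;
    rewrite eq_complex /= !(mul0r, mul1r, subr0, addr0, add0r) !eqxx.
rewrite (le_trans (ler_cnormD _ _))// cnormZ.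
have -> : normc ('i%C : R[i]) = 1 by rewrite /= expr0n add0r expr1n sqrtr1.
rewrite mul1r mulr2n mulrDl mul1r lerD//; apply: dominated_real_sum => i;
  rewrite (le_trans _ (cr i))// /re /im; case: (c i) => x y /=;
  rewrite -sqrtr_sqr ler_wsqrtr// ?lerDl ?lerDr; exact: sqr_ge0.
Qed.

End dominated_sums.

Section functional_calculus.
Variables (R : realType) (X : compactType) (r : nat) (F : X -> 'M[R]_r.+1).
Hypothesis F_cts : forall i j, continuous (fun x => F x i j).
Hypothesis F_inj : injective F.
Hypothesis F_surj : forall v : 'rV[R]_r.+1, @sphere R r v -> exists x, F x = v^T *m v.
Variables (E : comCstarType R) (f : 'M[E]_r.+1).
Hypothesis fsa : forall i j, star (f i j) = f i j.
Hypothesis fT : f^T = f.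
Hypothesis ff : f *m f = f.
Hypothesis ftr : \tr f = 1.

Local Notation rc := (rcst E).

(** A finite approximation of the spectral measure of f: the weights are
    elements of E, and f is close to F x wherever the point x has weight. *)
Record quadrature (e : R) := Quadrature {
  q_index : finType;
  q_weight : q_index -> E;
  q_point : q_index -> X;
  q_weight_ge0 : forall m, nonneg (q_weight m);
  q_weight_sum : \sum_m q_weight m = 1;
  q_error : cnorm (\sum_m q_weight m * dist2 f (F (q_point m))) <= e }.

Arguments q_weight {e} q m.
Arguments q_point {e} q m.

Lemma quadrature_exists e : 0 < e -> exists _ : quadrature e, True.
Proof.
move=> e0; have [I [k [x [k0 sx k1 ke]]]] := exists_quadrature fsa fT ff ftr e0.
have /choice[y yP] m := F_surj (sx m).
by unshelve eexists; first by exists I k y => //; under eq_bigr do rewrite yP.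
Qed.

Definition q_sum e (q : quadrature e) (g : X -> R[i]) : E :=
  \sum_m g (q_point q m) *: q_weight q m.

Definition q_sum2 e e' (q : quadrature e) (q' : quadrature e') (h : X -> X -> R[i]) : E :=
  \sum_(p : q_index q * q_index q')
    h (q_point q p.1) (q_point q' p.2) *: (q_weight q p.1 * q_weight q' p.2).

Lemma q_sum2_prod e e' (q : quadrature e) (q' : quadrature e') g g' :
  q_sum2 q q' (fun x y => g x * g' y) = q_sum q g * q_sum q' g'.
Proof.
rewrite /q_sum big_distrlr/= pair_bigA; apply: eq_bigr => p _ /=.
by rewrite -scalerAl -scalerAr scalerA.
Qed.

Lemma q_sum_cst1 e (q : quadrature e) : q_sum q (fun=> 1) = 1.
Proof. by rewrite /q_sum -[RHS](q_weight_sum q); apply: eq_bigr => m _;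
  rewrite scale1r. Qed.

(** By the triangle inequality through f, two points that both carry weight
    are close to each other. *)
Lemma q_sum2_le e e' (q : quadrature e) (q' : quadrature e') h (d N : R) :
  0 <= N -> 0 <= d ->
  (forall x y, normc (h x y) <= d + N * sqdist (F x) (F y)) ->
  cnorm (q_sum2 q q' h) <= 2 * (d + N * (2 * (e + e'))).
Proof.
move=> N0 d0 hN.
have w0 (p : q_index q * q_index q') : nonneg (q_weight q p.1 * q_weight q' p.2).
  by apply: nonnegM; exact: q_weight_ge0.
rewrite (le_trans (dominated_sum w0 (fun p => hN _ _)))// ler_wpM2l//.
set S := \sum_p rc (sqdist (F (q_point q p.1)) (F (q_point q' p.2))) * (q_weight q p.1 *
  q_weight q' p.2).
have w1 : \sum_(p : q_index q * q_index q') q_weight q p.1 * q_weight q' p.2 = 1.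
  rewrite -(pair_bigA _ (fun i j => q_weight q i * q_weight q' j)) -big_distrlr/=.
  by rewrite !q_weight_sum mulr1.
have -> : \sum_(p : q_index q * q_index q') rc (d + N * sqdist (F (q_point q p.1)) (F
  (q_point q' p.2))) *
    (q_weight q p.1 * q_weight q' p.2) = rc d + rc N * S.
  rewrite -[rc d]mulr1 -w1 !mulr_sumr -big_split; apply: eq_bigr => p _ /=.
  by ring.
rewrite (le_trans (ler_cnormD _ _))// cnorm_rcst cnormMr !ger0_norm// lerD2l ler_wpM2l//.
pose T := \sum_m q_weight q m * dist2 f (F (q_point q m)).
pose T' := \sum_m q_weight q' m * dist2 f (F (q_point q' m)).
have TT : T + T' = \sum_(p : q_index q * q_index q')
    (dist2 f (F (q_point q p.1)) + dist2 f (F (q_point q' p.2))) * (q_weight q p.1 *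
      q_weight q' p.2).
  rewrite -[T]mulr1 -[T']mul1r -{1}(q_weight_sum q') -(q_weight_sum q) !big_distrlr/=.
  rewrite !pair_bigA -big_split; apply: eq_bigr => p _ /=; ring.
have S0 : nonneg S.
  by apply: nonneg_sum => p _; apply: nonnegM => //; exact/nonneg_rcst/sqdist_ge0.
have ST : nonneg ((T + T') *+ 2 - S).
  rewrite TT -sumrMnl -sumrB; apply: nonneg_sum => p _.
  move: (F (q_point q p.1)) (F (q_point q' p.2)) => a b.
  rewrite -mulrnAl -mulrBl; apply: nonnegM => //.
  have -> : (dist2 f a + dist2 f b) *+ 2 - rc (sqdist a b) =
      \sum_i \sum_j ((rc (a i j) - f i j) + (rc (b i j) - f i j)) ^+ 2.
    rewrite /dist2 !sqnorm_mxE /sqdist rmorph_sum -big_split -sumrMnl -sumrB.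
    apply: eq_bigr => i _; rewrite rmorph_sum -big_split -sumrMnl -sumrB.
    by apply: eq_bigr => j _; rewrite /= !mxE; ring.
  apply: nonneg_sum => i _; apply: nonneg_sum_sqr => j.
  by rewrite starD !starB !star_rcst !fsa.
rewrite (le_trans (nonneg_cnorm_le S0 ST))// mulr2n.
rewrite (le_trans (ler_cnormD _ _))//.
have := ler_cnormD T T'; have := q_error q; have := q_error q'; rewrite -/T -/T'.
by lra.
Qed.

(** The difference of a coordinate and f i j is dominated by its square, which
    is part of the squared distance. *)
Lemma q_sum_coord e (q : quadrature e) i j (d : R) : 0 < d ->
  cnorm (q_sum q (fun x => (F x i j)%:C) - f i j) <= d ^+ 2 + (2 * d) ^- 2 * e.
Proof.
move=> d0; pose w := (2 * d)^-1; have w0 : 0 <= w by rewrite invr_ge0 mulr_ge0// ltW.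
have dr : rc d * rc w = rc 2^-1.
  by rewrite -rmorphM /w invfM mulrCA mulfV ?mulr1 ?lt0r_neq0.
pose t m := rc (F (q_point q m) i j) - f i j.
have st m : star (t m) = t m by rewrite starB star_rcst fsa.
pose T := \sum_m q_weight q m * dist2 f (F (q_point q m)).
have -> : q_sum q (fun x => (F x i j)%:C) - f i j = \sum_m q_weight q m * t m.
  under [RHS]eq_bigr do rewrite mulrBr.
  rewrite sumrB -mulr_suml q_weight_sum mul1r; congr (_ - _).
  by apply: eq_bigr => m _; rewrite -mul_rcst mulrC.
have bE (s : R) : rc s * rc s = 1 ->
    nonneg (rc (d ^+ 2) + rc (w ^+ 2) * T + rc s * \sum_m q_weight q m * t m).
  move=> s1; rewrite -[rc (d ^+ 2)]mulr1 -(q_weight_sum q) !mulr_sumr -!big_split.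
  apply: nonneg_sum => m _ /=.
  have -> : rc (d ^+ 2) * q_weight q m + rc (w ^+ 2) * (q_weight q m * dist2 f (F (q_point
    q m)))
      + rc s * (q_weight q m * t m) =
    q_weight q m * ((rc d + rc s * rc w * t m) ^+ 2 +
      rc (w ^+ 2) * (dist2 f (F (q_point q m)) - t m ^+ 2)).
    have d2 : rc d * rc w * 2 = 1.
      by rewrite dr -(rmorph_nat rc) -rmorphM mulVf ?pnatr_eq0// rmorph1.
    by ring: s1 d2.
  apply: nonnegM; first exact: q_weight_ge0.
  apply: nonnegD.
    by rewrite expr2; apply: nonneg_sqr;
      rewrite starD !starM !star_rcst st mulrC (mulrC (rc w)).
  apply: nonnegM; first exact/nonneg_rcst/sqr_ge0.
  rewrite /dist2 sqnorm_mxE (bigD1 i)//= (bigD1 j)//= !mxE -/(t m).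
  rewrite -[t m ^+ 2 + _ + _]addrA [t m ^+ 2 + _]addrC addrK; apply: nonnegD.
    apply: nonneg_sum => j' _; rewrite !mxE expr2; apply: nonneg_sqr.
    by rewrite starB star_rcst fsa.
  apply: nonneg_sum => i' _; apply: nonneg_sum_sqr => j'; rewrite !mxE.
  by rewrite starB star_rcst fsa.
have b1 := bE 1; have b2 := bE (-1).
rewrite (@le_trans _ _ (cnorm (rc (d ^+ 2) + rc (w ^+ 2) * T)))//.
  apply: cnorm_le_nonneg.
  - rewrite star_sum; apply: eq_bigr => m _; have [sk _] := q_weight_ge0 m.
    by rewrite starM sk st mulrC.
  - by rewrite -mulN1r -(rmorphN1 rc); apply: b2; rewrite rmorphN1 mulrNN mulr1.
  - by rewrite -[X in _ + X]mul1r -(rmorph1 rc); apply: b1; rewrite rmorph1 mulr1.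
rewrite (le_trans (ler_cnormD _ _))// cnorm_rcst ger0_norm ?sqr_ge0// lerD2l.
rewrite cnormMr ger0_norm ?sqr_ge0// /w exprVn ler_wpM2l ?invr_ge0 ?sqr_ge0//.
exact: q_error.
Qed.

Lemma q_sum2B e e' (q : quadrature e) (q' : quadrature e') h h' :
  q_sum2 q q' h - q_sum2 q q' h' = q_sum2 q q' (fun x y => h x y - h' x y).
Proof. by rewrite -sumrB; apply: eq_bigr => p _; rewrite scalerBl. Qed.

(** Phi g is the limit of the sums of g over quadratures of increasing
    precision. Both that these sums are a Cauchy sequence and that the limit is
    multiplicative follow from q_sum2_le: the double sums of g x - g y and of
    g x (h x - h y) tend to 0, since g and h hardly vary over pairs of points
    that carry weight. *)
Theorem functional_calculus : exists Phi : contC R X -> E,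
  [/\ forall a g h, Phi (Ccst X a * g + h) = a *: Phi g + Phi h,
      Phi 1 = 1, forall g h, Phi (g * h) = Phi g * Phi h,
      forall g, Phi (Cconj g) = star (Phi g) &
      forall (g : contC R X) i j, (forall x, Cfun g x = (F x i j)%:C) -> Phi g = f i j].
Proof.
pose d n : R := n.+1%:R^-1.
have d0 n : 0 < d n by rewrite invr_gt0 ltr0n.
have dle m n : (m <= n)%N -> d n <= d m.
  by move=> mn; rewrite lef_pV2 ?posrE ?ltr0n// ler_nat.
pose q n : quadrature (d n) := projT1 (cid (quadrature_exists (d0 n))).
pose S n (g : contC R X) := q_sum (q n) (Cfun g).
have small (K e : R) : 0 <= K -> 0 < e -> exists M, K * d M < e.
  move=> K0 e0; exists (Num.bound (K / e)).
  rewrite ltr_pdivrMr ?ltr0n// mulrC -ltr_pdivrMr//.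
  by rewrite (lt_trans (archi_boundP _)) ?ltr_nat// divr_ge0// ltW.
have near0 h : (forall e : R, 0 < e -> exists2 N, 0 <= N &
      forall x y, normc (h x y) <= e + N * sqdist (F x) (F y)) ->
    forall e : R, 0 < e -> exists M, forall m n, (M <= m)%N -> (M <= n)%N ->
      cnorm (q_sum2 (q m) (q n) h) < e.
  move=> hN e e0; have e4 : 0 < e / 4 by rewrite divr_gt0.
  have [N N0 NP] := hN _ e4; have [||M MP] := small (8 * N) (e / 2).
  - by rewrite mulr_ge0.
  - by rewrite divr_gt0.
  exists M => m n Mm Mn; rewrite (le_lt_trans (q_sum2_le _ _ N0 (ltW e4) NP))//.
  have : N * (2 * (d m + d n)) <= N * (2 * (d M + d M)).
    by rewrite ler_wpM2l// ler_wpM2l// lerD// dle.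
  by move: MP; lra.
have Scvg g : exists l, tends_to (fun n => S n g) l.
  apply: cauchy_tends_to => e e0.
  have [M MP] := near0 _ (fun d d0 => modulus F_cts F_inj g d0) e e0.
  exists M => m n Mm Mn; have := MP m n Mm Mn; rewrite -q_sum2B.
  have -> : q_sum2 (q m) (q n) (fun x _ => Cfun g x) = S m g.
    rewrite -[S m g]mulr1 -(q_sum_cst1 (q n)) -q_sum2_prod.
    by congr q_sum2; apply: funext => x; apply: funext => y; rewrite mulr1.
  suff -> : q_sum2 (q m) (q n) (fun _ y => Cfun g y) = S n g by [].
  rewrite -[S n g]mul1r -(q_sum_cst1 (q m)) -q_sum2_prod.
  by congr q_sum2; apply: funext => x; apply: funext => y; rewrite mul1r.
have [Phi PhiP] := choice Scvg.
exists Phi; split.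
- move=> a g h; apply: tends_to_unique (PhiP _) _.
  rewrite (_ : (fun n => _) = (fun n => a *: S n g + S n h)); last first.
    apply: funext => n; rewrite scaler_sumr -big_split; apply: eq_bigr => m _.
    by rewrite /= scalerA -scalerDl.
  exact: tends_toD (tends_toZ _ (PhiP g)) (PhiP h).
- apply: tends_to_unique (PhiP _) _.
  rewrite (_ : (fun n => _) = (fun=> 1)); first exact: tends_to_cst.
  by apply: funext => n; exact: q_sum_cst1.
- move=> g h; apply: tends_to_unique (PhiP _) _; rewrite -[Phi g * _]add0r.
  rewrite (_ : S^~ (g * h) = (fun n => (S n (g * h) - S n g * S n h) + S n g * S n h));
    last first.
    by apply: funext => n; rewrite subrK.
  apply: tends_toD; last exact: tends_toM.
  have [K gK] := Ccont_bounded g.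
  have [x0 _] := @inhabited_setT X.
  have K0 : 0 <= K := le_trans (normc_ge0 _) (gK x0).
  have hN e : 0 < e -> exists2 N, 0 <= N & forall x y,
      normc (Cfun g x * (Cfun h x - Cfun h y)) <= e + N * sqdist (F x) (F y).
    move=> e0; have [|N N0 NP] := modulus F_cts F_inj h (_ : 0 < e / (K + 1)).
      by rewrite divr_gt0// ltr_wpDl.
    exists (K * N); first by rewrite mulr_ge0.
    move=> x y; rewrite ComplexField.Normc.normcM.
    rewrite (le_trans (ler_pM (normc_ge0 _) (normc_ge0 _) (gK x) (NP x y)))//.
    rewrite mulrDr [K * (N * _)]mulrA lerD2r mulrCA ler_piMr ?(ltW e0)//.
    by rewrite ler_pdivrMr ?mul1r ?lerDl// ltr_wpDl.
  move=> e e0; have [M MP] := near0 _ hN e e0.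
  exists M => n Mn; have := MP n n Mn Mn; rewrite subr0.
  have -> : q_sum2 (q n) (q n) (fun x y => Cfun g x * (Cfun h x - Cfun h y)) =
      S n (g * h) - S n g * S n h.
    rewrite -q_sum2_prod -[S n (g * h)]mulr1 -(q_sum_cst1 (q n)) -q_sum2_prod q_sum2B.
    by congr q_sum2; apply: funext => x; apply: funext => y; rewrite mulr1 mulrBr.
  by [].
- move=> g; apply: tends_to_unique (PhiP _) _.
  rewrite (_ : (fun n => _) = (fun n => star (S n g))); first exact: tends_to_star.
  apply: funext => n; rewrite star_sum; apply: eq_bigr => m _.
  by have [sk _] := q_weight_ge0 m; rewrite starZ sk.
- move=> g i j gF; apply: tends_to_unique (PhiP _) _ => e e0.
  pose t := Num.min 1 (e / 2).
  have t0 : 0 < t by rewrite lt_min ltr01 divr_gt0.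
  have t1 : t <= 1 by rewrite ge_min lexx.
  have te : t <= e / 2 by rewrite ge_min lexx orbT.
  have [||M MP] := small ((2 * t) ^- 2) (e / 2).
  - by rewrite invr_ge0 sqr_ge0.
  - by rewrite divr_gt0.
  exists M => n Mn; rewrite /S (_ : Cfun g = (fun x => (F x i j)%:C)); last exact: funext.
  rewrite (le_lt_trans (q_sum_coord _ i j t0))//.
  have : (2 * t) ^- 2 * d n <= (2 * t) ^- 2 * d M.
    by rewrite ler_wpM2l ?dle// invr_ge0 sqr_ge0.
  have : t ^+ 2 <= t * 1 by rewrite expr2 ler_wpM2l// ltW.
  by move: MP; lra.
Qed.

End functional_calculus.

(** * Characters of C(X) and coordinates of the projective space *)

Section characters.
Variables (R : realType) (X : compactType) (n : nat) (F : X -> 'M[R]_n.+1).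
Hypothesis F_cts : forall i j, continuous (fun x => F x i j).
Hypothesis F_inj : injective F.

Definition coordinate i j : contC R X :=
  mkC (real_complex_cts (F_cts (i := i) (j := j))).

(** If chi g were not g x, then |g - chi g| ^+ 2 plus the squared distance to x
    would be invertible in C(X), yet chi vanishes on it. *)
Lemma character_eval (chi : {rmorphism contC R X -> R[i]}) (x : X) :
  (forall a, chi (Ccst X a) = a) ->
  (forall i j, chi (coordinate i j) = (F x i j)%:C) ->
  forall g, chi g = Cfun g x.
Proof.
move=> chiC chiF g; apply/eqP/negPn/negP => gx.
pose h := g - Ccst X (chi g).
pose t i j := coordinate i j - Ccst X (F x i j)%:C.
pose u := Cconj h * h + \sum_i \sum_j t i j * t i j.
have chi_u : chi u = 0.
  rewrite rmorphD rmorphM [chi h]rmorphB chiC subrr mulr0 add0r.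
  rewrite rmorph_sum big1// => i _; rewrite rmorph_sum big1// => j _.
  by rewrite rmorphM rmorphB chiC chiF subrr mulr0.
have CfunS (s : seq 'I_n.+1) (G : 'I_n.+1 -> contC R X) y :
    Cfun (\sum_(i <- s) G i) y = \sum_(i <- s) Cfun (G i) y.
  by apply: (big_morph (fun g : contC R X => Cfun g y : R[i]^o)).
have uE y : Cfun u y = (normc (Cfun g y - chi g) ^+ 2 + sqdist (F y) (F x))%:C.
  rewrite rmorphD rmorphXn; congr (_ + _).
    by rewrite /= Defs.normcE sqr_normc mulrC.
  rewrite CfunS /sqdist rmorph_sum; apply: eq_bigr => i _.
  rewrite CfunS rmorph_sum; apply: eq_bigr => j _.
  by rewrite expr2 rmorphM rmorphB.
have u0 y : Cfun u y != 0.
  rewrite uE; apply/eqP => /complexI/eqP; rewrite paddr_eq0 ?sqr_ge0 ?sqdist_ge0//.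
  move=> /andP[gy /eqP/sqdist_eq0/F_inj yx]; move: gy; rewrite yx sqrf_eq0 => /eqP.
  move/ComplexField.Normc.eq0_normc/eqP; rewrite subr_eq0 eq_sym => /eqP gx'.
  by move: gx; rewrite -gx' eqxx.
have uV_cts : continuous (fun y => (Cfun u y)^-1 : R[i]^o).
  by move=> y; apply: cvgV; [exact: u0 | exact: Ccont_continuous].
have uV : u * mkC uV_cts = 1 by apply: CcontP => y; exact: (mulfV (u0 y)).
have := congr1 chi uV; rewrite rmorphM chi_u mul0r rmorph1 => /esym/eqP.
by rewrite oner_eq0.
Qed.

End characters.

Section projective_space.
Variables (R : realType) (n : nat).
Local Notation RP := (real_projective_space R n).
Local Notation pi := (\pi_RP : @sphere R n -> RP)%qT.

Lemma RP_piP (v w : @sphere R n) : reflect (pi v = pi w) (antipodal v w).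
Proof. exact: (@eqmodP _ (antipodal_equiv R n) v w). Qed.

Definition RPmx (q : RP) : 'M[R]_n.+1 := (val (repr q))^T *m val (repr q).

Lemma sphere_mul_tr (v : @sphere R n) : val v *m (val v)^T = 1%:M.
Proof.
have := set_valP v; rewrite /sphere /= => v1.
by apply/matrixP => i j; rewrite !ord1 mxE mxE eqxx -[RHS]v1; apply: eq_bigr => k _;
  rewrite mxE expr2.
Qed.

Lemma RPmx_pi v : RPmx (pi v) = (val v)^T *m val v.
Proof.
rewrite /RPmx; have /RP_piP/orP[] := reprK (pi v) => /eqP -> //.
by rewrite mulmxN [(- _)^T]linearN/= mulNmx opprK.
Qed.

Lemma RPmx_surj v : @sphere R n v -> exists q, RPmx q = v^T *m v.
Proof. by move=> sv; exists (pi (SigSub (mem_set sv))); rewrite RPmx_pi. Qed.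

Lemma RPmx_inj : injective RPmx.
Proof.
move=> p q; rewrite /RPmx => pq; rewrite -[p]reprK -[q]reprK.
move: (repr p) (repr q) pq => v w vw; apply/RP_piP; rewrite /antipodal.
pose c := (val v *m (val w)^T) 0 0.
have vE : val v = c *: val w.
  rewrite -[LHS]mul1mx -(sphere_mul_tr v) -mulmxA vw mulmxA.
  by rewrite [val v *m _]mx11_scalar mul_scalar_mx.
have : (val v *m (val v)^T) 0 0 = 1 by rewrite sphere_mul_tr mxE eqxx.
rewrite vE [(_ *: _)^T]linearZ/= -scalemxAr -scalemxAl scalerA sphere_mul_tr !mxE mulr1
  -expr2 => /eqP.
rewrite sqrf_eq1 => /orP[] /eqP ->; first by rewrite scale1r eqxx.
by rewrite scaleN1r eqxx orbT.
Qed.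

Lemma RPmx_cts i j : continuous (fun q => RPmx q i j).
Proof.
have c1 k : continuous (fun v : @sphere R n => val v 0 k).
  move=> v; apply: (cvg_comp val (fun w : 'rV[R]_n.+1 => w 0 k));
    last exact: coord_continuous.
  exact: initial_continuous.
have c : continuous (fun v : @sphere R n => val v 0 i * val v 0 j).
  by move=> v; exact: (cvgM (c1 i v) (c1 j v)).
have -> : (fun q => RPmx q i j) = (fun v : @sphere R n => val v 0 i * val v 0 j) \o repr.
  by apply: funext => q; rewrite /RPmx !mxE big_ord1 mxE.
apply: repr_comp_continuous => //.
move=> a b /eqP/RP_piP/orP[] /eqP /= ->; rewrite ?eqxx// !mxE mulrNN eqxx//.
Qed.

End projective_space.

(** * Matrix units *)

Section matrix_units.
Variables (R : realType) (D : cstarType R) (n : nat) (e : 'I_n.+1 -> 'I_n.+1 -> D).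
Hypothesis e_mul : forall a b c d, e a b * e c d = if b == c then e a d else 0.
Hypothesis e_sum : \sum_a e a a = 1.
Hypothesis e_star : forall a b, star (e a b) = e b a.
Implicit Types (x y : D) (a b c d : 'I_n.+1).

(** The entries of x when D is written as the matrix algebra over the
    commutant of the matrix units. *)
Definition entry x a b : D := \sum_c e c a * x * e b c.

Lemma entry_comm x a b c d : e c d * entry x a b = entry x a b * e c d.
Proof.
rewrite /entry mulr_sumr mulr_suml (bigD1 d)//= big1 => [|i /negbTE id].
  rewrite (bigD1 c)//= [in RHS]big1 => [|i /negbTE ic].
    by rewrite !addr0 !mulrA e_mul eqxx -[in RHS]mulrA e_mul eqxx.
  by rewrite -mulrA e_mul ic mulr0.
by rewrite !mulrA e_mul eq_sym id !mul0r.
Qed.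

Lemma entryE x : x = \sum_a \sum_b entry x a b * e a b.
Proof.
rewrite -{1}[x]mul1r -{1}[1 * x]mulr1 -e_sum mulr_suml mulr_suml.
apply: eq_bigr => a _; rewrite mulr_sumr; apply: eq_bigr => b _.
rewrite /entry mulr_suml (bigD1 a)//= big1 => [|i /negbTE ia].
  by rewrite addr0 -!mulrA e_mul eqxx.
by rewrite -mulrA e_mul ia mulr0.
Qed.

Lemma entryM x y a b : entry (x * y) a b = \sum_c entry x a c * entry y c b.
Proof.
transitivity (\sum_d \sum_c e d a * x * e c c * y * e b d).
  apply: eq_bigr => d _.
  by rewrite -!mulr_suml -mulr_sumr e_sum mulr1 mulrA.
rewrite exchange_big; apply: eq_bigr => c _.
rewrite /entry mulr_suml; apply: eq_bigr => d _.
rewrite mulr_sumr (bigD1 d)//= big1 => [|i /negbTE id].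
  rewrite addr0; rewrite !mulrA; congr (_ * _ * _).
  by rewrite -[RHS]mulrA e_mul eqxx.
by rewrite !mulrA -[_ * e c d * e i c]mulrA e_mul eq_sym id mulr0 !mul0r.
Qed.

Lemma entry_e a b c d : entry (e c d) a b = if (a == c) && (d == b) then 1 else 0.
Proof.
transitivity (\sum_i if (a == c) && (d == b) then e i i else 0).
  apply: eq_bigr => i _; rewrite e_mul; have [ac|_] := eqVneq a c; last by rewrite mul0r.
  by rewrite e_mul.
by case: ifP => _; [exact: e_sum | rewrite big1].
Qed.

Lemma entry_star x a b : star (entry x a b) = entry (star x) b a.
Proof. by rewrite star_sum; apply: eq_bigr => c _; rewrite !starM !e_star mulrA. Qed.

End matrix_units.

(** * The action of unit quaternions on R^4 *)

(** On natural numbers the tables can be evaluated by the kernel, whereas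
    elements of 'I_4 made by inord cannot. *)
Definition klein_nat (i j : nat) : nat := nth 0%N (nth [::]
  [:: [:: 0; 1; 2; 3]; [:: 1; 0; 3; 2]; [:: 2; 3; 0; 1]; [:: 3; 2; 1; 0]] i) j.

Definition epsilon_nat (i j : nat) : int := nth 0 (nth [::]
  [:: [:: 1; 1; 1; 1]; [:: 1; -1; 1; -1]; [:: 1; -1; -1; 1]; [:: 1; 1; -1; -1]] i) j.

Definition quat_nat (k l a b : nat) : int :=
  if klein_nat (klein_nat k b) l == a
  then epsilon_nat l l * epsilon_nat k b * epsilon_nat (klein_nat k b) l else 0.

(** The cocycle epsilon is the multiplication table of the quaternions: for the
    basis c_1 = 1, c_2, c_3, c_4 one has c_i c_j = epsilon i j c_(t_i(j)) and
    c_l^* = epsilon l l c_l. So quat (k, l) is the matrix of x |-> c_k x c_l^*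
    in this basis. *)
Definition quat (p : 'I_4 * 'I_4) (a b : 'I_4) : int := quat_nat p.1 p.2 a b.

Definition klein2 (p q : 'I_4 * 'I_4) : 'I_4 * 'I_4 := (klein p.1 q.1, klein p.2 q.2).
Definition epsilon2 (p q : 'I_4 * 'I_4) : int := epsilon p.1 q.1 * epsilon p.2 q.2.

Local Notation I4 := (iota 0 4).

Lemma all_I4 (P : pred nat) : all P I4 -> forall i : 'I_4, P i.
Proof. by move=> /allP h i; apply: h; rewrite mem_iota ltn_ord. Qed.

Definition sum4 (F : nat -> int) : int := F 0%N + F 1%N + F 2%N + F 3%N.

Lemma sum4E (F : nat -> int) : \sum_(i < 4) F i = sum4 F.
Proof. by rewrite !big_ord_recr big_ord0 /= add0r. Qed.

Lemma klein_natE i j : klein i j = klein_nat i j :> nat.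
Proof.
rewrite kleinE /klein_line; move: i j.
by do 2!case=> [[|[|[|[|//]]]]] ?; rewrite /= ?inordK.
Qed.

Lemma epsilon_natE (i j : 'I_4) : epsilon i j = epsilon_nat i j.
Proof. exact: epsilonE. Qed.

Lemma quat_mul p q a b :
  \sum_c quat p a c * quat q c b = epsilon2 p q * quat (klein2 p q) a b.
Proof.
have h : all (fun i => all (fun j => all (fun k => all (fun l => all (fun x => all (fun y =>
  sum4 (fun z => quat_nat i j x z * quat_nat k l z y) ==
    epsilon_nat i k * epsilon_nat j l * quat_nat (klein_nat i k) (klein_nat j l) x y)
  I4) I4) I4) I4) I4) I4 by vm_compute.
rewrite (sum4E (fun z => quat_nat p.1 p.2 a z * quat_nat q.1 q.2 z b)).
rewrite /epsilon2 /quat !epsilon_natE !klein_natE; apply/eqP.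
by have /all_I4/(_ p.1)/all_I4/(_ p.2)/all_I4/(_ q.1)/all_I4/(_ q.2)/all_I4/(_ a)/all_I4/(_
  b) := h.
Qed.

Lemma quat_orthogonal p q :
  \sum_a \sum_b quat p a b * quat q a b = if p == q then 4 else 0.
Proof.
have h : all (fun i => all (fun j => all (fun k => all (fun l =>
  sum4 (fun x => sum4 (fun y => quat_nat i j x y * quat_nat k l x y)) ==
    if (i == k) && (j == l) then 4 else 0) I4) I4) I4) I4 by vm_compute.
under eq_bigr do rewrite (sum4E (fun y => quat_nat p.1 p.2 _ y * quat_nat q.1 q.2 _ y)).
rewrite (sum4E (fun x => sum4 (fun y => quat_nat p.1 p.2 x y * quat_nat q.1 q.2 x y))).
apply/eqP; rewrite -[p == q]/((p.1 == q.1) && (p.2 == q.2)).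
by have /all_I4/(_ p.1)/all_I4/(_ p.2)/all_I4/(_ q.1)/all_I4/(_ q.2) := h.
Qed.

Lemma quat_complete a b c d :
  \sum_p quat p a b * quat p c d = if (a == c) && (b == d) then 4 else 0.
Proof.
have h : all (fun x => all (fun y => all (fun x' => all (fun y' =>
  sum4 (fun i => sum4 (fun j => quat_nat i j x y * quat_nat i j x' y')) ==
    if (x == x') && (y == y') then 4 else 0) I4) I4) I4) I4 by vm_compute.
transitivity (\sum_(i < 4) \sum_(j < 4) quat_nat i j a b * quat_nat i j c d).
  by rewrite pair_bigA.
under eq_bigr do rewrite (sum4E (fun j => quat_nat _ j a b * quat_nat _ j c d)).
rewrite (sum4E (fun i => sum4 (fun j => quat_nat i j a b * quat_nat i j c d))).
apply/eqP; by have /all_I4/(_ a)/all_I4/(_ b)/all_I4/(_ c)/all_I4/(_ d) := h.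
Qed.

Lemma quat_tr p a b : quat p b a = epsilon2 p p * quat p a b.
Proof.
have h : all (fun i => all (fun j => all (fun x => all (fun y =>
  quat_nat i j y x == epsilon_nat i i * epsilon_nat j j * quat_nat i j x y)
  I4) I4) I4) I4 by vm_compute.
rewrite /epsilon2 !epsilon_natE; apply/eqP.
by have /all_I4/(_ p.1)/all_I4/(_ p.2)/all_I4/(_ a)/all_I4/(_ b) := h.
Qed.

(** c_k x c_l^* is antisymmetric in x exactly if one of c_k, c_l is 1 and the
    other one is imaginary. *)
Lemma quat_sym p a b : (p.1 == 0) = (p.2 == 0) -> quat p b a = quat p a b.
Proof.
move=> p12; rewrite quat_tr.
have h : all (fun i => all (fun j => ((i == 0%N) == (j == 0%N)) ==>
  (epsilon_nat i i * epsilon_nat j j == 1)) I4) I4 by vm_compute.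
have /all_I4/(_ p.1)/all_I4/(_ p.2)/implyP h1 := h.
rewrite /epsilon2 !epsilon_natE (eqP (h1 _)) ?mul1r//.
by apply/eqP; exact: p12.
Qed.

Lemma quat00 a b : quat (0, 0) a b = if a == b then 1 else 0.
Proof.
have h : all (fun x => all (fun y =>
  quat_nat 0 0 x y == if x == y then 1 else 0) I4) I4 by vm_compute.
by apply/eqP; have /all_I4/(_ a)/all_I4/(_ b) := h.
Qed.

(** For fixed x and k the four quaternions c_k x c_l^* are orthogonal and of
    the same length as x; this is the polarisation in x of that property. *)
Lemma quat_row k a b c d :
  \sum_l (quat (k, l) a c * quat (k, l) b d + quat (k, l) a d * quat (k, l) b c) =
  if (a == b) && (c == d) then 2 else 0.
Proof.
have h : all (fun k => all (fun x => all (fun y => all (fun z => all (fun t =>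
  sum4 (fun l => quat_nat k l x z * quat_nat k l y t + quat_nat k l x t * quat_nat k l y z)
    ==
   if (x == y) && (z == t) then 2 else 0) I4) I4) I4) I4) I4 by vm_compute.
rewrite (sum4E (fun l => quat_nat k l a c * quat_nat k l b d + quat_nat k l a d * quat_nat
  k l b c)).
apply/eqP; by have /all_I4/(_ k)/all_I4/(_ a)/all_I4/(_ b)/all_I4/(_ c)/all_I4/(_ d) := h.
Qed.

Lemma quat_col l a b c d :
  \sum_k (quat (k, l) a c * quat (k, l) b d + quat (k, l) a d * quat (k, l) b c) =
  if (a == b) && (c == d) then 2 else 0.
Proof.
have h : all (fun l => all (fun x => all (fun y => all (fun z => all (fun t =>
  sum4 (fun k => quat_nat k l x z * quat_nat k l y t + quat_nat k l x t * quat_nat k l y z)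
    ==
   if (x == y) && (z == t) then 2 else 0) I4) I4) I4) I4) I4 by vm_compute.
rewrite (sum4E (fun k => quat_nat k l a c * quat_nat k l b d + quat_nat k l a d * quat_nat
  k l b c)).
apply/eqP; by have /all_I4/(_ l)/all_I4/(_ a)/all_I4/(_ b)/all_I4/(_ c)/all_I4/(_ d) := h.
Qed.

(** c_i and c_j commute up to this sign. *)
Definition commsign (i j : 'I_4) : int := epsilon i j * epsilon j i.

Lemma klein_comm i j : klein i j = klein j i.
Proof.
have h : all (fun i => all (fun j => klein_nat i j == klein_nat j i) I4) I4 by vm_compute.
apply: val_inj => /=; rewrite !klein_natE; apply/eqP.
by have /all_I4/(_ i)/all_I4/(_ j) := h.
Qed.

Lemma epsilon_comm i j : epsilon i j = commsign i j * epsilon j i.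
Proof.
have h : all (fun i => all (fun j => epsilon_nat i j ==
  epsilon_nat i j * epsilon_nat j i * epsilon_nat j i) I4) I4 by vm_compute.
rewrite /commsign !epsilon_natE; apply/eqP.
by have /all_I4/(_ i)/all_I4/(_ j) := h.
Qed.

(** An imaginary c_j commutes with two of the basis quaternions and anticommutes
    with the other two. *)
Lemma sum_commsign j : \sum_i commsign i j = if j == 0 then 4 else 0.
Proof.
have h : all (fun j => sum4 (fun i => epsilon_nat i j * epsilon_nat j i) ==
   if j == 0%N then 4 else 0) I4 by vm_compute.
under eq_bigr do rewrite /commsign !epsilon_natE.
rewrite (sum4E (fun i => epsilon_nat i j * epsilon_nat j i)).
by apply/eqP; have /all_I4/(_ j) := h.
Qed.

Lemma commsign0 i : commsign i 0 = 1.
Proof.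
have h : all (fun i => epsilon_nat i 0 * epsilon_nat 0 i == 1) I4 by vm_compute.
by apply/eqP; rewrite /commsign !epsilon_natE; have /all_I4/(_ i) := h.
Qed.

Lemma klein_diag i : klein i i = 0.
Proof.
have h : all (fun i => klein_nat i i == 0%N) I4 by vm_compute.
by apply: val_inj => /=; rewrite klein_natE; apply/eqP; have /all_I4/(_ i) := h.
Qed.

Lemma klein0 i : klein i 0 = i.
Proof.
have h : all (fun i => klein_nat i 0 == i) I4 by vm_compute.
by apply: val_inj => /=; rewrite klein_natE; apply/eqP; have /all_I4/(_ i) := h.
Qed.

Lemma epsilon2_sqr p q : epsilon2 p q * epsilon2 p q = 1.
Proof.
have h : all (fun i => all (fun j => all (fun k => all (fun l =>
  (epsilon_nat i k * epsilon_nat j l) * (epsilon_nat i k * epsilon_nat j l) == 1) I4) I4)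
    I4) I4
  by vm_compute.
rewrite /epsilon2 !epsilon_natE; apply/eqP.
by have /all_I4/(_ p.1)/all_I4/(_ p.2)/all_I4/(_ q.1)/all_I4/(_ q.2) := h.
Qed.

(** * Representations of the twisted Klein group *)

Section twisted_representation.
Variables (R : realType) (D : cstarType R) (v : 'I_4 * 'I_4 -> D).
Hypothesis v_unitary : forall p, unitary (v p).
Hypothesis v_mul : forall p q, v p * v q = v (klein2 p q) *~ epsilon2 p q.
Local Notation C := R[i].
Local Notation q_ p a b := ((quat p a b)%:~R : C).
Local Notation c4 := (4%:R : C).

Let c40 : c4 != 0. Proof. by rewrite pnatr_eq0. Qed.

(** quat / 2 is an orthogonal matrix, indexed by pairs on both sides; this is
    the image of the matrix unit E_ab under the linear map which sends the
    matrix quat p to v p. *)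
Definition quat_unit (a b : 'I_4) : D := c4^-1 *: \sum_p q_ p a b *: v p.
Local Notation e := quat_unit.

Lemma quat_unitK p : v p = \sum_a \sum_b q_ p a b *: e a b.
Proof.
transitivity (c4^-1 *: \sum_q (\sum_a \sum_b q_ p a b * q_ q a b) *: v q); last first.
  rewrite scaler_sumr; under eq_bigr do rewrite scaler_suml scaler_sumr.
  rewrite exchange_big; apply: eq_bigr => a _.
  under eq_bigr do rewrite scaler_suml scaler_sumr.
  rewrite exchange_big; apply: eq_bigr => b _.
  rewrite /quat_unit !scaler_sumr; apply: eq_bigr => q _.
  by rewrite !scalerA; congr (_ *: _); ring.
have orth q : \sum_a \sum_b q_ p a b * q_ q a b = if p == q then c4 else 0.
  transitivity ((\sum_a \sum_b quat p a b * quat q a b)%:~R : C).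
    rewrite rmorph_sum; apply: eq_bigr => a _; rewrite rmorph_sum.
    by apply: eq_bigr => b _; rewrite rmorphM.
  by rewrite quat_orthogonal; case: ifP.
rewrite (bigD1 p)//= [X in _ + X]big1 ?addr0; last first.
  by move=> q /negbTE qp; rewrite orth eq_sym qp scale0r.
by rewrite orth eqxx scalerA mulVf// scale1r.
Qed.

Lemma sum_quatM a b c d :
  \sum_p q_ p a b * q_ p c d = if (a == c) && (b == d) then c4 else 0.
Proof.
under eq_bigr do rewrite -rmorphM.
by rewrite -rmorph_sum quat_complete; case: ifP.
Qed.

Let v_mulE p q : v p * v q = \sum_a \sum_b (\sum_z q_ p a z * q_ q z b) *: e a b.
Proof.
rewrite v_mul -scaler_int quat_unitK scaler_sumr; apply: eq_bigr => a _.
rewrite scaler_sumr; apply: eq_bigr => b _; rewrite scalerA -rmorphM -quat_mul.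
by rewrite rmorph_sum; congr (_ *: _); apply: eq_bigr => z _; rewrite rmorphM.
Qed.

Lemma quat_unit_mull p c d : v p * e c d = \sum_a q_ p a c *: e a d.
Proof.
rewrite {1}/quat_unit -scalerAr mulr_sumr.
transitivity (c4^-1 *: \sum_a \sum_b
    (\sum_q q_ q c d * \sum_z q_ p a z * q_ q z b) *: e a b).
  congr (_ *: _); under [RHS]eq_bigr do under eq_bigr do rewrite scaler_suml.
  under [RHS]eq_bigr do rewrite exchange_big.
  rewrite [RHS]exchange_big; apply: eq_bigr => q _.
  rewrite -scalerAr v_mulE scaler_sumr; apply: eq_bigr => a _.
  by rewrite scaler_sumr; apply: eq_bigr => b _; rewrite scalerA.
rewrite scaler_sumr; apply: eq_bigr => a _.
have inner b : \sum_q q_ q c d * (\sum_z q_ p a z * q_ q z b) =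
    if d == b then q_ p a c * c4 else 0.
  under eq_bigr do rewrite mulr_sumr.
  rewrite exchange_big (bigD1 c)//= [X in _ + X]big1 ?addr0 => [|z zc].
    under eq_bigr do rewrite mulrCA.
    by rewrite -mulr_sumr sum_quatM eqxx /=; case: ifP; rewrite ?mulr0.
  under eq_bigr do rewrite mulrCA.
  by rewrite -mulr_sumr sum_quatM eq_sym (negbTE zc) mulr0.
under eq_bigr do rewrite inner.
rewrite (bigD1 d)//= eqxx [X in _ + X]big1 ?addr0 => [|b bd].
  by rewrite scalerA mulrCA mulVf// mulr1.
by rewrite eq_sym (negbTE bd) scale0r.
Qed.

Lemma quat_unit_mul a b c d : e a b * e c d = if b == c then e a d else 0.
Proof.
rewrite {1}/quat_unit -scalerAl mulr_suml.
transitivity (c4^-1 *: \sum_x (\sum_p q_ p a b * q_ p x c) *: e x d).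
  congr (_ *: _); under [RHS]eq_bigr do rewrite scaler_suml.
  rewrite [RHS]exchange_big; apply: eq_bigr => p _.
  rewrite -scalerAl quat_unit_mull scaler_sumr.
  by apply: eq_bigr => x _; rewrite scalerA.
under eq_bigr do rewrite sum_quatM.
rewrite (bigD1 a)//= eqxx [X in _ + X]big1 ?addr0 => [|x xa].
  rewrite /=; case: ifP => _; last by rewrite scale0r scaler0.
  by rewrite scalerA mulVf// scale1r.
by rewrite eq_sym (negbTE xa) scale0r.
Qed.

Lemma twisted_rep1 : v (0, 0) = 1.
Proof.
have [v1 _] := v_unitary (0, 0).
have vv : v (0, 0) * v (0, 0) = v (0, 0).
  rewrite v_mul /klein2 /= klein0 /epsilon2 /= /epsilon /=.
  by rewrite mulr1z.
by rewrite -[LHS]mul1r -v1 -mulrA vv.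
Qed.

Lemma quat_unit_sum : \sum_a e a a = 1.
Proof.
rewrite -twisted_rep1 [RHS]quat_unitK; apply: eq_bigr => a _.
rewrite (bigD1 a)//= quat00 eqxx scale1r big1 ?addr0// => b /negbTE ba.
by rewrite quat00 eq_sym ba scale0r.
Qed.

Lemma twisted_rep_star p : star (v p) = v p *~ epsilon2 p p.
Proof.
have [v1 _] := v_unitary p.
have vv : v p * v p = 1 *~ epsilon2 p p by rewrite v_mul /klein2 !klein_diag twisted_rep1.
rewrite -[LHS]mulr1; transitivity (star (v p) * (v p * v p) *~ epsilon2 p p).
  by rewrite vv -mulrzAr -mulrzA epsilon2_sqr.
by rewrite mulrA v1 mul1r.
Qed.

Lemma quat_unit_star a b : star (e a b) = e b a.
Proof.
rewrite /quat_unit starZ star_sum; congr (_ *: _).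
  by rewrite fmorphV rmorph_nat.
apply: eq_bigr => p _.
rewrite starZ rmorph_int twisted_rep_star -[in LHS](scaler_int (epsilon2 p p) (v p)).
rewrite scalerA -rmorphM mulrC.
by rewrite -quat_tr.
Qed.

Let scaler_mul3 (r s : C) (x y z : D) : (r *: x) * y * (s *: z) = (r * s) *: (x * y * z).
Proof. by rewrite -!scalerAl -scalerAr scalerA. Qed.

(** Both sides are the trace of the matrix of x e_ba: averaging over an
    orthogonal basis of unitaries projects onto the commutant. *)
Lemma entry_average x a b :
  entry e x a b = c4^-1 *: \sum_p v p * (x * e b a) * star (v p).
Proof.
transitivity (c4^-1 *: \sum_c \sum_d \sum_c' \sum_d'
    (\sum_p q_ p c d * q_ p c' d') *: (e c d * (x * e b a) * e d' c')); last first.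
  congr (_ *: _).
  under eq_bigr do under eq_bigr do under eq_bigr do under eq_bigr do rewrite scaler_suml.
  under eq_bigr do under eq_bigr do under eq_bigr do rewrite exchange_big.
  under eq_bigr do under eq_bigr do rewrite exchange_big.
  under eq_bigr do rewrite exchange_big.
  rewrite exchange_big; apply: eq_bigr => p _.
  rewrite [in RHS]quat_unitK 2!mulr_suml; apply: eq_bigr => c _.
  rewrite 2!mulr_suml; apply: eq_bigr => d _.
  rewrite star_sum mulr_sumr; apply: eq_bigr => c' _.
  rewrite star_sum mulr_sumr; apply: eq_bigr => d' _.
  by rewrite starZ rmorph_int quat_unit_star [in RHS]scaler_mul3.
rewrite scaler_sumr; apply: eq_bigr => c _.
rewrite (bigD1 a)//= [X in _ + X]big1 ?addr0 => [|d da].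
  rewrite (bigD1 c)//= [X in _ + X]big1 ?addr0 => [|c' cc'].
    rewrite (bigD1 a)//= [X in _ + X]big1 ?addr0 => [|d' dd'].
      rewrite sum_quatM !eqxx scalerA mulVf// scale1r.
      by rewrite !mulrA -[_ * e b a * _]mulrA quat_unit_mul eqxx.
    by rewrite sum_quatM eqxx eq_sym (negbTE dd') scale0r.
  by rewrite big1// => d' _; rewrite sum_quatM eq_sym (negbTE cc') scale0r.
rewrite big1// => c' _; rewrite big1// => d' _; rewrite sum_quatM.
case: ifP => [/andP[_ /eqP <-]|_]; last by rewrite scale0r.
by rewrite !mulrA -[_ * e b a * _]mulrA quat_unit_mul eq_sym (negbTE da) mulr0 scaler0.
Qed.

End twisted_representation.

(** * The rank-one projection behind a covariant magic square *)

Section covariant_projection.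
Variables (R : realType) (D : cstarType R) (v : 'I_4 * 'I_4 -> D) (P : D).
Hypothesis v_unitary : forall p, unitary (v p).
Hypothesis v_mul : forall p q, v p * v q = v (klein2 p q) *~ epsilon2 p q.
Hypothesis P_proj : projection P.
Local Notation pp p := (v p * P * star (v p)).
Hypothesis row_sum : forall k, \sum_l pp (k, l) = 1.
Hypothesis col_sum : forall l, \sum_k pp (k, l) = 1.
Local Notation C := R[i].
Local Notation e := (quat_unit v).
Local Notation q_ p a b := ((quat p a b)%:~R : C).
Local Notation c4 := (4%:R : C).
Local Notation f := (entry e P).

Let e_mul := quat_unit_mul v_mul.
Let e_sum := quat_unit_sum v_unitary v_mul.
Let e_star := quat_unit_star v_unitary v_mul.

Lemma conj_projection p : projection (pp p).
Proof.
have [sP PP] := P_proj; have [v1 _] := v_unitary p; split.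
  by rewrite !starM starK sP mulrA.
by rewrite !mulrA -[_ * star _ * v p]mulrA v1 mulr1 -[_ * P * P]mulrA PP.
Qed.

Lemma conj_projection0 : pp (0, 0) = P.
Proof. by rewrite (twisted_rep1 v_unitary v_mul) star1 mul1r mulr1. Qed.

(** P is orthogonal to the other entries of its row and of its column. *)
Lemma compress_unitary p : (p.1 == 0) != (p.2 == 0) -> P * v p * P = 0.
Proof.
move=> p0; suff h : P * pp p = 0.
  have [v1 _] := v_unitary p.
  have -> : P * v p * P = (P * pp p) * v p.
    by rewrite !mulrA -[_ * star _ * v p]mulrA v1 mulr1.
  by rewrite h mul0r.
rewrite -{1}conj_projection0; case: p p0 => k l /=.
have [->|k0] := eqVneq k 0; have [->|l0] := eqVneq l 0 => // _.
  apply: (projections_orthogonal (P := fun j => pp (0, j))) => [j||].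
  - exact: conj_projection.
  - exact: row_sum.
  - by rewrite eq_sym.
apply: (projections_orthogonal (P := fun j => pp (j, 0))) => [j||].
- exact: conj_projection.
- exact: col_sum.
- by rewrite eq_sym.
Qed.

(** The matrix E_cd - E_dc is a combination of the antisymmetric matrices quat p. *)
Lemma compress_quat_unit c d : P * e c d * P = P * e d c * P.
Proof.
rewrite /quat_unit -!scalerAr -!scalerAl; congr (_ *: _).
rewrite !mulr_sumr !mulr_suml; apply: eq_bigr => p _.
rewrite -!scalerAr -!scalerAl.
have [p0|p0] := boolP ((p.1 == 0) == (p.2 == 0)); last by rewrite compress_unitary ?scaler0.
by rewrite (quat_sym _ _ (eqP p0)).
Qed.

(** P e_cd P = P e_dc P says on entries that the 2 x 2 minors of f vanish. *)
Lemma entry_exchange a b c d : f a c * f d b = f a d * f c b.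
Proof.
have h c' d' : entry e (P * e c' d' * P) a b = f a c' * f d' b.
  rewrite (entryM e_mul e_sum) (bigD1 d')//= big1 ?addr0 => [|j /negbTE jd].
    rewrite (entryM e_mul e_sum) (bigD1 c')//= big1 ?addr0 => [|j /negbTE jc].
      by rewrite (entry_e e_mul e_sum) !eqxx mulr1.
    by rewrite (entry_e e_mul e_sum) jc mulr0.
  rewrite (entryM e_mul e_sum) big1 ?mul0r// => i _.
  by rewrite (entry_e e_mul e_sum) [d' == j]eq_sym jd andbF mulr0.
by rewrite -!h compress_quat_unit.
Qed.

Let sgn p q : C := (commsign p.1 q.1 * commsign p.2 q.2)%:~R.

Lemma twisted_rep_commute p q : v p * v q = sgn p q *: (v q * v p).
Proof.
rewrite !v_mul /klein2 (klein_comm p.1) (klein_comm p.2) /epsilon2.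
rewrite (epsilon_comm p.1) (epsilon_comm p.2) /sgn scaler_int -mulrzA.
by congr (_ *~ _); ring.
Qed.

(** The Fourier coefficients of the magic square for the characters of the
    Klein group. *)
Let spectral_sum q : D := \sum_p sgn p q *: pp p.

(** As the rows and the columns have sum 1, a coefficient vanishes if exactly
    one of its two characters is trivial. *)
Lemma spectral_sum0 q : (q.1 == 0) != (q.2 == 0) -> spectral_sum q = 0.
Proof.
rewrite /spectral_sum.
have comm0 (m : 'I_4) : m != 0 -> \sum_i (commsign i m)%:~R *: (1 : D) = 0.
  move=> m0; rewrite -scaler_suml -rmorph_sum sum_commsign (negbTE m0).
  by rewrite rmorph0 scale0r.
case: q => m n /=; have [->|m0] := eqVneq m 0; have [->|n0] := eqVneq n 0 => // _.
- rewrite -[RHS](comm0 _ n0).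
  transitivity (\sum_j \sum_i (commsign j n)%:~R *: pp (i, j)).
    rewrite exchange_big pair_bigA; apply: eq_bigr => -[i j] _.
    by rewrite /sgn /= commsign0 mul1r.
  by apply: eq_bigr => j _; rewrite -scaler_sumr col_sum.
- rewrite -[RHS](comm0 _ m0).
  transitivity (\sum_i \sum_j (commsign i m)%:~R *: pp (i, j)).
    rewrite pair_bigA; apply: eq_bigr => -[i j] _.
    by rewrite /sgn /= commsign0 mulr1.
  by apply: eq_bigr => i _; rewrite -scaler_sumr row_sum.
Qed.

(** The average in entry_average, with e_ba expanded in the unitaries: moving
    v p past v q produces the sign of a character. *)
Lemma entry_spectral a b :
  f a b = c4^-1 *: \sum_q (c4^-1 * q_ q b a) *: (spectral_sum q * v q).
Proof.
rewrite (entry_average v_unitary v_mul); congr (_ *: _).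
transitivity (\sum_p \sum_q (c4^-1 * q_ q b a) *: (sgn p q *: pp p * v q)).
  apply: eq_bigr => p _; rewrite /quat_unit -!scalerAr -scalerAl.
  rewrite !mulr_sumr mulr_suml scaler_sumr; apply: eq_bigr => q _.
  rewrite -!scalerAr -!scalerAl scalerA; congr (_ *: _).
  have [v1 _] := v_unitary p; have [_ v2] := v_unitary p.
  rewrite -[X in v p * (X * _)]mulr1 -v1 !mulrA -[_ * v p * v q]mulrA twisted_rep_commute.
  by rewrite -scalerAr -scalerAl !mulrA -[_ * v p * star _]mulrA v2 mulr1.
rewrite exchange_big; apply: eq_bigr => q _.
by rewrite /spectral_sum mulr_suml scaler_sumr.
Qed.

(** Only the symmetric matrices quat q have nonzero coefficients. *)
Lemma entry_sym a b : f a b = f b a.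
Proof.
rewrite !entry_spectral; congr (_ *: _); apply: eq_bigr => q _.
have [q0|q0] := boolP ((q.1 == 0) == (q.2 == 0));
  last by rewrite spectral_sum0// mul0r !scaler0.
by rewrite (quat_sym _ _ (eqP q0)).
Qed.

Lemma entry_trace : \sum_a f a a = 1.
Proof.
under eq_bigr do rewrite (entry_average v_unitary v_mul).
rewrite -scaler_sumr exchange_big.
transitivity (c4^-1 *: \sum_p pp p).
  congr (_ *: _); apply: eq_bigr => p _.
  by rewrite -mulr_suml -!mulr_sumr e_sum mulr1.
transitivity (c4^-1 *: \sum_k \sum_l pp (k, l)).
  by rewrite pair_bigA; congr (_ *: _); apply: eq_bigr => -[].
under eq_bigr do rewrite row_sum.
rewrite sumr_const card_ord (_ : 1 *+ 4 = c4 *: (1 : D)); last by rewrite scaler_nat.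
by rewrite scalerA mulVf ?pnatr_eq0// scale1r.
Qed.

Lemma entry_sa a b : star (f a b) = f a b.
Proof.
by have [sP _] := P_proj; rewrite (entry_star e_star) sP entry_sym.
Qed.

Lemma entry_idem a b : \sum_c f a c * f c b = f a b.
Proof. by have [_ PP] := P_proj; rewrite -(entryM e_mul e_sum) PP. Qed.

(** Symmetry swaps the outer pairs of indices in f_ab f_cd and the vanishing
    minors swap the inner one, so that all permutations are allowed. *)
Lemma entry_commute a b c d : f a b * f c d = f c d * f a b.
Proof.
by rewrite entry_exchange (entry_sym a c) (entry_sym b d) entry_exchange.
Qed.

Local Notation RP := (real_projective_space R 3).

(** The calculus for f takes place in the bicommutant of the entries of f, and
    therefore commutes with the matrix units. *)
Lemma covariant_calculus : exists Phi : contC R RP -> D,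
  [/\ forall a g h, Phi (Ccst RP a * g + h) = a *: Phi g + Phi h,
      Phi 1 = 1, forall g h, Phi (g * h) = Phi g * Phi h,
      forall g, Phi (Cconj g) = star (Phi g) &
      forall (g : contC R RP) i j, (forall x,
        Cfun g x = (RPmx x i j)%:C) -> Phi g = f i j] /\
  forall g a b, e a b * Phi g = Phi g * e a b.
Proof.
pose F (p : 'I_4 * 'I_4) := f p.1 p.2.
have Fsa p : star (F p) = F p by exact: entry_sa.
have FC p q : F p * F q = F q * F p by exact: entry_commute.
pose E := bicommutant_of Fsa FC; pose w : E -> D := @bicommutant_val _ _ _ _ Fsa FC.
have w_inj : injective w by exact: bicommutant_val_inj.
have [wL [w1 wM] wS] : star_hom w := bicommutant_val_star_hom Fsa FC.
pose fE : 'M[E]_4 := \matrix_(i, j) (Sub (F (i, j)) (@bicommutant_mem R D _ F (i, j)) : E).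
have fEw i j : w (fE i j) = f i j by rewrite mxE; exact: SubK.
have wsum (I : Type) (s : seq I) (G : I -> E) : w (\sum_(i <- s) G i) = \sum_(i <- s) w (G
  i).
  exact: (raddf_sum (w : {linear E -> D})).
have [||||Phi [PL P1 PM PS PF]] :=
  @functional_calculus R RP 3 (@RPmx R 3) (@RPmx_cts R 3) (@RPmx_inj R 3) (@RPmx_surj R 3)
    E fE.
- by move=> i j; apply: w_inj; rewrite wS fEw entry_sa.
- by apply/matrixP => i j; rewrite mxE; apply: w_inj; rewrite !fEw entry_sym.
- apply/matrixP => i j; apply: w_inj; rewrite fEw mxE wsum -[RHS]entry_idem.
  by apply: eq_bigr => k _; rewrite wM !fEw.
- apply: w_inj; rewrite wsum w1 -[RHS]entry_trace.
  by apply: eq_bigr => k _; rewrite fEw.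
exists (w \o Phi); split; first split.
- by move=> a g h /=; rewrite PL wL.
- by rewrite /= P1.
- by move=> g h /=; rewrite PM wM.
- by move=> g /=; rewrite PS wS.
- by move=> g i j gF /=; rewrite (PF g i j gF) fEw.
move=> g a b; have /bicommutantP wg := bicommutant_valP (Phi g).
by apply/esym/wg => -[c d]; rewrite /F /= (entry_comm e_mul).
Qed.

End covariant_projection.

(** * Star homomorphisms *)

Section star_homs.
Variables (R : realType) (A B : cstarType R) (f : A -> B).
Hypothesis fH : star_hom f.

Lemma star_hom0 : f 0 = 0.
Proof.
have [fL _ _] := fH; have := fL 1 0 0; rewrite !scale1r addr0 => f00.
by apply: (addrI (f 0)); rewrite addr0 -f00.
Qed.

Lemma star_homD x y : f (x + y) = f x + f y.
Proof. by have [fL _ _] := fH; have := fL 1 x y; rewrite !scale1r. Qed.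

Lemma star_homZ a x : f (a *: x) = a *: f x.
Proof. by have [fL _ _] := fH; have := fL a x 0; rewrite star_hom0 !addr0. Qed.

Lemma star_hom_sum (I : Type) (s : seq I) (G : I -> A) :
  f (\sum_(i <- s) G i) = \sum_(i <- s) f (G i).
Proof. exact: (big_morph f star_homD star_hom0). Qed.

Lemma star_hom1 : f 1 = 1. Proof. by have [_ [f1 _] _] := fH. Qed.

Lemma star_homM x y : f (x * y) = f x * f y.
Proof. by have [_ [_ fM] _] := fH. Qed.

Lemma star_hom_star x : f (star x) = star (f x).
Proof. by have [_ _ fS] := fH. Qed.

Lemma star_hom_magic (p : 'I_4 -> 'I_4 -> A) :
  magic_square p -> magic_square (fun i j => f (p i j)).
Proof.
move=> [pP pc pr]; split=> [i j|j|i].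
- by have [sp pp] := pP i j; split; rewrite -?star_hom_star -?star_homM ?sp ?pp.
- by rewrite -star_hom_sum pc star_hom1.
- by rewrite -star_hom_sum pr star_hom1.
Qed.

End star_homs.

Lemma star_hom_comp (R : realType) (A B D : cstarType R) (g : B -> D) (f : A -> B) :
  star_hom g -> star_hom f -> star_hom (g \o f).
Proof.
move=> [gL [g1 gM] gS] [fL [f1 fM] fS]; split.
- by move=> a x y /=; rewrite fL gL.
- by split=> [|x y] /=; rewrite ?f1 ?g1 ?fM ?gM.
- by move=> x /=; rewrite fS gS.
Qed.

Lemma star_hom_conj (R : realType) (A B : cstarType R) (f : A -> B) (u : B) :
  unitary u -> star_hom f -> star_hom (fun x => u * f x * star u).
Proof.
move=> [u1 u2] [fL [f1 fM] fS]; split.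
- by move=> a x y /=; rewrite fL mulrDr mulrDl -scalerAr -scalerAl.
- split=> [|x y] /=; first by rewrite f1 mulr1.
  by rewrite fM !mulrA -[_ * star u * u]mulrA u1 mulr1.
- by move=> x /=; rewrite !starM starK fS mulrA.
Qed.

(** The images of p under f form a magic square, so the uniqueness in its
    universal property applies. *)
Lemma universal_magic_unique (R : realType) (A : cstarType R) (p : 'I_4 -> 'I_4 -> A)
    (D : cstarType R) (f g : A -> D) :
  universal_magic_square p -> star_hom f -> star_hom g ->
  (forall i j, f (p i j) = g (p i j)) -> f = g.
Proof.
move=> [pM pU] fH gH fg.
have [h [_ hU]] := pU D _ (star_hom_magic fH pM).
by rewrite -(hU f)// -(hU g)//; split => // i j; rewrite fg.
Qed.

(** * Homomorphisms from M_n(C(X)) *)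

Section matrix_representation.
Variables (R : realType) (X : compactType) (D : cstarType R) (n : nat).
Variables (e : 'I_n.+1 -> 'I_n.+1 -> D) (Phi : contC R X -> D).
Hypothesis e_mul : forall a b c d, e a b * e c d = if b == c then e a d else 0.
Hypothesis e_sum : \sum_a e a a = 1.
Hypothesis e_star : forall a b, star (e a b) = e b a.
Hypothesis Phi_lin : forall a g h, Phi (Ccst X a * g + h) = a *: Phi g + Phi h.
Hypothesis Phi1 : Phi 1 = 1.
Hypothesis PhiM : forall g h, Phi (g * h) = Phi g * Phi h.
Hypothesis Phi_conj : forall g, Phi (Cconj g) = star (Phi g).
Hypothesis Phi_e : forall g a b, e a b * Phi g = Phi g * e a b.
Local Notation M := (mx_contC R X n.+1).

Definition mx_rep (N : M) : D := \sum_a \sum_b Phi (N a b) * e a b.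

Lemma calculusD g h : Phi (g + h) = Phi g + Phi h.
Proof.
have := Phi_lin 1 g h; rewrite scale1r => <-; congr Phi; congr (_ + _).
by apply: CcontP => x; exact/esym/mul1r.
Qed.

Lemma calculus0 : Phi 0 = 0.
Proof. by apply: (addrI (Phi 0)); rewrite -calculusD !addr0. Qed.

Lemma calculus_sum (I : Type) (s : seq I) (G : I -> contC R X) :
  Phi (\sum_(i <- s) G i) = \sum_(i <- s) Phi (G i).
Proof. exact: (big_morph Phi calculusD calculus0). Qed.

Lemma calculus_cst a : Phi (Ccst X a) = a%:A.
Proof.
have := Phi_lin a 1 0; rewrite calculus0 Phi1 !addr0 => <-; congr Phi.
by apply: CcontP => x; exact/esym/mulr1.
Qed.

Lemma mx_rep_star_hom : star_hom mx_rep.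
Proof.
split.
- move=> a x y; rewrite /mx_rep scaler_sumr -big_split; apply: eq_bigr => i _ /=.
  rewrite scaler_sumr -big_split; apply: eq_bigr => j _ /=.
  by rewrite scalerAl -mulrDl -Phi_lin !mxE.
- split=> [|x y].
    rewrite -e_sum; apply: eq_bigr => a _;
      rewrite (bigD1 a)//= big1 ?addr0 => [|b /negbTE ba].
      by rewrite mxE eqxx Phi1 mul1r.
    by rewrite mxE eq_sym ba calculus0 mul0r.
  rewrite /mx_rep mulr_suml; apply: eq_bigr => a _.
  transitivity (\sum_b \sum_c Phi (x a c) * Phi (y c b) * e a b).
    by apply: eq_bigr => b _; rewrite mxE calculus_sum mulr_suml; apply: eq_bigr => c _;
      rewrite PhiM.
  rewrite exchange_big mulr_suml; apply: eq_bigr => c _.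
  rewrite mulr_sumr [RHS](bigD1 c)//= [X in _ + X]big1 ?addr0 => [|d /negbTE dc].
    rewrite mulr_sumr; apply: eq_bigr => b _.
    by rewrite mulrA -[_ * e a c * _]mulrA Phi_e mulrA -[RHS]mulrA e_mul eqxx.
  rewrite mulr_sumr big1// => b _.
  by rewrite mulrA -[_ * e a c * _]mulrA Phi_e mulrA -[LHS]mulrA e_mul eq_sym dc mulr0.
- move=> x; rewrite /mx_rep star_sum exchange_big; apply: eq_bigr => a _.
  rewrite star_sum; apply: eq_bigr => b _.
  by rewrite mxE starM e_star -Phi_conj Phi_e.
Qed.

End matrix_representation.

(** * The covariant magic square on the projective space *)

Section concrete_magic_square.
Variable R : realType.
Local Notation RP := (real_projective_space R 3).
Local Notation M := (mx_contC R RP 4).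
Local Notation C := R[i].

Fact Ccst_is_zmod_morphism : zmod_morphism (Ccst (R := R) RP).
Proof. by move=> a b; apply: CcontP. Qed.
Fact Ccst_is_monoid_morphism : monoid_morphism (Ccst (R := R) RP).
Proof. by split=> [|a b]; apply: CcontP. Qed.
HB.instance Definition _ := GRing.isZmodMorphism.Build C (contC R RP) (Ccst (R :=
  R) RP) Ccst_is_zmod_morphism.
HB.instance Definition _ := GRing.isMonoidMorphism.Build C (contC R RP) (Ccst (R :=
  R) RP) Ccst_is_monoid_morphism.

Lemma mx_contC_scaleE a (x : M) i j : (a *: x) i j = Ccst RP a * x i j.
Proof. by rewrite mxE. Qed.

Lemma mx_contC_starE (x : M) i j : (star x) i j = Cconj (x j i).
Proof. by rewrite mxE. Qed.

Lemma mx_contC_mulE (x y : M) i j : (x * y) i j = \sum_k x i k * y k j.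
Proof. by rewrite mxE. Qed.

Lemma mx_contC_sumE (I : Type) (s : seq I) (G : I -> M) i j :
  (\sum_(k <- s) G k) i j = \sum_(k <- s) G k i j.
Proof. by rewrite summxE. Qed.

Definition quat_mx p : M := \matrix_(a, b) (quat p a b)%:~R.
Definition coord_mx : M := \matrix_(a, b) coordinate (@RPmx_cts R 3) a b.
Local Notation V := quat_mx.
Local Notation F := coord_mx.

Lemma Cconj_int (z : int) : Cconj (z%:~R : contC R RP) = z%:~R.
Proof.
have zE : (z%:~R : contC R RP) = Ccst RP z%:~R by rewrite rmorph_int.
by rewrite zE; apply: CcontP => x; exact: (rmorph_int (@conjc R)).
Qed.

Lemma quat_mx_mul p q : V p * V q = V (klein2 p q) *~ epsilon2 p q.
Proof.
rewrite -scaler_int; apply/matrixP => a b.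
rewrite mx_contC_scaleE rmorph_int mx_contC_mulE [in RHS]mxE -rmorphM -quat_mul rmorph_sum.
by apply: eq_bigr => c _; rewrite !mxE rmorphM.
Qed.

Lemma quat_mx_unitary p : unitary (V p).
Proof.
split; apply/matrixP => a b; rewrite mx_contC_mulE [RHS]mxE.
  transitivity ((epsilon2 p p * \sum_c quat p a c * quat p c b)%:~R : contC R RP).
    rewrite mulr_sumr rmorph_sum; apply: eq_bigr => c _.
    by rewrite mx_contC_starE !mxE Cconj_int -rmorphM mulrA -quat_tr.
  by rewrite quat_mul mulrA epsilon2_sqr mul1r /klein2 !klein_diag quat00; case: eqP.
transitivity ((epsilon2 p p * \sum_c quat p a c * quat p c b)%:~R : contC R RP).
  rewrite mulr_sumr rmorph_sum; apply: eq_bigr => c _.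
  by rewrite mx_contC_starE !mxE Cconj_int -rmorphM mulrCA -quat_tr.
by rewrite quat_mul mulrA epsilon2_sqr mul1r /klein2 !klein_diag quat00; case: eqP.
Qed.

Lemma coord_mxE a b x : Cfun (F a b) x = (RPmx x a b)%:C.
Proof. by rewrite mxE. Qed.

Lemma RPmx_sym (x : RP) a b : RPmx x a b = RPmx x b a.
Proof. by rewrite !mxE; apply: eq_bigr => k _; rewrite !mxE mulrC. Qed.

Lemma coord_mx_projection : projection F.
Proof.
split; apply/matrixP => a b; apply: CcontP => x.
  rewrite mx_contC_starE -[LHS]/((Cfun (F b a) x)^*) !coord_mxE RPmx_sym.
  by apply/eqP; rewrite eq_complex /= oppr0 !eqxx.
rewrite mx_contC_mulE Cfun_sum coord_mxE.
have -> : RPmx x a b = (RPmx x *m RPmx x) a b.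
  by rewrite /RPmx mulmxA -(mulmxA _ _ (val (repr x))^T) sphere_mul_tr mulmx1.
rewrite mxE rmorph_sum; apply: eq_bigr => k _.
by rewrite -[LHS]/(Cfun (F a k) x * Cfun (F k b) x) !coord_mxE rmorphM.
Qed.

Lemma coord_mx_trace : \sum_a F a a = 1.
Proof.
apply: CcontP => x; rewrite Cfun_sum.
transitivity ((\tr (RPmx x))%:C : C).
  by rewrite rmorph_sum; apply: eq_bigr => a _; rewrite coord_mxE.
by rewrite /RPmx mxtrace_mulC sphere_mul_tr mxtrace1.
Qed.

Local Notation q_ p := (V p * F * star (V p)).

(** The conjugates of x x^T by the orthogonal matrices quat (s i) project to the
    lines through orthogonal vectors; as F is symmetric, the polarised identity
    suffices, at the price of a factor 2. *)
Lemma coord_mx_line (I : finType) (s : I -> 'I_4 * 'I_4) :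
  (forall a b c d, \sum_i (quat (s i) a c * quat (s i) b d + quat (s i) a d * quat (s i) b
    c) =
    if (a == b) && (c == d) then 2 else 0) ->
  \sum_i q_ (s i) = 1.
Proof.
move=> sP; apply/matrixP => a b; rewrite mx_contC_sumE [RHS]mxE.
have double_inj (g h : contC R RP) : g + g = h + h -> g = h.
  move=> gh; apply: CcontP => x.
  have half (z : C) : z = 2%:R^-1 * (z + z).
    by rewrite -mulr2n -[z *+ 2]mulr_natl mulrA mulVf ?pnatr_eq0// mul1r.
  rewrite (half (Cfun g x)) (half (Cfun h x)); congr (_ * _).
  exact: (congr1 (fun k => Cfun k x) gh).
apply: double_inj.
have symF c d : F c d = F d c by apply: CcontP => x; rewrite !coord_mxE RPmx_sym.
pose Q i c d : contC R RP := (quat (s i) c d)%:~R.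
have qE i : (q_ (s i)) a b = \sum_c \sum_d Q i a c * Q i b d * F c d.
  rewrite mx_contC_mulE exchange_big; apply: eq_bigr => d _.
  rewrite mx_contC_starE [V _ b d]mxE Cconj_int mx_contC_mulE mulr_suml.
  by apply: eq_bigr => c _; rewrite mxE /Q; ring.
transitivity (\sum_c \sum_d (\sum_i (Q i a c * Q i b d + Q i a d * Q i b c)) * F c d).
  transitivity (\sum_i \sum_c \sum_d (Q i a c * Q i b d + Q i a d * Q i b c) * F c d).
    rewrite -big_split; apply: eq_bigr => i _ /=.
    rewrite {2}qE exchange_big qE -big_split; apply: eq_bigr => c _ /=.
    rewrite -big_split; apply: eq_bigr => d _ /=.
    by rewrite (symF d c); ring.
  rewrite exchange_big; apply: eq_bigr => c _.
  by rewrite exchange_big; apply: eq_bigr => d _; rewrite mulr_suml.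
have inner c d : \sum_i (Q i a c * Q i b d + Q i a d * Q i b c) =
    if (a == b) && (c == d) then 2 else 0.
  transitivity ((\sum_i (quat (s i) a c * quat (s i) b d +
      quat (s i) a d * quat (s i) b c))%:~R : contC R RP).
    by rewrite rmorph_sum; apply: eq_bigr => i _; rewrite rmorphD !rmorphM.
  by rewrite sP; case: ifP.
under eq_bigr do under eq_bigr do rewrite inner.
have [_|_] := eqVneq a b; last by rewrite big1 ?addr0// => c _; rewrite big1// => d _;
  rewrite mul0r.
transitivity (2 * \sum_c F c c); last by rewrite coord_mx_trace mulr1.
rewrite mulr_sumr; apply: eq_bigr => c _.
rewrite (bigD1 c)//= eqxx [X in _ + X = _]big1 ?addr0// => d /negbTE dc.
by rewrite eq_sym dc mul0r.
Qed.

Lemma concrete_magic_square : magic_square (fun i j => q_ (i, j)).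
Proof.
split=> [i j|j|i].
- exact: (conj_projection quat_mx_unitary coord_mx_projection).
- by apply: (coord_mx_line (s := fun i => (i, j))) => a b c d; exact: quat_col.
- by apply: (coord_mx_line (s := fun j => (i, j))) => a b c d; exact: quat_row.
Qed.

Lemma quat_unit_mx a b : quat_unit V a b = delta_mx a b.
Proof.
apply/matrixP => c d; rewrite mx_contC_scaleE mx_contC_sumE [RHS]mxE.
transitivity (Ccst RP (4%:R^-1 * \sum_p (quat p a b)%:~R * (quat p c d)%:~R : C)).
  rewrite rmorphM; congr (_ * _); rewrite rmorph_sum; apply: eq_bigr => p _.
  by rewrite mx_contC_scaleE rmorphM [V p c d]mxE !rmorph_int.
rewrite sum_quatM [a == c]eq_sym [b == d]eq_sym; case: ifP => _.
  by rewrite mulVf ?pnatr_eq0// rmorph1.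
by rewrite mulr0 rmorph0.
Qed.

End concrete_magic_square.

(** * The isomorphism *)

Section scalar_matrices.
Variables (R : realType) (X : compactType) (n : nat).
Local Notation M := (mx_contC R X n.+1).
Implicit Types (Y : M).

Lemma delta_mx_mulE a b Y i j : ((delta_mx a b : M) * Y) i j = if i == a then Y b j else 0.
Proof.
rewrite mxE (bigD1 b)//= big1 ?addr0 => [|k /negbTE kb].
  by rewrite mxE eqxx andbT; case: ifP => _; rewrite ?mul1r ?mul0r.
by rewrite mxE kb andbF mul0r.
Qed.

Lemma mul_delta_mxE a b Y i j : (Y * (delta_mx a b : M)) i j = if j == b then Y i a else 0.
Proof.
rewrite mxE (bigD1 a)//= big1 ?addr0 => [|k /negbTE ka].
  by rewrite mxE eqxx /=; case: ifP => _; rewrite ?mulr1 ?mulr0.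
by rewrite mxE ka mulr0.
Qed.

Lemma commute_delta_mx Y : (forall a b, (delta_mx a b : M) * Y = Y * delta_mx a b) ->
  forall i j, Y i j = if i == j then Y 0 0 else 0.
Proof.
move=> Yc i j; have := congr1 (fun Z : M => Z 0 j) (Yc 0 i).
by rewrite delta_mx_mulE mul_delta_mxE eqxx eq_sym.
Qed.

End scalar_matrices.

Theorem theoremA (R : realType)
    (A : cstarType R) (p : 'I_4 -> 'I_4 -> A)
    (alpha : 'S_4 * 'S_4 -> A -> A)
    (B : cstarType R) (iota : A -> B) (u : 'I_4 -> 'I_4 -> B)
    (A4 : universal_magic_square p)
    (actS4S4 : magic_action p alpha)
    (crossed : twisted_crossed_product alpha iota u) :
  cstar_isomorphic B (mx_contC R (real_projective_space R 3) 4).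
Proof.
pose RP := real_projective_space R 3; pose M := mx_contC R RP 4.
pose V := @quat_mx R; pose F : M := coord_mx R.
have [_ [iotaH u_unitary u_conj u_mul] B_univ] := crossed.
have [p_magic A_univ] := A4.
have VU : forall q, unitary (V q) := @quat_mx_unitary R.
have VM : forall q q', V q * V q' = V (klein2 q q') *~ epsilon2 q q' := @quat_mx_mul R.
(* Psi comes from the universal properties of A and of B. *)
have [psi [[psiH psi_p] _]] := A_univ M _ (concrete_magic_square R).
have cov : twisted_covariant alpha psi (fun i j => V (i, j)).
  split => // i j x.
  have [alphaH alpha_p] := actS4S4 (klein i) (klein j).
  suff /(congr1 (@^~ x)) : (fun x => V (i, j) * psi x * star (V (i, j))) =
      psi \o alpha (klein i, klein j) by [].
  apply: (universal_magic_unique A4); first exact: star_hom_conj.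
    exact: star_hom_comp.
  move=> k l; rewrite /= alpha_p !psi_p.
  have -> : V (i, j) * (V (k, l) * F * star (V (k, l))) * star (V (i, j)) =
      (V (i, j) * V (k, l)) * F * star (V (i, j) * V (k, l)) by rewrite starM !mulrA.
  rewrite VM /klein2 /=; set s := epsilon2 _ _; set W := V (klein i k, klein j l).
  have -> : star (W *~ s) = star W *~ s.
    by rewrite -(scaler_int s W) starZ rmorph_int scaler_int.
  by rewrite mulrzAl mulrzAl mulrzAr -mulrzA epsilon2_sqr.
have [Psi [[PsiH Psi_iota Psi_u] _]] := B_univ M psi _ cov.
(* Theta: B is the algebra of 4 x 4 matrices over the commutant of u, and the
   functions on the projective space map to this commutant. *)
pose v q := u q.1 q.2; pose P := iota (p 0 0).
have vU q : unitary (v q) by exact: u_unitary.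
have vM q q' : v q * v q' = v (klein2 q q') *~ epsilon2 q q' by exact: u_mul.
have PP : projection P.
  by have [iP _ _] := star_hom_magic iotaH p_magic; exact: iP.
have conjP i j : v (i, j) * P * star (v (i, j)) = iota (p i j).
  by rewrite u_conj; have [_ ->] := actS4S4 (klein i) (klein j); rewrite !klein0.
have [_ pcol prow] := star_hom_magic iotaH p_magic.
have row k : \sum_l v (k, l) * P * star (v (k, l)) = 1.
  by under eq_bigr do rewrite conjP; exact: prow.
have col l : \sum_k v (k, l) * P * star (v (k, l)) = 1.
  by under eq_bigr do rewrite conjP; exact: pcol.
have [Phi [[PhiL Phi1 PhiM Phi_conj PhiF] Phi_e]] := covariant_calculus vU vM PP row col.
pose e := quat_unit v.
have e_mul : forall a b c d, e a b * e c d = if b == c then e a d else 0 :=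
  quat_unit_mul vM.
have e_sum : \sum_a e a a = 1 := quat_unit_sum vU vM.
have e_star := quat_unit_star vU vM : forall a b, star (e a b) = e b a.
pose Theta : M -> B := mx_rep e Phi.
have ThetaH : star_hom Theta by exact: mx_rep_star_hom.
have Theta_V q : Theta (V q) = v q.
  rewrite [RHS](quat_unitK v); apply: eq_bigr => a _; apply: eq_bigr => b _.
  rewrite mxE (_ : (quat q a b)%:~R = Ccst RP (quat q a b)%:~R); last by rewrite rmorph_int.
  by rewrite (calculus_cst PhiL Phi1) -scalerAl mul1r.
have Theta_F : Theta F = P.
  rewrite [RHS](entryE e_mul e_sum); apply: eq_bigr => a _; apply: eq_bigr => b _.
  by rewrite (PhiF _ a b)// => x; exact: coord_mxE.
exists Psi; split => //; exists Theta.
- (* Theta \o Psi and id extend the same covariant pair (iota, u). *)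
  have [h [_ h_uniq]] := B_univ B iota u (And4 iotaH u_unitary u_conj u_mul).
  have hT : h = Theta \o Psi.
    apply: h_uniq; split=> [|x|i j]; first exact: star_hom_comp.
    + rewrite /= Psi_iota; suff /(congr1 (@^~ x)) : Theta \o psi = iota by [].
      apply: (universal_magic_unique A4) => // [|i j]; first exact: star_hom_comp.
      rewrite /= psi_p (star_homM ThetaH) (star_homM ThetaH) (star_hom_star ThetaH).
      by rewrite Theta_V Theta_F conjP.
    + by rewrite /= Psi_u Theta_V.
  have hI : h = id.
    apply: h_uniq; split => //; split => //; split => //.
  by move=> b; have := congr1 (@^~ b) hT; rewrite hI.
- have Psi_e a b : Psi (e a b) = delta_mx a b.
    rewrite -[RHS]quat_unit_mx /e /quat_unit (star_homZ PsiH) (star_hom_sum PsiH).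
    congr (_ *: _); apply: eq_bigr => q _; rewrite (star_homZ PsiH) Psi_u.
    by case: q.
  have Psi_P : Psi P = F.
    rewrite /P Psi_iota psi_p; exact: (conj_projection0 F VU VM).
  pose Y g := Psi (Phi g).
  have Y_scalar g i j : (Y g) i j = if i == j then (Y g) 0 0 else 0.
    apply: commute_delta_mx => a b; rewrite -!Psi_e -!(star_homM PsiH).
    by rewrite Phi_e.
  (* At a point x the diagonal entry is a character of C(RP) with the same
     values as x on the coordinates. *)
  have YE g : (Y g) 0 0 = g.
    apply: CcontP => x.
    pose chi g' := Cfun ((Y g') 0 0) x.
    have chi_cst a : chi (Ccst RP a) = a.
      rewrite /chi /Y (calculus_cst PhiL Phi1) (star_homZ PsiH) (star_hom1 PsiH).
      by rewrite mx_contC_scaleE mxE; exact: mulr1.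
    have chiD g1 g2 : chi (g1 + g2) = chi g1 + chi g2.
      by rewrite /chi /Y (calculusD PhiL) (star_homD PsiH) mxE.
    have chiM g1 g2 : chi (g1 * g2) = chi g1 * chi g2.
      suff -> : chi (g1 * g2) = Cfun ((Y g1) 0 0 * (Y g2) 0 0) x by [].
      congr (Cfun _ x); rewrite {1}/Y PhiM (star_homM PsiH) mx_contC_mulE (bigD1 0)//= big1
        ?addr0//.
      by move=> k /negbTE k0; rewrite -/(Y g1) Y_scalar eq_sym k0 mul0r.
    have chi_zmod : zmod_morphism chi.
      by move=> g1 g2; apply: (addIr (chi g2)); rewrite subrK -chiD subrK.
    have chi_monoid : monoid_morphism chi.
      by split=> //; have := chi_cst 1; congr (_ = _); congr chi; exact: CcontP.
    pose chiZ := GRing.isZmodMorphism.Build _ _ chi chi_zmod.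
    pose chiMm := GRing.isMonoidMorphism.Build _ _ chi chi_monoid.
    pose chiR : {rmorphism contC R RP -> R[i]} := HB.pack chi chiZ chiMm.
    apply: (@character_eval R RP 3 (@RPmx R 3) (@RPmx_cts R 3) (@RPmx_inj R 3) chiR x
      chi_cst).
    move=> i j; rewrite -[RHS]coord_mxE /= /chi; congr (Cfun _ x).
    rewrite /Y (PhiF _ i j)// /entry (star_hom_sum PsiH) mx_contC_sumE (bigD1 0)//= big1
      ?addr0; last first.
      move=> k /negbTE k0; rewrite (star_homM PsiH) Psi_e mul_delta_mxE.
      by rewrite eq_sym k0.
    rewrite !(star_homM PsiH) !Psi_e Psi_P mul_delta_mxE eqxx delta_mx_mulE eqxx.
    by [].
  move=> N; apply/matrixP => i j; rewrite /Theta /mx_rep (star_hom_sum PsiH) mx_contC_sumE.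
  rewrite (bigD1 i)//= [X in _ + X]big1 ?addr0; last first.
    move=> a /negbTE ai; rewrite (star_hom_sum PsiH) mx_contC_sumE big1// => b _.
    rewrite (star_homM PsiH) Psi_e mul_delta_mxE -/(Y _) Y_scalar [i == a]eq_sym ai.
    by case: ifP.
  rewrite (star_hom_sum PsiH) mx_contC_sumE (bigD1 j)//= [X in _ + X]big1 ?addr0;
    last first.
    by move=> b /negbTE bj; rewrite (star_homM PsiH) Psi_e mul_delta_mxE eq_sym bj.
  by rewrite (star_homM PsiH) Psi_e mul_delta_mxE eqxx -/(Y _) Y_scalar eqxx YE.
Qed.
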